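(* Let $F$ be an algebraically closed field of characteristic zero, $G$ a finite group, and $A$ a finite dimensional $G$-graded algebra over $F$ with $A_{ss}\cong A_1\times\cdots\times A_q$ its decomposition into $G$-graded simple components. Then for each $i=1,\dots,q$ there exists a $G$-graded polynomial $m_i(X_G)$ such that (1) $m_i(X_G)$ is an $e$-central polynomial of $A_i$; and (2) $m_i(X_G)$ is a graded identity of every algebra $\Sigma$ satisfying: (a) $\Sigma$ is a finite dimensional $G$-graded simple algebra; (b) $\dim_F(\Sigma_g)=\dim_F((A_i)_g)$ for every $g\in G$; (c) $\mathrm{Id}_G(A_i)\not\supseteq\mathrm{Id}_G(\Sigma)$.
   Context: $A_{ss}$ is a maximal $G$-graded semisimple subalgebra supplementing the Jacobson radical of $A$. A $G$-graded polynomial is $e$-central for a $G$-graded algebra $R$ (with $e$ the identity of $G$) if it is multilinear, a nonidentity of $R$, and all its values on $R$ are central in $R$ and homogeneous of degree $e$. $\mathrm{Id}_G$ denotes the $T$-ideal of $G$-graded identities. *)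

(* Defs.v *)
(* finite-dimensional (possibly non-unital) associative
   G-graded algebras over a field, modelled as a vectType with an abstract
   bilinear associative product; graded polynomials as finitely supported
   functions on nonempty words in the graded variables x_{i,g}. *)
From HB Require Import structures.
From mathcomp Require Import all_boot all_order all_algebra all_fingroup all_field.
From mathcomp Require Import finmap.
Set Implicit Arguments. Unset Strict Implicit. Unset Printing Implicit Defensive.
Import GRing.Theory.
Local Open Scope ring_scope.

Section GradedAlgebras.
Variables (F : fieldType) (gT : finGroupType) (V : vectType F).
Variable mul : V -> V -> V.

Definition is_algebra : Prop :=
  [/\ forall a x y z, mul (a *: x + y) z = a *: mul x z + mul y z,
      forall a x y z, mul x (a *: y + z) = a *: mul x y + mul x z &
      forall x y z, mul x (mul y z) = mul (mul x y) z].

Definition prodv (U W : {vspace V}) : {vspace V} :=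
  (<< [seq mul u w | u <- vbasis U, w <- vbasis W] >>)%VS.

(* I^(n+1) *)
Definition vpow (I : {vspace V}) (n : nat) : {vspace V} :=
  iter n (fun W => prodv W I) I.

Definition nilpotentv (I : {vspace V}) : Prop := exists n, vpow I n = 0%VS.

Definition subalgebra (S : {vspace V}) : Prop := (prodv S S <= S)%VS.

Definition idealv (S I : {vspace V}) : Prop :=
  [/\ (I <= S)%VS, (prodv S I <= I)%VS & (prodv I S <= I)%VS].

Definition jacobson_radical (S J : {vspace V}) : Prop :=
  [/\ idealv S J, nilpotentv J &
      forall I, idealv S I -> nilpotentv I -> (I <= J)%VS].

Definition semisimple (S : {vspace V}) : Prop :=
  subalgebra S /\ jacobson_radical S 0%VS.

Definition is_grading (gr : gT -> {vspace V}) : Prop :=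
  [/\ directv (\sum_(g : gT) gr g)%VS,
      (\sum_(g : gT) gr g)%VS = fullv &
      forall g h, (prodv (gr g) (gr h) <= gr (g * h)%g)%VS].

Definition graded_subspace (gr : gT -> {vspace V}) (S : {vspace V}) : Prop :=
  (S <= \sum_(g : gT) (S :&: gr g))%VS.

Definition graded_subalgebra gr S := graded_subspace gr S /\ subalgebra S.

Definition graded_ideal gr (S I : {vspace V}) :=
  graded_subspace gr I /\ idealv S I.

Definition graded_simple gr (S : {vspace V}) : Prop :=
  [/\ graded_subalgebra gr S, prodv S S != 0%VS &
      forall I, graded_ideal gr S I -> I = 0%VS \/ I = S].

Definition graded_semisimple_subalgebra gr S :=
  graded_subalgebra gr S /\ semisimple S.

Definition max_graded_ss_supplement gr (S : {vspace V}) : Prop :=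
  [/\ graded_semisimple_subalgebra gr S,
      (exists J, [/\ jacobson_radical fullv J, directv (S + J)%VS &
                     (S + J)%VS = fullv]) &
      forall S', graded_semisimple_subalgebra gr S' -> (S <= S')%VS -> S' = S].
End GradedAlgebras.

(* Graded variables x_{i,g} are pairs (i, g); a nonempty word is a pair
   (first letter, remaining letters). Graded polynomials (elements of the
   free associative algebra F<X_G>) are finitely supported coefficient
   functions on nonempty words. *)
Definition gword (gT : finGroupType) := ((nat * gT) * seq (nat * gT))%type.
Definition gpoly (F : fieldType) (gT : finGroupType) :=
  {fsfun gword gT -> F with 0}.

Definition letters (gT : finGroupType) (w : gword gT) : seq (nat * gT) :=
  w.1 :: w.2.

Section Eval.
Variables (F : fieldType) (gT : finGroupType) (V : vectType F).
Variable mul : V -> V -> V.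

Definition eval_word (phi : nat * gT -> V) (w : gword gT) : V :=
  foldl (fun acc v => mul acc (phi v)) (phi w.1) w.2.

Definition geval (phi : nat * gT -> V) (p : gpoly F gT) : V :=
  \sum_(w <- finsupp p) p w *: eval_word phi w.

Definition graded_subst (gr : gT -> {vspace V}) (S : {vspace V})
  (phi : nat * gT -> V) : Prop :=
  forall v, phi v \in (S :&: gr v.2)%VS.

Definition graded_identity gr S (p : gpoly F gT) : Prop :=
  forall phi, graded_subst gr S phi -> geval phi p = 0.

Definition multilinear (p : gpoly F gT) : Prop :=
  exists s : seq (nat * gT), uniq s /\
    forall w, w \in finsupp p -> perm_eq (letters w) s.

Definition e_central gr S (p : gpoly F gT) : Prop :=
  [/\ multilinear p, ~ graded_identity gr S p &
      forall phi, graded_subst gr S phi ->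
        geval phi p \in (S :&: gr 1%g)%VS /\
        forall a, a \in S -> mul (geval phi p) a = mul a (geval phi p)].
End Eval.

(* Main.v *)
(** Let S be a graded simple algebra.  A minimal graded left ideal contains an
idempotent e of degree 1, and eSe is a graded division algebra with one-dimensional
components, i.e. a twisted group algebra of a subgroup H.  Dual bases of eS and Se
over eSe identify S with matrices over this twisted group algebra, and a |H|-th
power argument normalises the cocycle to take roots of unity as values.  So up to
graded isomorphism there are only finitely many graded simple algebras of dimension
at most a given bound, and each of them which has an identity failing on S has a
multilinear identity, homogeneous in G, failing on S.

An e-central polynomial of S is found as follows.  With a basis x_i of S, a basis
y_i and the trace form t(u) = tr(left multiplication by u), the sum over
permutations s of sgn(s) sum_i x_i a y_s(i) prod_(k != i) t(x_k y_s(k)) is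
alternating in x and in y, hence a scalar multiple of the Casimir sum
sum_i b_i a b_i^* for dual bases b, b^*; on a of degree 1 this is a scalar.  The
traces are expressed by polynomials through Razmyslov's trick, at the price of a
factor f(b, ...) for a multilinear f alternating in a basis, which is absorbed in
a.  Inserting in a also the finitely many identities above, suitably multiplied
so that the value of a stays nonzero on S, gives the required polynomial. *)
Require Import Defs.
From HB Require Import structures.
From mathcomp Require Import all_boot all_order all_algebra all_fingroup all_field.
From mathcomp Require Import finmap.
From mathcomp Require Import ring.
From Stdlib Require Import Classical FunctionalExtensionality.
Import GRing.Theory.
Set Implicit Arguments.
Unset Strict Implicit.
Unset Printing Implicit Defensive.
Local Open Scope ring_scope.

(** One polynomial can serve all algebras [Σ] because an isomorphism type is recorded by finite
    data: the size [r], the degrees of the rows, the support [H] and the cocycle. The dimension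
    bounds [r], and the normalised cocycle takes its values in a finite set of roots of unity.
    Multilinearity dictates the shape of the polynomial. In the term with index [i] only the traces
    with [k != i] occur, so the number of Razmyslov blocks would be one less than the number of
    indices and the missing block would vary with [i]. Slot [i] therefore carries the constant
    [t 1], produced by a block applied to 1, and every monomial contains the same letters.
    Nonvanishing is arranged through one idempotent matrix unit [E]. Auxiliary letters around the
    arguments of the alternating blocks and around the inserted identities bring each of these
    factors to the value [E]. Their product is again [E], on which the Casimir sum is [|H|] times
    the unit. Characteristic zero keeps [|H|], [|H| r] and the dimension nonzero; it is also used to
    linearise identities that need not be homogeneous. *)

Lemma min_nat_of_ex (P : nat -> Prop) :
  (exists n, P n) -> exists2 n, P n & forall m, P m -> (n <= m)%N.
Proof.
case=> n Pn; elim/ltn_ind: n Pn => n IHn Pn.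
have [[m [Pm lt_mn]]|noless] := classic (exists m, P m /\ (m < n)%N).
  exact: IHn Pm.
exists n => // m Pm; rewrite leqNgt; apply/negP => lt_mn.
by apply: noless; exists m.
Qed.

(** * Subspaces described by predicates *)

Section VspaceOfProp.
Variables (F : fieldType) (V : vectType F).

Definition lin_closed (P : V -> Prop) : Prop :=
  P 0 /\ forall a x y, P x -> P y -> P (a *: x + y).

Lemma lin_closed_sum (P : V -> Prop) (I : Type) (r : seq I) (Q : pred I)
    (f : I -> V) :
  lin_closed P -> (forall i, Q i -> P (f i)) -> P (\sum_(i <- r | Q i) f i).
Proof.
case=> P0 PD Pf; apply: big_ind => // x y Px Py.
by rewrite -[x]scale1r; apply: PD.
Qed.

Lemma lin_closedZ (P : V -> Prop) a x : lin_closed P -> P x -> P (a *: x).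
Proof. by case=> P0 PD Px; rewrite -[_ *: _]addr0; apply: PD. Qed.

(** Among the subspaces contained in [P], one of least codimension exhausts [P]: otherwise a line
    inside [P] could be added to it. *)
Lemma vspace_of_prop (P : V -> Prop) :
  lin_closed P -> exists U : {vspace V}, forall x, x \in U <-> P x.
Proof.
case=> P0 PD.
pose Q k := exists2 U : {vspace V}, (\dim {:V} - \dim U)%N = k &
  forall x, x \in U -> P x.
have [|k [U <- UP] minU] := @min_nat_of_ex Q.
  by exists (\dim {:V} - \dim (0 : {vspace V}))%N, 0%VS => // x /[!memv0] /eqP ->.
exists U => x; split=> [/UP //|Px]; apply: contraT => nUx.
have ltU : (\dim U < \dim (U + <[x]>))%N.
  rewrite ltnNge; apply: contra nUx => le_dim.
  have /eqP -> : U == (U + <[x]>)%VS by rewrite eqEdim addvSl.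
  by rewrite memvE addvSr.
have /minU : Q (\dim {:V} - \dim (U + <[x]>))%N.
  exists (U + <[x]>)%VS => // _ /memv_addP[u /UP Pu [_ /vlineP[a ->] ->]].
  by rewrite addrC; apply: PD.
by rewrite leqNgt ltn_sub2l // (leq_trans ltU) // dimvS ?subvf.
Qed.

End VspaceOfProp.

(** * Graded ideals of graded simple algebras *)

Section GradedAlgebraTheory.
Variables (F : fieldType) (gT : finGroupType) (V : vectType F).
Variables (mul : V -> V -> V) (gr : gT -> {vspace V}).
Hypotheses (algV : is_algebra mul) (grV : is_grading mul gr).

Local Notation "x ** y" := (mul x y) (at level 40, left associativity).

Lemma amulA x y z : x ** (y ** z) = x ** y ** z.
Proof. by case: algV. Qed.

Lemma amulDl x y z : (x + y) ** z = x ** z + y ** z.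
Proof. by case: algV => h _ _; rewrite -[x]scale1r h !scale1r. Qed.

Lemma amulDr x y z : z ** (x + y) = z ** x + z ** y.
Proof. by case: algV => _ h _; rewrite -[x]scale1r h !scale1r. Qed.

Lemma amul0x x : 0 ** x = 0.
Proof. by apply: (addrI (0 ** x)); rewrite -amulDl !addr0. Qed.

Lemma amulx0 x : x ** 0 = 0.
Proof. by apply: (addrI (x ** 0)); rewrite -amulDr !addr0. Qed.

Lemma amulZl a x y : (a *: x) ** y = a *: (x ** y).
Proof. by case: algV => h _ _; rewrite -[a *: x]addr0 h amul0x addr0. Qed.

Lemma amulZr a x y : x ** (a *: y) = a *: (x ** y).
Proof. by case: algV => _ h _; rewrite -[a *: y]addr0 h amulx0 addr0. Qed.

Lemma amulBl x y z : (x - y) ** z = x ** z - y ** z.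
Proof. by rewrite amulDl -scaleN1r amulZl scaleN1r. Qed.

Lemma amulBr x y z : z ** (x - y) = z ** x - z ** y.
Proof. by rewrite amulDr -scaleN1r amulZr scaleN1r. Qed.

Lemma amul_suml (I : Type) (r : seq I) (Q : pred I) (f : I -> V) y :
  (\sum_(i <- r | Q i) f i) ** y = \sum_(i <- r | Q i) f i ** y.
Proof. exact: (big_morph (mul^~ y) (fun a b => amulDl a b y) (amul0x y)). Qed.

Lemma amul_sumr (I : Type) (r : seq I) (Q : pred I) (f : I -> V) y :
  y ** (\sum_(i <- r | Q i) f i) = \sum_(i <- r | Q i) y ** f i.
Proof. exact: (big_morph (mul y) (fun a b => amulDr a b y) (amulx0 y)). Qed.

Lemma mem_prodv (U W : {vspace V}) x y : x \in U -> y \in W ->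
  x ** y \in Defs.prodv mul U W.
Proof.
move=> Ux Wy; rewrite (coord_vbasis Ux) (coord_vbasis Wy).
rewrite amul_suml memv_suml // => i _; rewrite amul_sumr memv_suml // => j _.
rewrite amulZl amulZr !memvZ // memv_span //.
by apply: allpairs_f; apply: mem_nth; rewrite size_tuple.
Qed.

Lemma prodv_subP (U W X : {vspace V}) :
  (forall x y, x \in U -> y \in W -> x ** y \in X) -> (Defs.prodv mul U W <= X)%VS.
Proof.
move=> UWX; apply/span_subvP => _ /allpairsP[[u w] /= [Uu Ww ->]].
by apply: UWX; apply: vbasis_mem.
Qed.

Definition gcomp (g : gT) : V -> V := sumv_pi (\sum_g gr g)%VS g.

Lemma gcomp_is_linear g : linear (gcomp g).
Proof. by move=> a x y; rewrite /gcomp linearP. Qed.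
HB.instance Definition _ g :=
  GRing.isLinear.Build F V V _ (gcomp g) (gcomp_is_linear g).

Lemma gcomp_in g x : gcomp g x \in gr g.
Proof. exact: memv_sum_pi. Qed.

Lemma gcomp_sum x : \sum_g gcomp g x = x.
Proof. by apply: sumv_pi_sum; case: grV => _ -> _; rewrite memvf. Qed.

Lemma gcomp_sum_id (f : gT -> V) g : (forall h, f h \in gr h) ->
  gcomp g (\sum_h f h) = f g.
Proof.
move=> fgr; case: grV => /directv_sum_unique dx _ _.
have := dx (fun h => gcomp h (\sum_h f h)) f (fun h _ => gcomp_in h _)
  (fun h _ => fgr h).
by rewrite gcomp_sum eqxx => /esym/forall_inP/(_ g isT)/eqP.
Qed.

Lemma gcompE g h x : x \in gr h -> gcomp g x = if g == h then x else 0.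
Proof.
move=> hx; rewrite -(@gcomp_sum_id (fun g => if g == h then x else 0)).
  by rewrite (bigD1 h) //= eqxx big1 ?addr0 // => k /negPf ->.
by move=> k; case: eqP => [->|] //; rewrite mem0v.
Qed.

Lemma amul_gr g h x y : x \in gr g -> y \in gr h -> x ** y \in gr (g * h)%g.
Proof.
by move=> gx hy; case: grV => _ _ /(_ g h)/subvP; apply; apply: mem_prodv.
Qed.

Lemma gcomp_mull g h a x : a \in gr g ->
  gcomp h (a ** x) = a ** gcomp (g^-1 * h)%g x.
Proof.
move=> ga; rewrite -{1}[x]gcomp_sum amul_sumr.
rewrite (reindex_inj (mulgI g^-1%g)) /=.
rewrite (@gcomp_sum_id (fun k => a ** gcomp (g^-1 * k)%g x)) // => k.
by rewrite -[k in gr k](mulKVg g) amul_gr ?gcomp_in.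
Qed.

Lemma gcomp_mulr g h a x : a \in gr g ->
  gcomp h (x ** a) = gcomp (h * g^-1)%g x ** a.
Proof.
move=> ga; rewrite -{1}[x]gcomp_sum amul_suml.
rewrite (reindex_inj (mulIg g^-1%g)) /=.
rewrite (@gcomp_sum_id (fun k => gcomp (k * g^-1)%g x ** a)) // => k.
by rewrite -[k in gr k](mulgKV g) amul_gr ?gcomp_in.
Qed.

Hypothesis simV : graded_simple mul gr fullv.

Lemma gsimple_prop (P : V -> Prop) : lin_closed P ->
    (forall a x, P x -> P (a ** x)) -> (forall a x, P x -> P (x ** a)) ->
    (forall g x, P x -> P (gcomp g x)) ->
  (forall x, P x -> x = 0) \/ (forall x, P x).
Proof.
move=> linP Pl Pr Pg; have [U PU] := vspace_of_prop linP.
case: simV => _ _ simU.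
suff /simU[U0|UT] : graded_ideal mul gr fullv U.
- by left => x /PU Ux; apply/eqP; rewrite -memv0 -U0.
- by right => x; apply/PU; rewrite UT memvf.
split.
  apply/subvP => x /PU Px; rewrite -[x]gcomp_sum memv_sumr // => g _.
  by rewrite memv_cap gcomp_in andbT; apply/PU/Pg.
split; first exact: subvf.
  by apply: prodv_subP => x y _ /PU Py; apply/PU/Pl.
by apply: prodv_subP => x y /PU Px _; apply/PU/Pr.
Qed.

Lemma gsimple_prod_neq0 : exists x y, x ** y <> 0.
Proof.
apply: NNPP => no; case: simV => _ /eqP[]; apply/eqP; rewrite -subv0.
apply: prodv_subP => x y _ _; rewrite memv0; apply/eqP; apply: NNPP => xy0.
by apply: no; exists x, y.
Qed.

Definition homog (x : V) := exists g, x \in gr g.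

Lemma ghom_ext (P : V -> Prop) : lin_closed P -> (forall x, homog x -> P x) ->
  forall x, P x.
Proof.
move=> linP Ph x; rewrite -[x]gcomp_sum; apply: lin_closed_sum => // g _.
by apply: Ph; exists g; apply: gcomp_in.
Qed.

(* The elements [x] with all [s x t] zero form a graded ideal; were it everything,
   expanding [u] as a sum of products would give [u v = 0] for all [u], [v]. *)
Lemma gsimple_sandwich x : homog x -> x <> 0 -> exists s t, s ** x ** t <> 0.
Proof.
case=> g gx nz_x; apply: NNPP => no.
have x0 s t : s ** x ** t = 0 by apply: NNPP => h; apply: no; exists s, t.
pose P y := forall s t, s ** y ** t = 0.
have linP : lin_closed P.
  split=> [s t|a y z Py Pz s t]; first by rewrite amulx0 amul0x.
  by rewrite amulDr amulZr amulDl amulZl Py Pz scaler0 addr0.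
case: (gsimple_prop linP).
- by move=> a y Py s t; rewrite amulA Py.
- by move=> a y Py s t; rewrite amulA -amulA Py.
- move=> h y Py; move=> s t; move: s; apply: ghom_ext.
    split=> [|a u v Pu Pv]; first by rewrite !amul0x.
    by rewrite !amulDl !amulZl Pu Pv scaler0 addr0.
  move=> s [k ks]; move: t; apply: ghom_ext.
    split=> [|a u v Pu Pv]; first by rewrite !amulx0.
    by rewrite !amulDr !amulZr Pu Pv scaler0 addr0.
  (* For homogeneous [s] and [t] of degrees [k] and [l], this component of [s y t] involves only the
     component of [y] of degree [h]. *)
  move=> t [l lt]; have := congr1 (gcomp (k * h * l)%g) (Py s t).
  by rewrite linear0 (gcomp_mulr _ _ lt) (gcomp_mull _ _ ks) mulgK mulKg.
- by move/(_ x x0).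
move=> allP.
pose Q y := exists l : seq (V * V), y = \sum_(p <- l) p.1 ** p.2.
have linQ : lin_closed Q.
  split=> [|a _ _ [l ->] [l' ->]]; first by exists [::]; rewrite big_nil.
  exists ([seq (a *: p.1, p.2) | p <- l] ++ l'); rewrite big_cat big_map /=.
  by rewrite scaler_sumr; congr (_ + _); apply: eq_bigr => p _; rewrite amulZl.
have [u [v uv]] := gsimple_prod_neq0.
case: (gsimple_prop linQ).
- move=> a _ [l ->]; exists [seq (a ** p.1, p.2) | p <- l].
  by rewrite big_map amul_sumr; apply: eq_bigr => p _; rewrite amulA.
- move=> a _ [l ->]; exists [seq (p.1, p.2 ** a) | p <- l].
  by rewrite big_map amul_suml; apply: eq_bigr => p _; rewrite amulA.
- move=> h y [l ->].
  exists [seq (gcomp k p.1, gcomp (k^-1 * h)%g p.2) | p <- l, k <- enum gT].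
  rewrite big_allpairs_dep linear_sum /=; apply: eq_bigr => p _.
  rewrite -{1}[p.1]gcomp_sum amul_suml linear_sum /= big_enum /=.
  by apply: eq_bigr => k _; rewrite (gcomp_mull _ _ (gcomp_in k _)).
- by move/(_ (u ** v)) => h; apply: uv; apply: h; exists [:: (u, v)]; rewrite big_seq1.
move=> allQ; apply: uv; have [l ->] := allQ u; rewrite amul_suml big1 // => p _.
exact: allP.
Qed.

(** The sums of products [p x q] form a graded ideal, which [gsimple_sandwich] shows to be nonzero.
    Factors on both sides are written because no unit is available yet. *)
Lemma gsimple_span x : homog x -> x <> 0 ->
  forall s, exists l : seq (V * V), s = \sum_(p <- l) p.1 ** x ** p.2.
Proof.
move=> hx nz_x; pose Q y := exists l : seq (V * V), y = \sum_(p <- l) p.1 ** x ** p.2.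
have linQ : lin_closed Q.
  split=> [|a _ _ [l ->] [l' ->]]; first by exists [::]; rewrite big_nil.
  exists ([seq (a *: p.1, p.2) | p <- l] ++ l'); rewrite big_cat big_map /=.
  by rewrite scaler_sumr; congr (_ + _); apply: eq_bigr => p _; rewrite !amulZl.
have [u [v uv]] := gsimple_sandwich hx nz_x.
case: (gsimple_prop linQ) => //.
- move=> a _ [l ->]; exists [seq (a ** p.1, p.2) | p <- l].
  by rewrite big_map amul_sumr; apply: eq_bigr => p _; rewrite !amulA.
- move=> a _ [l ->]; exists [seq (p.1, p.2 ** a) | p <- l].
  by rewrite big_map amul_suml; apply: eq_bigr => p _; rewrite amulA.
- move=> h y [l ->]; have [g gx] := hx.
  exists [seq (gcomp k p.1, gcomp ((k * g)^-1 * h)%g p.2) | p <- l, k <- enum gT].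
  rewrite big_allpairs_dep linear_sum /=; apply: eq_bigr => p _.
  rewrite -{1}[p.1]gcomp_sum !amul_suml linear_sum /= big_enum /=.
  by apply: eq_bigr => k _; rewrite (gcomp_mull _ _ (amul_gr (gcomp_in k _) gx)).
by move/(_ (u ** x ** v)) => h; case: uv; apply: h; exists [:: (u, v)]; rewrite big_seq1.
Qed.

(** If [x s y] vanished for all [s], then [u x] would annihilate every sum of products [p y q],
    hence everything by [gsimple_span]; this contradicts [gsimple_sandwich] for [x]. *)
Lemma gsimple_prime x y : homog x -> homog y -> x <> 0 -> y <> 0 ->
  exists2 s, homog s & x ** s ** y <> 0.
Proof.
move=> hx hy nz_x nz_y; apply: NNPP => no.
have xsy s : x ** s ** y = 0.
  move: s; apply: ghom_ext => [|s hs].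
    split=> [|a u v Pu Pv]; first by rewrite amulx0 amul0x.
    by rewrite amulDr amulZr amulDl amulZl Pu Pv scaler0 addr0.
  by apply: NNPP => h; apply: no; exists s.
have [u [v]] := gsimple_sandwich hx nz_x; apply.
have [l ->] := gsimple_span hy nz_y v; rewrite amul_sumr big1 // => p _.
by rewrite !amulA -(amulA u x) -(amulA u (x ** _)) xsy amulx0 amul0x.
Qed.

Lemma gsimple_mull_neq0 x : homog x -> x <> 0 -> exists2 s, homog s & s ** x <> 0.
Proof.
move=> hx nz; have [s [k ks] sx] := gsimple_prime hx hx nz nz.
by exists (x ** s) => //; have [g gx] := hx; exists (g * k)%g; apply: amul_gr.
Qed.

End GradedAlgebraTheory.

(** * A graded division algebra from a minimal left ideal *)

Section MinimalLeftIdeal.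
Variables (F : fieldType) (gT : finGroupType) (V : vectType F).
Variables (mul : V -> V -> V) (gr : gT -> {vspace V}).
Hypotheses (algV : is_algebra mul) (grV : is_grading mul gr).
Hypothesis simV : graded_simple mul gr fullv.

Local Notation "x ** y" := (mul x y) (at level 40, left associativity).
Local Notation homog := (homog gr).

(** Choose a nonzero homogeneous [x] whose left multiples span the least dimension. The multiples of
    a nonzero homogeneous [y = a x] are among those of [x] and have at least that dimension. *)
Lemma minimal_left_ideal : exists x, [/\ homog x, x <> 0 &
  forall y, homog y -> y <> 0 -> (exists a, y = a ** x) ->
    forall z, (exists a, z = a ** x) -> exists a, z = a ** y].
Proof.
have leftU y : exists U : {vspace V}, forall z, z \in U <-> exists a, z = a ** y.
  apply: vspace_of_prop; split; first by exists 0; rewrite (amul0x algV).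
  move=> c _ _ [a ->] [b ->]; exists (c *: a + b).
  by rewrite (amulDl algV) (amulZl algV).
pose Q d := exists x (U : {vspace V}), [/\ homog x, x <> 0,
  forall z, z \in U <-> exists a, z = a ** x & \dim U = d].
have [|d [x [U [hx nz_x Ux <-]]] minU] := @min_nat_of_ex Q.
  have [u [v uv]] := gsimple_prod_neq0 simV.
  have [x hx nz_x] : exists2 x, homog x & x <> 0.
    apply: NNPP => no; apply: uv; suff -> : u = 0 by rewrite (amul0x algV).
    rewrite -[u](gcomp_sum grV) big1 // => g _; apply: NNPP => h.
    by apply: no; exists (gcomp gr g u) => //; exists g; apply: gcomp_in.
  by have [U Ux] := leftU x; exists (\dim U), x, U.
exists x; split=> // y hy nz_y [a ya] z /Ux Uz.
have [U' Uy] := leftU y; apply/Uy.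
suff -> : U' = U by [].
apply/eqP; rewrite eqEdim minU ?andbT; last by exists y, U'.
by apply/subvP => t /Uy[b ->]; apply/Ux; exists (b ** a); rewrite ya (amulA algV).
Qed.

(** In the minimal left ideal [L], primeness gives [w] and [z] with [w z] nonzero. Then [w z]
    generates [L], so [z = a w z], and [a w] is a left unit for [z] inside [L]. *)
Lemma gsimple_idempotent : exists e, [/\ e \in gr 1%g, e <> 0, e ** e = e &
  forall y, homog y -> y <> 0 -> y ** e = y -> exists a, e = a ** y].
Proof.
have [x [hx nz_x minx]] := minimal_left_ideal.
have [s [k ks] nz_w] := gsimple_mull_neq0 algV grV simV hx nz_x.
set w := s ** x in nz_w; have [g gx] := hx.
have gw : w \in gr (k * g)%g by apply: amul_gr.
have hw : homog w by exists (k * g)%g.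
have [t [l lt] nz_wz] := gsimple_prime algV grV simV hw hw nz_w nz_w.
pose z := t ** w; rewrite -(amulA algV) -/z in nz_wz.
have gz : z \in gr (l * (k * g))%g by apply: amul_gr.
have zx : z = (t ** s) ** x by rewrite /z /w (amulA algV).
have [|||a za] := minx (w ** z) _ nz_wz _ z.
- by exists (k * g * (l * (k * g)))%g; apply: amul_gr.
- by exists (w ** t ** s); rewrite zx !(amulA algV).
- by exists (t ** s).
(* Since [z] is homogeneous, the part of degree 1 of [a w] still fixes [z]. *)
pose e := gcomp gr 1%g (a ** w).
have ez : e ** z = z.
  have := congr1 (gcomp gr (l * (k * g))%g) za.
  rewrite (amulA algV) (gcomp_mulr algV grV _ _ gz) mulgV -/e => <-.
  by rewrite (gcompE grV _ gz) eqxx.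
have ex : exists b, e = b ** x.
  rewrite /e (gcomp_mulr algV grV _ _ gw) /w (amulA algV); by eexists.
have ge : e \in gr 1%g by apply: gcomp_in.
have nz_e : e <> 0 by move=> e0; apply: nz_wz; rewrite -ez e0 (amul0x algV) (amulx0 algV).
exists e; split=> //.
  apply/eqP; rewrite -subr_eq0; apply/eqP; apply: NNPP => nz_v.
  (* If [v = e e - e] were nonzero it would generate [L], so [w] would be a multiple of [v]. But [v]
     annihilates [z], whereas [w z] is nonzero. *)
  have [|||b wv] := minx _ _ nz_v _ w.
  - by exists 1%g; rewrite memvB // -[1%g]mulg1 amul_gr.
  - by have [b eb] := ex; exists (e ** b - b); rewrite (amulBl algV) -(amulA algV) -eb.
  - by exists s.
  apply: nz_wz; rewrite wv -(amulA algV) (amulBl algV) -(amulA algV) !ez subrr.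
  exact: (amulx0 algV).
move=> y hy nz_y ye; apply: (minx y) => //.
by have [b eb] := ex; exists (y ** b); rewrite -(amulA algV) -eb ye.
Qed.

Section Division.
Variable e : V.
Hypotheses (e1 : e \in gr 1%g) (nz_e : e <> 0) (ee : e ** e = e).
Hypothesis mine : forall y, homog y -> y <> 0 -> y ** e = y -> exists a, e = a ** y.

(** The component of degree [g] of the corner [e S e], the graded division algebra of the
    overview. *)
Definition dcomp g d := [/\ d \in gr g, e ** d = d & d ** e = d].

Lemma dcompM g h c d : dcomp g c -> dcomp h d -> dcomp (g * h)%g (c ** d).
Proof.
move=> [gc ec ce] [hd ed de]; split; first exact: amul_gr.
  by rewrite (amulA algV) ec.
by rewrite -(amulA algV) de.
Qed.

Lemma dcomp1 : dcomp 1%g e. Proof. by []. Qed.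

Lemma dcomp_lin g : lin_closed (dcomp g).
Proof.
split=> [|a x y [gx ex xe] [gy ey ye]].
  by split; rewrite ?mem0v ?(amul0x algV) ?(amulx0 algV).
split; first by rewrite memvD ?memvZ.
  by rewrite (amulDr algV) (amulZr algV) ex ey.
by rewrite (amulDl algV) (amulZl algV) xe ye.
Qed.

Lemma dcomp_linv g d : dcomp g d -> d <> 0 ->
  exists2 d', dcomp g^-1%g d' & d' ** d = e.
Proof.
move=> [gd ed de] nz_d; have [a ea] := mine (ex_intro _ g gd) nz_d de.
have ea' : e = gcomp gr g^-1%g a ** d.
  have := congr1 (gcomp gr 1%g) ea.
  by rewrite (gcompE grV _ e1) eqxx (gcomp_mulr algV grV _ _ gd) mul1g.
set b := gcomp _ _ _ in ea'; exists (e ** b ** e).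
  split; last by rewrite -(amulA algV) ee.
    rewrite -[g^-1%g]mulg1 amul_gr // -[g^-1%g]mul1g amul_gr //.
    exact: gcomp_in.
  by rewrite !(amulA algV) ee.
by rewrite -(amulA algV) ed -(amulA algV) -ea' ee.
Qed.

(** As for groups: a left inverse [c] of the left inverse [d'] satisfies [d = c d' d = c]. *)
Lemma dcomp_inv g d : dcomp g d -> d <> 0 ->
  exists d', [/\ dcomp g^-1%g d', d' ** d = e & d ** d' = e].
Proof.
move=> Dd nz_d; have [d' Dd' d'd] := dcomp_linv Dd nz_d.
have nz_d' : d' <> 0 by move=> d0; apply: nz_e; rewrite -d'd d0 (amul0x algV).
have [c [_ _ ce] cd'] := dcomp_linv Dd' nz_d'; exists d'; split=> //.
by have [_ ed _] := Dd; rewrite -{1}[d]ed -{1}cd' -(amulA algV c) d'd ce.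
Qed.

Lemma dcomp_mul_neq0 g h c d : dcomp g c -> dcomp h d -> c <> 0 -> d <> 0 ->
  c ** d <> 0.
Proof.
move=> Dc [_ ed _] nz_c nz_d cd; have [c' [_ c'c _]] := dcomp_inv Dc nz_c.
by apply: nz_d; rewrite -ed -c'c -(amulA algV) cd (amulx0 algV).
Qed.

End Division.
End MinimalLeftIdeal.

(** * Over a closed field the components of the corner are at most lines *)

Section DivisionClosed.
Variables (F : closedFieldType) (gT : finGroupType) (V : vectType F).
Variables (mul : V -> V -> V) (gr : gT -> {vspace V}).
Hypotheses (algV : is_algebra mul) (grV : is_grading mul gr).
Local Notation "x ** y" := (mul x y) (at level 40, left associativity).

(** Row [i] of [A] holds the coordinates of [a] times the [i]-th basis vector, so a row eigenvector
    of [A] lists the coefficients of the required element. *)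
Lemma eigenvector_exists (U : {vspace V}) a : U <> 0%VS ->
    (forall x, x \in U -> a ** x \in U) ->
  exists c x, [/\ x \in U, x <> 0 & a ** x = c *: x].
Proof.
move=> nzU aU; have dimU : (0 < \dim U)%N by rewrite lt0n dimv_eq0; apply/eqP.
pose b := vbasis U.
pose A : 'M_(\dim U) := \matrix_(i, j) coord b j (a ** b`_i).
have /closed_rootP[c] : size (char_poly A) != 1%N.
  by rewrite size_char_poly; case: (\dim U) dimU.
rewrite -eigenvalue_root_char => /eigenvalueP[v vA nz_v].
have bU (i : 'I_(\dim U)) : b`_i \in U.
  by apply: vbasis_mem; apply: mem_nth; rewrite size_tuple.
exists c, (\sum_i v 0 i *: b`_i); split.
- by apply: memv_suml => i _; rewrite memvZ.
- move/eqP: nz_v => nz_v v0; apply: nz_v; apply/rowP => i; rewrite mxE.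
  by move/freeP: (basis_free (vbasisP U)); apply.
rewrite (amul_sumr algV) scaler_sumr.
under eq_bigr => i _ do rewrite (amulZr algV) (coord_vbasis (aU _ (bU i))) scaler_sumr.
rewrite exchange_big; apply: eq_bigr => j _ /=.
have := congr1 (fun w : 'rV_(\dim U) => w 0 j) vA; rewrite !mxE scalerA => <-.
by rewrite scaler_suml; apply: eq_bigr => i _; rewrite mxE scalerA.
Qed.

Hypothesis simV : graded_simple mul gr fullv.
Variable e : V.
Hypotheses (e1 : e \in gr 1%g) (nz_e : e <> 0) (ee : e ** e = e).
Hypothesis mine : forall y, homog gr y -> y <> 0 -> y ** e = y -> exists a, e = a ** y.

(** For an eigenvalue [c], the element [a - c e] annihilates a nonzero element of degree 1, and
    homogeneous elements of the corner are not zero divisors there. *)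
Lemma dcomp1_scalar a : dcomp mul gr e 1%g a -> exists c, a = c *: e.
Proof.
move=> Da; have [U DU] := vspace_of_prop (dcomp_lin gr algV e 1%g).
have [||c [x [/DU Dx nz_x ax]]] := @eigenvector_exists U a.
- by move=> U0; apply: nz_e; apply/eqP; rewrite -memv0 -U0; apply/DU.
- by move=> x /DU Dx; apply/DU; rewrite -[1%g]mulg1; apply: dcompM.
exists c; apply/eqP; rewrite -subr_eq0; apply/eqP; apply: NNPP => nz_ac.
have Dac : dcomp mul gr e 1%g (a - c *: e).
  rewrite addrC -scaleNr; have [_ h] := dcomp_lin gr algV e 1%g.
  by apply: h.
apply: (dcomp_mul_neq0 algV grV e1 nz_e ee mine Dac Dx nz_ac nz_x).
by have [_ ex _] := Dx; rewrite (amulBl algV) (amulZl algV) ex ax subrr.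
Qed.

Lemma dcomp_line g c d : dcomp mul gr e g c -> dcomp mul gr e g d -> d <> 0 ->
  exists a, c = a *: d.
Proof.
move=> Dc Dd nz_d; have [d' [Dd' d'd dd']] := dcomp_inv algV grV e1 nz_e ee mine Dd nz_d.
have [|a ca] := @dcomp1_scalar (c ** d').
  by rewrite -(mulgV g); apply: dcompM.
exists a; have [_ _ ce] := Dc; have [_ ed _] := Dd.
by rewrite -[c]ce -d'd (amulA algV) ca (amulZl algV) ed.
Qed.

End DivisionClosed.

(** * Matrix units over a twisted group algebra *)

(* [B i h j] stands for the matrix unit [e_ij] times [u_h] in the matrices over
   the twisted group algebra of [H] with cocycle [al]. *)
Definition groupoid_basis (F : fieldType) (gT : finGroupType) (V : vectType F)
    (mul : V -> V -> V) (gr : gT -> {vspace V})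
    (r : nat) (gs : nat -> gT) (H : {set gT}) (al : gT -> gT -> F)
    (B : 'I_r -> gT -> 'I_r -> V) : Prop :=
  [/\ forall i h j, h \in H -> B i h j \in gr ((gs i)^-1 * h * gs j)%g,
      forall i h j k h' l, h \in H -> h' \in H ->
        mul (B i h j) (B k h' l) = if j == k then al h h' *: B i (h * h')%g l else 0,
      forall v, exists c : 'I_r -> gT -> 'I_r -> F,
        v = \sum_i \sum_(h in H) \sum_j c i h j *: B i h j &
      forall c : 'I_r -> gT -> 'I_r -> F,
        \sum_i \sum_(h in H) \sum_j c i h j *: B i h j = 0 ->
        forall i h j, h \in H -> c i h j = 0].

(** * Dual bases over the corner and the matrix decomposition *)

Section Structure.
Variables (F : closedFieldType) (gT : finGroupType) (V : vectType F).
Variables (mul : V -> V -> V) (gr : gT -> {vspace V}).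
Hypotheses (algV : is_algebra mul) (grV : is_grading mul gr).
Hypothesis simV : graded_simple mul gr fullv.
Local Notation "x ** y" := (mul x y) (at level 40, left associativity).
Local Notation homog := (homog gr).

Section DualFamilies.
Variable e : V.
Hypotheses (e1 : e \in gr 1%g) (nz_e : e <> 0) (ee : e ** e = e).
Hypothesis mine : forall y, homog y -> y <> 0 -> y ** e = y -> exists a, e = a ** y.
Local Notation dcomp := (dcomp mul gr e).

Definition dual_family r (gs : nat -> gT) (x y : nat -> V) : Prop :=
  (forall i, (i < r)%N -> [/\ x i \in gr (gs i), y i \in gr (gs i)^-1%g,
      e ** x i = x i & y i ** e = y i]) /\
  (forall i j, (i < r)%N -> (j < r)%N -> x i ** y j = if i == j then e else 0).

(** A linear relation between the [x i] is tested by right multiplication by [y j]. This bound makes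
    the extension process stop, and later leaves finitely many values of [r]. *)
Lemma dual_family_size r gs x y : dual_family r gs x y -> (r <= \dim {:V})%N.
Proof.
case=> xy1 xy2; pose X := [tuple x i | i < r].
have /eqP : free X.
  apply/freeP => k k0 j.
  have := congr1 (fun v => v ** y j) k0; rewrite (amul_suml algV) (amul0x algV).
  rewrite (bigD1 j) //= big1 => [|i ij].
    rewrite addr0 (amulZl algV) nth_mktuple xy2 // eqxx => /eqP.
    by rewrite scaler_eq0 => /orP[/eqP //|/eqP /nz_e].
  rewrite (amulZl algV) nth_mktuple xy2 //.
  by rewrite val_eqE (negPf ij) scaler0.
by rewrite size_tuple => <-; rewrite dimvS ?subvf.
Qed.

(** The sum of the diagonal matrix units; it becomes the identity element once the family is
    complete. *)
Definition family_unit r (x y : nat -> V) := \sum_(i < r) y i ** x i.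

Lemma family_unit1 r gs x y : dual_family r gs x y -> family_unit r x y \in gr 1%g.
Proof.
case=> xy1 _; apply: memv_suml => i _; have [gx gy _ _] := xy1 i (ltn_ord i).
by rewrite -(mulVg (gs i)); apply: amul_gr.
Qed.

Lemma mul_family_unit r gs x y j : dual_family r gs x y -> (j < r)%N ->
  family_unit r x y ** y j = y j.
Proof.
case=> xy1 xy2 lt_j; rewrite (amul_suml algV) (bigD1 (Ordinal lt_j)) //=.
rewrite big1 => [|i ij]; rewrite -(amulA algV) xy2 //.
  by rewrite eqxx addr0; have [] := xy1 j lt_j.
by rewrite -[j]/(val (Ordinal lt_j)) val_eqE (negPf ij) (amulx0 algV).
Qed.

Lemma family_unit_mul r gs x y j : dual_family r gs x y -> (j < r)%N ->
  x j ** family_unit r x y = x j.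
Proof.
case=> xy1 xy2 lt_j; rewrite (amul_sumr algV) (bigD1 (Ordinal lt_j)) //=.
rewrite big1 => [|i ij]; rewrite (amulA algV) xy2 //.
  by rewrite eqxx addr0; have [] := xy1 j lt_j.
rewrite -[j]/(val (Ordinal lt_j)) val_eqE eq_sym (negPf ij).
by rewrite (amul0x algV).
Qed.

(** A Gram-Schmidt step. Subtracting [x0 eps] makes [x1] orthogonal to the old [y j]; primeness and
    an inverse in the corner give [y1] with [x1 y1 = e]; subtracting [eps y1] makes it orthogonal to
    the old [x j] without changing the product with [x1]. *)
Lemma dual_family_extend r gs x y x0 : dual_family r gs x y ->
    homog x0 -> e ** x0 = x0 -> x0 ** family_unit r x y <> x0 ->
  exists gs' x' y', dual_family r.+1 gs' x' y'.
Proof.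
move=> fam [g gx0] ex0 nx0; set eps := family_unit r x y in nx0.
have geps : eps \in gr 1%g := family_unit1 fam.
pose x1 := x0 - x0 ** eps.
have gx1 : x1 \in gr g by rewrite memvB // -[g]mulg1 amul_gr.
have nz_x1 : x1 <> 0 by move/eqP; rewrite subr_eq0 => /eqP /esym.
have ex1 : e ** x1 = x1 by rewrite (amulBr algV) (amulA algV) ex0.
have x1y j : (j < r)%N -> x1 ** y j = 0.
  move=> lt_j; rewrite (amulBl algV) -(amulA algV).
  by rewrite (mul_family_unit fam lt_j) subrr.
have [||s [k ks] nz_d] := gsimple_prime algV grV simV _ _ nz_x1 nz_e.
- by exists g.
- by exists 1%g.
have Dd : dcomp (g * k)%g (x1 ** s ** e).
  split; first by rewrite -[(g * k)%g]mulg1; do 2!apply: amul_gr => //.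
    by rewrite !(amulA algV) ex1.
  by rewrite -(amulA algV) ee.
have [d [[gd ed de] _ dd]] := dcomp_inv algV grV e1 nz_e ee mine Dd nz_d.
pose y1 := s ** e ** d.
have x1y1 : x1 ** y1 = e by rewrite /y1 !(amulA algV).
have gy1 : y1 \in gr g^-1%g.
  rewrite /y1; have -> : g^-1%g = (k * 1 * (g * k)^-1)%g.
    by rewrite mulg1 invMg mulKVg.
  by do 2!apply: amul_gr => //.
pose y2 := y1 - eps ** y1.
have gy2 : y2 \in gr g^-1%g by rewrite memvB // -[g^-1%g]mul1g amul_gr.
have y1e : y1 ** e = y1 by rewrite -(amulA algV) de.
have y2e : y2 ** e = y2 by rewrite (amulBl algV) -(amulA algV) y1e.
have xy2 j : (j < r)%N -> x j ** y2 = 0.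
  move=> lt_j; rewrite (amulBr algV) (amulA algV).
  by rewrite (family_unit_mul fam lt_j) subrr.
have x1eps : x1 ** eps = 0.
  rewrite (amul_sumr algV) big1 // => i _.
  by rewrite (amulA algV) x1y // (amul0x algV).
have x1y2 : x1 ** y2 = e.
  by rewrite (amulBr algV) (amulA algV) x1eps (amul0x algV) subr0.
have [xy1 xyd] := fam.
exists (fun i => if i == r then g else gs i), (fun i => if i == r then x1 else x i),
  (fun i => if i == r then y2 else y i); split=> [i|i j]; rewrite !ltnS.
  by case: (eqVneq i r) => // ir; rewrite leq_eqVlt (negPf ir) => /xy1.
case: (eqVneq i r) => [->|ir]; case: (eqVneq j r) => [->|jr] //.
- by rewrite (leq_eqVlt j) (negPf jr) => _ /x1y.
- by rewrite leq_eqVlt (negPf ir) => /xy2.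
by rewrite (leq_eqVlt i) (leq_eqVlt j) (negPf ir) (negPf jr) => /xyd/[apply].
Qed.

Lemma complete_dual_family : exists r gs x y, dual_family r gs x y /\
  forall x0, homog x0 -> e ** x0 = x0 -> x0 ** family_unit r x y = x0.
Proof.
apply: NNPP => no.
suff all r : exists gs x y, dual_family r gs x y.
  have [gs [x [y fam]]] := all (\dim {:V}).+1.
  by have := dual_family_size fam; rewrite ltnn.
elim: r => [|r [gs [x [y fam]]]].
  by exists (fun=> 1%g), (fun=> 0), (fun=> 0); split.
apply: NNPP => nofam; apply: no; exists r, gs, x, y; split=> // x0 hx0 ex0.
apply: NNPP => nx0; apply: nofam; exact: dual_family_extend fam hx0 ex0 nx0.
Qed.

Section Coordinates.
Variables (r : nat) (gs : nat -> gT) (x y : nat -> V).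
Hypothesis fam : dual_family r gs x y.
Hypothesis complete :
  forall x0, homog x0 -> e ** x0 = x0 -> x0 ** family_unit r x y = x0.
Local Notation eps := (family_unit r x y).

(** Completeness gives [e t eps = e t] for all [t], and by [gsimple_span] every [s] is a sum of
    terms [p e t]. *)
Lemma family_unitr s : s ** eps = s.
Proof.
have all_e t : e ** t ** eps = e ** t.
  move: t; apply: (ghom_ext grV) => [|t [g gt]].
    split=> [|a u v Pu Pv]; first by rewrite !(amulx0 algV) (amul0x algV).
    by rewrite !(amulDr algV) !(amulZr algV) (amulDl algV) (amulZl algV) Pu Pv.
  apply: complete; last by rewrite (amulA algV) ee.
  by exists (1 * g)%g; apply: amul_gr.
have [|l ->] := gsimple_span algV grV simV _ nz_e s; first by exists 1%g.
rewrite (amul_suml algV); apply: eq_bigr => p _.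
by rewrite -!(amulA algV) (amulA algV e) all_e.
Qed.

(** A nonzero defect [eps s - s] would by primeness survive multiplication by some [e t], but
    [e t eps = e t]. *)
Lemma family_unitl s : eps ** s = s.
Proof.
have geps : eps \in gr 1%g := family_unit1 fam.
move: s; apply: (ghom_ext grV) => [|s [g gs']].
  split=> [|a u v Pu Pv]; first by rewrite !(amulx0 algV).
  by rewrite !(amulDr algV) !(amulZr algV) Pu Pv.
apply/eqP; rewrite -subr_eq0; apply/eqP; apply: NNPP => nz.
have [||t _] := gsimple_prime algV grV simV _ _ nz_e nz; first by exists 1%g.
  by exists g; rewrite memvB // -[g]mul1g amul_gr.
by apply; rewrite (amulBr algV) (amulA algV) family_unitr subrr.
Qed.

Lemma family_decomp s : s = \sum_(i < r) \sum_(j < r) y i ** (x i ** s ** y j) ** x j.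
Proof.
rewrite -{1}[s]family_unitr -{1}[s]family_unitl !(amul_suml algV).
apply: eq_bigr => i _; rewrite (amul_sumr algV); apply: eq_bigr => j _.
by rewrite !(amulA algV).
Qed.

Variable u : gT -> V.
Hypothesis Du : forall h, dcomp h (u h).
Hypothesis u0 : forall h d, u h = 0 -> dcomp h d -> d = 0.
Let H := [set h | u h != 0].
Variable al : gT -> gT -> F.
Hypothesis uM : forall h k, h \in H -> k \in H ->
  u h ** u k = al h k *: u (h * k)%g.

(** Products contract through [x j y k], which is [e] or 0. Coordinates come from [family_decomp]:
    each [x i v y j] lies in the corner, whose homogeneous components are spanned by the [u h]. *)
Lemma family_groupoid_basis :
  groupoid_basis mul gr gs H al (fun (i : 'I_r) h (j : 'I_r) => y i ** u h ** x j).
Proof.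
have [xy1 xyd] := fam; split.
- move=> i h j _; have [_ gy _ _] := xy1 i (ltn_ord i).
  have [gx _ _ _] := xy1 j (ltn_ord j); have [gu _ _] := Du h.
  by do 2!apply: amul_gr => //.
- move=> i h j k h' l Hh Hh'; rewrite -!(amulA algV) (amulA algV (x j)) xyd //.
  rewrite val_eqE; case: eqP => _; last by rewrite (amul0x algV) !(amulx0 algV).
  have [_ eu _] := Du h'; rewrite (amulA algV e) eu (amulA algV (u h)) uM //.
  by rewrite (amulZl algV) (amulZr algV).
- move=> v.
  have line s h : e ** s = s -> s ** e = s -> exists c, gcomp gr h s = c *: u h.
    move=> es se; have Ds : dcomp h (gcomp gr h s).
      split; first exact: gcomp_in.
        by have := congr1 (gcomp gr h) es; rewrite (gcomp_mull algV grV _ _ e1) invg1 mul1g.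
      by have := congr1 (gcomp gr h) se; rewrite (gcomp_mulr algV grV _ _ e1) invg1 mulg1.
    have [uh0|/eqP uh] := eqVneq (u h) 0.
      by exists 0; rewrite (u0 uh0 Ds) scale0r.
    exact: (dcomp_line algV grV e1 nz_e ee mine Ds (Du h) uh).
  have ex (p : 'I_r * gT * 'I_r) : exists c,
      gcomp gr p.1.2 (x p.1.1 ** v ** y p.2) = c *: u p.1.2.
    have [_ _ ex _] := xy1 p.1.1 (ltn_ord _).
    have [_ _ _ ye] := xy1 p.2 (ltn_ord _).
    by apply: line; rewrite ?(amulA algV) ?ex // -(amulA algV) ye.
  have [c cP] := fin_all_exists ex; exists (fun i h j => c (i, h, j)).
  rewrite {1}[v]family_decomp; apply: eq_bigr => i _.
  rewrite exchange_big /=; apply: eq_bigr => j _.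
  rewrite -[x i ** v ** y j](gcomp_sum grV) (amul_sumr algV) (amul_suml algV).
  rewrite (bigID (mem H)) /= [X in _ + X]big1 ?addr0 => [|h].
    apply: eq_bigr => h Hh; rewrite (cP (i, h, j)) /=.
    by rewrite (amulZr algV) (amulZl algV).
  rewrite inE negbK => /eqP uh0; rewrite (cP (i, h, j)) /= uh0 scaler0.
  by rewrite (amulx0 algV) (amul0x algV).
move=> c c0 i h j Hh.
have xBy (k : 'I_r) h' (l : 'I_r) : x i ** (y k ** u h' ** x l) ** y j =
    if (i == k) && (l == j) then u h' else 0.
  rewrite -!(amulA algV) xyd // (amulA algV (x i)) xyd // !val_eqE.
  have [_ eu ue] := Du h'.
  case: eqP => _ /=; case: eqP => _; rewrite ?(amulx0 algV) ?(amul0x algV) //.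
  by rewrite (amulA algV) eu ue.
have /(congr1 (fun v => gcomp gr h (x i ** v ** y j))) := c0.
(* Sandwiching the relation between [x i] and [y j] and taking degree [h] isolates the single
   coefficient [c i h j]. *)
rewrite (amulx0 algV) (amul0x algV) linear0.
rewrite (amul_sumr algV) (amul_suml algV) linear_sum (bigD1 i) //= [X in _ + X]big1 ?addr0.
  rewrite (amul_sumr algV) (amul_suml algV) linear_sum (bigD1 h) //= [X in _ + X]big1 ?addr0.
    rewrite (amul_sumr algV) (amul_suml algV) linear_sum (bigD1 j) //= [X in _ + X]big1 ?addr0.
      rewrite (amulZr algV) (amulZl algV) xBy !eqxx linearZ /=.
      have [gu _ _] := Du h; rewrite (gcompE grV _ gu) eqxx => /eqP.
      by move: Hh; rewrite scaler_eq0 inE => /negPf ->; rewrite orbF => /eqP.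
    move=> l lj; rewrite (amulZr algV) (amulZl algV) xBy (negPf lj) andbF.
    by rewrite scaler0 linear0.
  move=> k /andP[_ kh]; rewrite (amul_sumr algV) (amul_suml algV) linear_sum.
  rewrite big1 //= => l _; rewrite (amulZr algV) (amulZl algV) xBy linearZ /=.
  have [gu _ _] := Du k.
  case: ifP => _; last by rewrite linear0 scaler0.
  by rewrite (gcompE grV _ gu) eq_sym (negPf kh) scaler0.
move=> k ki; rewrite (amul_sumr algV) (amul_suml algV) linear_sum big1 //= => l _.
rewrite (amul_sumr algV) (amul_suml algV) linear_sum big1 //= => m _.
rewrite (amulZr algV) (amulZl algV) xBy eq_sym (negPf ki) /=.
by rewrite scaler0 linear0.
Qed.

End Coordinates.

End DualFamilies.

(** * Normalising the cocycle to roots of unity *)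

Section Normalization.
Variables (H : {set gT}) (u : gT -> V) (al : gT -> gT -> F).
Hypothesis u0 : forall h, h \in H -> u h <> 0.
Hypothesis H1 : 1%g \in H.
Hypothesis HM : forall h k, h \in H -> k \in H -> (h * k)%g \in H.
Hypothesis uM : forall h k, h \in H -> k \in H ->
  u h ** u k = al h k *: u (h * k)%g.
Hypothesis al0 : forall h k, h \in H -> k \in H -> al h k <> 0.
Hypotheses (all1 : forall h, h \in H -> al 1%g h = 1)
           (alr1 : forall h, h \in H -> al h 1%g = 1).

Lemma twisted_cocycle h k l : h \in H -> k \in H -> l \in H ->
  al h k * al (h * k)%g l = al k l * al h (k * l)%g.
Proof.
move=> Hh Hk Hl; have := amulA algV (u h) (u k) (u l).
rewrite !uM // (amulZr algV) (amulZl algV) !uM ?HM // !scalerA mulgA => /eqP.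
rewrite -subr_eq0 -scalerBl scaler_eq0 subr_eq0 => /orP[/eqP <- //|/eqP].
by move/u0; case; rewrite !HM.
Qed.

Lemma prod_translate (f : gT -> F) k : k \in H ->
  \prod_(l in H) f (k * l)%g = \prod_(l in H) f l.
Proof.
move=> Hk; have HE : [set (k * x)%g | x in H] = H.
  apply/eqP; rewrite eqEcard card_imset ?leqnn ?andbT; last exact: mulgI.
  by apply/subsetP => _ /imsetP[x Hx ->]; apply: HM.
by rewrite -[in RHS]HE big_imset //= => x y _ _ /mulgI.
Qed.

(* The product of [al h k] over [k] in [H] trivialises the [#|H|]-th power of
   the cocycle, so dividing [u h] by a [#|H|]-th root of it makes the values of
   the cocycle roots of unity. *)
Lemma cocycle_normalization : exists c : gT -> F, [/\ c 1%g = 1,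
  forall h, h \in H -> c h != 0 &
  forall h k, h \in H -> k \in H -> (al h k * c (h * k)%g / (c h * c k)) ^+ #|H| = 1].
Proof.
pose be h := \prod_(k in H) al h k.
have N0 : (0 < #|H|)%N by apply/card_gt0P; exists 1%g.
have ex h : exists c, (h = 1%g -> c = 1) /\ (h \in H -> c ^+ #|H| = be h).
  have [->|h1] := eqVneq h 1%g.
    (* At the identity the root is fixed to be 1, so that the rescaled cocycle is still 1 whenever
       an argument is the identity. *)
    exists 1; split=> // _; rewrite expr1n /be big1 // => k Hk; exact: all1.
  have /closed_rootP[c] : size ('X^#|H| - (be h)%:P) != 1%N.
    by rewrite size_XnsubC // eqSS -lt0n.
  rewrite /root !hornerE subr_eq0 => /eqP cb; exists c; split=> // /eqP.
  by rewrite (negPf h1).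
have [c cP] := fin_all_exists ex; exists c.
have be0 h : h \in H -> be h != 0.
  move=> Hh; apply/prodf_neq0 => k Hk; apply/eqP; exact: al0.
have c0 h : h \in H -> c h != 0.
  move=> Hh; have := be0 h Hh; have [_ <- //] := cP h.
  by rewrite expf_eq0 N0.
split=> // [|h k Hh Hk]; first by have [-> //] := cP 1%g.
rewrite exprMn exprVn !exprMn; have [_ -> //] := cP h; have [_ -> //] := cP k.
have [_ -> //] := cP (h * k)%g; last exact: HM.
have -> : al h k ^+ #|H| * be (h * k)%g = be h * be k.
  rewrite /be -[al h k ^+ _]prodr_const -big_split /=.
  rewrite (eq_bigr (fun l => al k l * al h (k * l)%g)) => [|l Hl]; last first.
    exact: twisted_cocycle.
  by rewrite big_split /= (prod_translate (al h) Hk) mulrC.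
by rewrite divff // mulf_neq0 ?be0.
Qed.

End Normalization.

Theorem graded_simple_structure :
  exists r gs (H : {set gT}) al (B : 'I_r -> gT -> 'I_r -> V),
  [/\ groupoid_basis mul gr gs H al B, (0 < r <= \dim {:V})%N,
    [/\ 1%g \in H, forall h k, h \in H -> k \in H -> (h * k)%g \in H &
      forall h, h \in H -> h^-1%g \in H],
    forall h k, h \in H -> k \in H -> al h k ^+ (#|gT|)`! = 1 &
    forall h, h \in H -> al 1%g h = 1 /\ al h 1%g = 1].
Proof.
have [e [e1 nz_e ee mine]] := gsimple_idempotent algV grV simV.
have [r [gs [x [y [fam complete]]]]] := complete_dual_family e1 nz_e ee mine.
have D1 := dcomp1 e1 ee.
(* The representative in degree 1 is [e] itself, which makes the cocycle normalised. The value 0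
   marks an empty component, so [H] is the support. *)
have exu h : exists uh, [/\ dcomp mul gr e h uh,
    h = 1%g -> uh = e & uh = 0 -> forall d, dcomp mul gr e h d -> d = 0].
  have [->|/eqP h1] := eqVneq h 1%g.
    by exists e; split=> // /nz_e.
  have [[d [Dd nz_d]]|no] := classic (exists d, dcomp mul gr e h d /\ d <> 0).
    by exists d; split=> // [h1'|/nz_d //]; case: h1.
  exists 0; split=> [|h1'|_ d Dd]; first by case: (dcomp_lin gr algV e h).
    by case: h1.
  by apply: NNPP => nz_d; apply: no; exists d.
have [u uP] := fin_all_exists exu.
pose H := [set h | u h != 0].
have u0 h : h \in H -> u h <> 0 by rewrite inE => /eqP.
have Du h : dcomp mul gr e h (u h) by have [] := uP h.
have u1 : u 1%g = e by have [_ -> //] := uP 1%g.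
have H1 : 1%g \in H by rewrite inE u1; apply/eqP.
have HD h d : dcomp mul gr e h d -> d <> 0 -> h \in H.
  move=> Dd nz_d; rewrite inE; apply/eqP => uh0; apply: nz_d.
  by have [_ _ h0] := uP h; apply: h0.
have nzM h k : h \in H -> k \in H -> u h ** u k <> 0.
  by move=> /u0 nh /u0 nk; apply: (dcomp_mul_neq0 algV grV e1 nz_e ee mine (Du h) (Du k)).
have HM h k : h \in H -> k \in H -> (h * k)%g \in H.
  move=> Hh Hk; apply: (HD _ (u h ** u k)); last exact: nzM.
  exact: dcompM (Du h) (Du k).
have HV h : h \in H -> h^-1%g \in H.
  move=> Hh; have [d [Dd d1 _]] := dcomp_inv algV grV e1 nz_e ee mine (Du h) (u0 h Hh).
  by apply: HD Dd _ => d0; apply: nz_e; rewrite -d1 d0 (amul0x algV).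
have exal (p : gT * gT) : exists a, p.1 \in H -> p.2 \in H ->
    u p.1 ** u p.2 = a *: u (p.1 * p.2)%g.
  case: p => h k /=.
  have [Hh|nHh] := boolP (h \in H); last by exists 0.
  have [Hk|nHk] := boolP (k \in H); last by exists 0.
  have [a ua] := dcomp_line algV grV e1 nz_e ee mine
    (dcompM algV grV (Du h) (Du k)) (Du (h * k)%g) (u0 _ (HM _ _ Hh Hk)).
  by exists a.
have [al0 al0P] := fin_all_exists exal; pose al h k := al0 (h, k).
have uM h k : h \in H -> k \in H -> u h ** u k = al h k *: u (h * k)%g.
  by move=> Hh Hk; rewrite (al0P (h, k)).
have alN0 h k : h \in H -> k \in H -> al h k <> 0.
  by move=> Hh Hk a0; apply: (nzM h k) => //; rewrite uM // a0 scale0r.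
have all1 h : h \in H -> al 1%g h = 1.
  move=> Hh; have := uM 1%g h H1 Hh; have [_ eu _] := Du h.
  rewrite u1 eu mul1g -{1}[u h]scale1r => /eqP; rewrite -subr_eq0 -scalerBl.
  by rewrite scaler_eq0 subr_eq0 => /orP[/eqP <- //|/eqP /(u0 h Hh)].
have alr1 h : h \in H -> al h 1%g = 1.
  move=> Hh; have := uM h 1%g Hh H1; have [_ _ eu] := Du h.
  rewrite u1 eu mulg1 -{1}[u h]scale1r => /eqP; rewrite -subr_eq0 -scalerBl.
  by rewrite scaler_eq0 subr_eq0 => /orP[/eqP <- //|/eqP /(u0 h Hh)].
have [c [c1 c0 cN]] := cocycle_normalization u0 H1 HM uM alN0 all1.
(* Extended by 1 outside [H]: the factor is invertible everywhere, so rescaling preserves the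
   support. *)
pose c' h := if h \in H then c h else 1.
have c'0 h : c' h != 0 by rewrite /c'; case: ifP => [/c0 //|_]; apply: oner_neq0.
pose v h := (c' h)^-1 *: u h.
have vu h : (v h != 0) = (u h != 0) by rewrite scaler_eq0 invr_eq0 (negPf (c'0 h)).
have HE : H = [set h | v h != 0] by apply/setP => h; rewrite !inE vu.
pose be h k := al h k * c' (h * k)%g / (c' h * c' k).
exists r, gs, H, be, (fun i h j => y i ** v h ** x j); split.
- rewrite HE; apply: (family_groupoid_basis e1 nz_e ee mine fam complete).
  + by move=> h; apply: lin_closedZ (Du h); apply: dcomp_lin.
  + move=> h d /eqP; rewrite /v scaler_eq0 invr_eq0 (negPf (c'0 h)) /= => /eqP uh0.
    by have [_ _ h0] := uP h; apply: h0.
  move=> h k; rewrite -HE => Hh Hk; rewrite (amulZl algV) (amulZr algV) uM //.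
  rewrite !scalerA /be; congr (_ *: _); field; rewrite !c'0 //.
- rewrite (dual_family_size nz_e fam) andbT lt0n; apply/eqP => r0.
  apply: nz_e; rewrite -(complete e) //; last by exists 1%g.
  by rewrite /family_unit r0 big_ord0 (amulx0 algV).
- by split.
- move=> h k Hh Hk; rewrite /be /c' Hh Hk HM //.
  (* The factorial is a common exponent for all supports, so one finite list of roots of unity
     serves every algebra. *)
  have /dvdnP[m ->] : (#|H| %| (#|gT|)`!)%N.
    by apply: dvdn_fact; rewrite max_card andbT; apply/card_gt0P; exists 1%g.
  by rewrite mulnC exprM cN // expr1n.
move=> h Hh; rewrite /be /c' Hh H1 c1 mul1g mulg1 Hh all1 // alr1 // !mul1r mulr1.
by rewrite divff // c0.
Qed.

End Structure.

(** * Alternating sums and Razmyslov's trick *)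

Section AlternatingSums.
Variables (F : fieldType) (A : algType F) (n : nat).

Lemma prod_eq0 (I : eqType) (r : seq I) (f : I -> A) j :
  j \in r -> f j = 0 -> \prod_(i <- r) f i = 0.
Proof.
elim: r => // i r IHr; rewrite inE big_cons => /orP[/eqP <- ->|/IHr h /h ->].
  by rewrite mul0r.
by rewrite mulr0.
Qed.

(** Writes a product of scalars times one element as a product over all slots, the form required by
    the determinant lemmas below. *)
Lemma prod_one_slot (i : 'I_n) (z : A) (c : 'I_n -> F) :
  \prod_k (if k == i then c k *: z else (c k)%:A) = (\prod_k c k) *: z.
Proof.
rewrite (eq_bigr (fun k => c k *: (if k == i then z else 1))); last first.
  by move=> k _; case: ifP.
by rewrite scaler_prod -big_mkcond big_pred1_eq.
Qed.

Definition lin_fun (T : A -> A) := forall a x y, T (a *: x + y) = a *: T x + T y.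

Lemma lin_fun0 T : lin_fun T -> T 0 = 0.
Proof.
move=> linT; have := linT (-1) 0 0.
by rewrite scaler0 addr0 scaleN1r => ->; rewrite addNr.
Qed.

Lemma lin_fun_sum T (I : Type) (r : seq I) (Q : pred I) (f : I -> F) (g : I -> A) :
  lin_fun T -> T (\sum_(i <- r | Q i) f i *: g i) = \sum_(i <- r | Q i) f i *: T (g i).
Proof.
move=> linT; elim: r => [|i r IHr]; first by rewrite !big_nil lin_fun0.
by rewrite !big_cons; case: (Q i); rewrite // linT IHr.
Qed.

(** Multiplicativity of the determinant, with one matrix replaced by the noncommuting values
    [T l (b q)]. In the expansion over maps [f], the scalars attached to a non-injective [f] add up
    to a determinant with two equal rows. *)
Lemma alternating_sum_det (T : 'I_n -> A -> A) (b x : 'I_n -> A) (M : 'M[F]_n) :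
    (forall k, lin_fun (T k)) -> (forall l, x l = \sum_q M l q *: b q) ->
  \sum_(s : 'S_n) (-1) ^+ s *: \prod_l T l (x (s l)) =
  \det M *: \sum_(s : 'S_n) (-1) ^+ s *: \prod_l T l (b (s l)).
Proof.
move=> linT xM.
pose AA := {ffun 'I_n -> 'I_n}; pose W (f : AA) := \prod_l T l (b (f l)).
pose N (f : AA) : 'M[F]_n := \matrix_(i, j) M j (f i).
transitivity (\sum_(f : AA) \det (N f) *: W f).
  transitivity (\sum_(s : 'S_n) \sum_(f : AA)
      ((-1) ^+ s * \prod_l M (s l) (f l)) *: W f).
    apply: eq_bigr => s _.
    rewrite (eq_bigr (fun l => \sum_q M (s l) q *: T l (b q))); last first.
      by move=> l _; rewrite xM lin_fun_sum.
    rewrite bigA_distr_bigA scaler_sumr; apply: eq_bigr => f _.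
    by rewrite scaler_prod scalerA.
  rewrite exchange_big; apply: eq_bigr => f _ /=.
  rewrite -scaler_suml; congr (_ *: _); apply: eq_bigr => s _.
  by congr (_ * _); apply: eq_bigr => l _; rewrite mxE.
rewrite (bigID (fun f : AA => injectiveb f)) /= addrC big1 ?add0r => [|f Uf].
  rewrite (reindex (@pval _)) /=; last first.
    pose in_Sn := insubd (1%g : 'S_n).
    by exists in_Sn => /= f Uf; first apply: val_inj; apply: insubdK.
  rewrite scaler_sumr; apply: eq_big => /= [s | s _]; rewrite ?(valP s) //.
  have -> : N (pval s) = row_perm s M^T.
    by apply/matrixP => i j; rewrite !mxE pvalE.
  rewrite row_permE det_mulmx det_perm det_tr scalerA mulrC; congr (_ *: _).
  by apply: eq_bigr => l _; rewrite pvalE.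
case/injectivePn: Uf => i1 [i2 ne fE].
rewrite (determinant_alternate ne) ?scale0r // => j; by rewrite !mxE fE.
Qed.

End AlternatingSums.

(** * Alternation within homogeneous components *)

Section GradedSums.
Variables (F : fieldType) (A : algType F) (gT : finGroupType) (hom : gT -> A -> Prop).

Definition graded_coords n (b : 'I_n -> A) (deg : 'I_n -> gT) (co : 'I_n -> A -> F) :=
  [/\ forall i a x y, co i (a *: x + y) = a * co i x + co i y,
      forall i j, co i (b j) = (i == j)%:R,
      forall x, x = \sum_i co i x *: b i &
      forall g x i, hom g x -> co i x != 0 -> deg i = g].

Section OneBasis.
Variables (n : nat) (b : 'I_n -> A) (deg : 'I_n -> gT) (co : 'I_n -> A -> F).
Hypothesis bP : graded_coords b deg co.

(** Only these permutations put into each slot an argument of the degree of that slot, which keeps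
    the alternating polynomials homogeneous. *)
Definition deg_pres (s : 'S_n) := [forall l, deg (s l) == deg l].

Definition coord_mx (x : 'I_n -> A) : 'M[F]_n := \matrix_(l, q) co q (x l).

Lemma coord0 i : co i 0 = 0.
Proof.
case: bP => lin _ _ _; have := lin i (-1) 0 0.
by rewrite scaler0 addr0 mulN1r addNr.
Qed.

Lemma coord_sum i (I : Type) (r : seq I) (f : I -> F) (g : I -> A) :
  co i (\sum_(k <- r) f k *: g k) = \sum_(k <- r) f k * co i (g k).
Proof.
case: bP => lin _ _ _; elim: r => [|k r IHr]; first by rewrite !big_nil coord0.
by rewrite !big_cons lin IHr.
Qed.

(* Cutting the slot maps down to the right degree turns the sum over degree
   preserving permutations into a full alternating sum. *)
Lemma graded_alternating_sum_det (T : 'I_n -> A -> A) (x : 'I_n -> A) :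
    (forall k, lin_fun (T k)) -> (forall l, hom (deg l) (x l)) ->
    (forall l, hom (deg l) (b l)) ->
  \sum_(s | deg_pres s) (-1) ^+ s *: \prod_l T l (x (s l)) =
  \det (coord_mx x) *: \sum_(s | deg_pres s) (-1) ^+ s *: \prod_l T l (b (s l)).
Proof.
move=> linT hx hb; case: (bP) => lin cob sumb cohom.
pose T' k x := T k (\sum_(q | deg q == deg k) co q x *: b q).
have linT' k : lin_fun (T' k).
  move=> a y z; rewrite /T' -linT; congr (T k _).
  rewrite scaler_sumr -big_split; apply: eq_bigr => q _ /=.
  by rewrite lin scalerDl scalerA.
have T'E k g z : hom g z -> T' k z = if g == deg k then T k z else 0.
  move=> hz; rewrite /T'; case: eqP => [gk|gk].
    congr (T k _); rewrite [RHS]sumb [RHS](bigID (fun q => deg q == deg k)) /=.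
    rewrite [X in _ = _ + X]big1 ?addr0 // => q qk.
    have [->|nz] := eqVneq (co q z) 0; first by rewrite scale0r.
    by move: qk; rewrite (cohom _ _ _ hz nz) gk eqxx.
  rewrite big1 ?lin_fun0 // => q /eqP qk.
  have [->|nz] := eqVneq (co q z) 0; first by rewrite scale0r.
  by case: gk; rewrite -qk (cohom _ _ _ hz nz).
have full (y : 'I_n -> A) : (forall l, hom (deg l) (y l)) ->
    \sum_(s | deg_pres s) (-1) ^+ s *: \prod_l T l (y (s l)) =
    \sum_(s : 'S_n) (-1) ^+ s *: \prod_l T' l (y (s l)).
  move=> hy; rewrite [RHS](bigID deg_pres) /= [X in _ = _ + X]big1 ?addr0.
    apply: eq_bigr => s /forallP ps; congr (_ *: _); apply: eq_bigr => l _.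
    by rewrite (T'E _ _ _ (hy _)) ps.
  move=> s; rewrite negb_forall => /existsP[l sl].
  rewrite (@prod_eq0 _ _ _ _ _ l) ?scaler0 ?mem_index_enum //.
  by rewrite (T'E _ _ _ (hy _)) (negPf sl).
rewrite !full //; apply: alternating_sum_det => // l.
by rewrite {1}[x l]sumb; apply: eq_bigr => q _; rewrite mxE.
Qed.

End OneBasis.

(** * Traces by Razmyslov's trick and the scalar-valued sum *)

Section CentralValue.
Hypothesis homD : forall g x y, hom g x -> hom g y -> hom g (x + y).
Hypothesis homZ : forall g a x, hom g x -> hom g (a *: x).
Hypothesis hom0 : forall g, hom g 0.
Hypothesis homI : hom 1%g 1.
Hypothesis homM : forall g h x y, hom g x -> hom h y -> hom (g * h)%g (x * y).
Variables (n : nat) (deg : 'I_n -> gT).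
Variables (b : 'I_n -> A) (co : 'I_n -> A -> F).
Variables (bd : 'I_n -> A) (cod : 'I_n -> A -> F).
Hypothesis bP : graded_coords b deg co.
Hypothesis bdP : graded_coords bd (fun i => (deg i)^-1%g) cod.
Hypotheses (hb : forall i, hom (deg i) (b i))
           (hbd : forall i, hom (deg i)^-1%g (bd i)).

Definition left_trace (u : A) : F := \sum_q co q (u * b q).
Local Notation t := left_trace.

Variable N0 : F.
Hypothesis tbd : forall i j, t (b i * bd j) = N0 * (i == j)%:R.
Variable kap : A -> F.
Hypothesis casimir : forall a, hom 1%g a -> \sum_i b i * a * bd i = (kap a)%:A.

(** The polynomial [f] of the overview. The letters [y l] and [z l] are there so that a substitution
    can make a single permutation survive. *)
Definition alt (x y z : 'I_n -> A) :=
  \sum_(s | deg_pres deg s) (-1) ^+ s *: \prod_l (y l * x (s l) * z l).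

Lemma alt_det x y z : (forall l, hom (deg l) (x l)) ->
  alt x y z = \det (coord_mx co x) *: alt b y z.
Proof.
move=> hx; apply: (graded_alternating_sum_det bP (T := fun l w => y l * w * z l)) => //.
by move=> k a u v; rewrite mulrDr mulrDl -scalerAr -scalerAl.
Qed.

(* Razmyslov's trick: applying [u] in turn to each argument of an alternating
   polynomial multiplies its value by the trace of left multiplication by [u]. *)
Definition razmyslov u x y z :=
  \sum_j alt (fun l => if l == j then u * x l else x l) y z.

(** The derivative of a determinant: replacing row [j] of [M] by row [j] of [M U] and summing over
    [j] gives the trace of [U] times the determinant of [M], by cofactor expansion and the adjugate
    identity. *)
Lemma razmyslov_trace u x y z : hom 1%g u -> (forall l, hom (deg l) (x l)) ->
  razmyslov u x y z = (t u * \det (coord_mx co x)) *: alt b y z.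
Proof.
move=> hu hx; case: (bP) => lin cob sumb cohom; set M := coord_mx co x.
pose U q p := co p (u * b q).
have hx' j l : hom (deg l) (if l == j then u * x l else x l).
  by case: ifP => // _; rewrite -[deg l]mul1g; apply: homM.
rewrite /razmyslov (eq_bigr _ (fun j _ => alt_det y z (hx' j))) -scaler_suml.
congr (_ *: _).
transitivity (\sum_j \sum_p (\sum_q M j q * U q p) * cofactor M j p).
  apply: eq_bigr => j _; rewrite (expand_det_row _ j); apply: eq_bigr => p _.
  rewrite mxE eqxx; congr (_ * _).
    rewrite {1}[x j]sumb mulr_sumr.
    rewrite (eq_bigr (fun q => co q (x j) *: (u * b q))); last first.
      by move=> q _; rewrite scalerAr.
    by rewrite (coord_sum bP); apply: eq_bigr => q _; rewrite mxE.
  congr (_ * \det _); apply/matrixP => k l; rewrite !mxE.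
  by rewrite eq_sym (negPf (neq_lift _ _)).
have adjM q p : \sum_j cofactor M j p * M j q = \det M *+ (p == q).
  have /matrixP/(_ p q) := mul_adj_mx M; rewrite !mxE => <-.
  by apply: eq_bigr => j _; congr (_ * _); rewrite [RHS]mxE.
transitivity (\sum_p \sum_q U q p * \sum_j cofactor M j p * M j q).
  rewrite exchange_big; apply: eq_bigr => p _ /=.
  under eq_bigr do rewrite mulr_suml.
  rewrite exchange_big; apply: eq_bigr => q _ /=.
  by rewrite mulr_sumr; apply: eq_bigr => j _; ring.
rewrite /t mulr_suml; apply: eq_bigr => p _.
rewrite (bigD1 p) //= [X in _ + X]big1 ?addr0 => [|q qp]; rewrite adjM ?eqxx //.
by rewrite eq_sym (negPf qp) mulr0.
Qed.

Lemma trace_lin a x y : t (a *: x + y) = a * t x + t y.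
Proof.
case: bP => lin _ _ _; rewrite mulr_sumr -big_split; apply: eq_bigr => q _ /=.
by rewrite mulrDl -scalerAl lin.
Qed.

Lemma deg_presV s : deg_pres (fun i => (deg i)^-1%g) s = deg_pres deg s.
Proof. by apply: eq_forallb => l; rewrite (inj_eq invg_inj). Qed.

Lemma deg_pres_inv s : deg_pres deg s^-1%g = deg_pres deg s.
Proof.
apply/forallP/forallP => h l.
  by have := h (s l); rewrite permK eq_sym.
by have := h (s^-1 l)%g; rewrite permKV eq_sym.
Qed.

(** The constant [t 1] in slot [i] stands in for the absent trace, so that each term has the same
    number of trace factors. *)
Definition weight (x y : 'I_n -> A) (s : 'S_n) i :=
  \prod_k (if k == i then t 1 else t (x k * y (s k))).

Definition gram (x y : 'I_n -> A) a :=
  \sum_(s | deg_pres deg s) (-1) ^+ s *: \sum_i weight x y s i *: (x i * a * y (s i)).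

Lemma gram_dual x y a : (forall l, hom (deg l)^-1%g (y l)) ->
  gram x y a = \det (coord_mx cod y) *: gram x bd a.
Proof.
move=> hy; pose T i k w := if k == i then t 1 *: (x i * a * w) else (t (x k * w))%:A.
have linT i k : lin_fun (T i k).
  move=> c u v; rewrite /T; case: ifP => _.
    by rewrite mulrDr -scalerAr scalerDr !scalerA mulrC.
  by rewrite mulrDr -scalerAr trace_lin scalerDl scalerA.
have gramE w : gram x w a =
    \sum_i \sum_(s | deg_pres (fun i => (deg i)^-1%g) s)
      (-1) ^+ s *: \prod_k T i k (w (s k)).
  rewrite exchange_big /=; apply: eq_big => [s|s _]; first by rewrite deg_presV.
  rewrite scaler_sumr; apply: eq_bigr => i _; congr (_ *: _).
  rewrite -(prod_one_slot i); apply: eq_bigr => k _; rewrite /T.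
  by case: eqP => [->|].
rewrite !gramE scaler_sumr; apply: eq_bigr => i _.
by rewrite (graded_alternating_sum_det bdP (linT i) hy hbd).
Qed.

(** Passing to the inverse permutation moves it from the second family to the first, which exhibits
    alternation in [x]. *)
Lemma gram_primal x a : (forall l, hom (deg l) (x l)) ->
  gram x bd a = \det (coord_mx co x) *: gram b bd a.
Proof.
move=> hx; pose T i k w := if k == i then t 1 *: (w * a * bd i) else (t (w * bd k))%:A.
have linT i k : lin_fun (T i k).
  move=> c u v; rewrite /T; case: ifP => _.
    by rewrite !mulrDl -!scalerAl scalerDr !scalerA mulrC.
  by rewrite mulrDl -scalerAl trace_lin scalerDl scalerA.
have gramE w : gram w bd a =
    \sum_i \sum_(s | deg_pres deg s) (-1) ^+ s *: \prod_k T i k (w (s k)).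
  rewrite exchange_big /= /gram (reindex_inj invg_inj) /=.
  apply: eq_big => [s|s _]; first by rewrite deg_pres_inv.
  rewrite odd_permV (reindex_inj (@perm_inj _ s)) /= scaler_sumr.
  apply: eq_bigr => i _; rewrite permK; congr (_ *: _).
  rewrite /weight (reindex_inj (@perm_inj _ s)) /=.
  rewrite (eq_bigr (fun k => if k == i then t 1 else t (w (s k) * bd k))).
    rewrite -(prod_one_slot i); apply: eq_bigr => k _; rewrite /T.
    by case: eqP => [->|].
  by move=> k _; rewrite permK (inj_eq perm_inj).
rewrite !gramE scaler_sumr; apply: eq_bigr => i _.
exact: (graded_alternating_sum_det bP (linT i) hx hb).
Qed.

(** On dual bases the trace form is diagonal, so only the identity permutation contributes; its
    [n.-1] traces equal [N0]. *)
Lemma gram_basis a : hom 1%g a ->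
  gram b bd a = (t 1 * N0 ^+ n.-1 * kap a)%:A.
Proof.
move=> ha; rewrite /gram (bigD1 1%g) /=; last by apply/forallP => l; rewrite perm1.
rewrite [X in _ + X]big1 ?addr0 => [|s /andP[_ s1]].
  rewrite odd_perm1 scale1r -scalerA -casimir // scaler_sumr.
  apply: eq_bigr => i _; rewrite perm1; congr (_ *: _).
  rewrite /weight (bigD1 i) //= eqxx; congr (_ * _).
  rewrite (eq_bigr (fun=> N0)) => [|k /negPf ki]; last first.
    by rewrite ki perm1 tbd eqxx mulr1.
  by rewrite prodr_const cardC1 card_ord.
rewrite big1 ?scaler0 // => i _.
(* A permutation other than the identity moves at least two points. One different from [i] is
   needed, because slot [i] carries no trace. *)
have /existsP[k /andP[ki sk]] : [exists k, (k != i) && (s k != k)].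
  apply: contraNT s1 => /existsPn no; apply/eqP; apply/permP => k; rewrite perm1.
  have fix_s j : j != i -> s j = j by move=> ji; have := no j; rewrite ji negbK => /eqP.
  have [->|/fix_s //] := eqVneq k i; apply/eqP; apply: contraT => si.
  by case/negP: (si); apply/eqP; apply: (@perm_inj _ s); apply: fix_s.
rewrite /weight (bigD1 k) //= (negPf ki) tbd eq_sym (negPf sk) mulr0 mul0r.
by rewrite scale0r.
Qed.

Definition central_value (x y : 'I_n -> A) (xx yy zz : 'I_n -> 'I_n -> A) p :=
  \sum_(s | deg_pres deg s) (-1) ^+ s *:
    \sum_i x i *
      ((\prod_k razmyslov (if k == i then 1 else x k * y (s k)) (xx k) (yy k) (zz k))
       * p) * y (s i).

(** Block [k] yields a trace, a determinant and an alternating factor. The alternating factors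
    depend neither on [s] nor on [i], so together with [p] they form the middle argument [a] of
    [gram x y a]. *)
Lemma central_valueE x y xx yy zz p :
    (forall i, hom (deg i) (x i)) -> (forall i, hom (deg i)^-1%g (y i)) ->
    (forall k i, hom (deg i) (xx k i)) ->
    hom 1%g ((\prod_k alt b (yy k) (zz k)) * p) ->
  central_value x y xx yy zz p =
  (\prod_k \det (coord_mx co (xx k)) * \det (coord_mx cod y) *
   \det (coord_mx co x) * (t 1 * N0 ^+ n.-1 *
   kap ((\prod_k alt b (yy k) (zz k)) * p)))%:A.
Proof.
move=> hx hy hxx hp; set a := _ * p; rewrite -scalerA -gram_basis //.
rewrite -scalerA -gram_primal // -scalerA -gram_dual // scaler_sumr; apply: eq_bigr => s /forallP ps.
rewrite scalerA mulrC -scalerA; congr (_ *: _); rewrite scaler_sumr.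
apply: eq_bigr => i _.
have hu k : hom 1%g (if k == i then 1 else x k * y (s k)).
  case: ifP => // _; rewrite -(mulgV (deg k)) -{2}(eqP (ps k)); exact: homM.
rewrite (eq_bigr _ (fun k _ => razmyslov_trace (yy k) (zz k) (hu k) (hxx k))).
rewrite scaler_prod big_split /= -scalerAl -/a -scalerAr -scalerAl scalerA mulrC.
congr (_ * _ *: _); apply: eq_bigr => k _; by case: ifP.
Qed.

End CentralValue.
End GradedSums.

(** * Multilinearisation of graded identities *)

Section NCPolynomials.
Variables (F : fieldType) (T : eqType).

(** Unreduced lists of monomials, the empty word included: contents of sums and products are then
    computed without considering cancellation. *)
Definition ncpoly := seq (F * seq T).

Definition nceval (A : algType F) (rho : T -> A) (p : ncpoly) : A :=
  \sum_(m <- p) m.1 *: \prod_(v <- m.2) rho v.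

Definition ncvar v : ncpoly := [:: (1, [:: v])].
Definition ncone : ncpoly := [:: (1, [::])].
Definition ncscale c (p : ncpoly) : ncpoly := [seq (c * m.1, m.2) | m <- p].
Definition ncmul (p q : ncpoly) : ncpoly :=
  [seq (a.1 * b.1, a.2 ++ b.2) | a <- p, b <- q].

Section Eval.
Variables (A : algType F) (rho : T -> A).
Local Notation ev := (nceval rho).

Lemma nceval_var v : ev (ncvar v) = rho v.
Proof. by rewrite /nceval !big_seq1 scale1r. Qed.

Lemma nceval_one : ev ncone = 1.
Proof. by rewrite /nceval big_seq1 big_nil scale1r. Qed.

Lemma nceval_nil : ev [::] = 0.
Proof. exact: big_nil. Qed.

Lemma nceval_cat p q : ev (p ++ q) = ev p + ev q.
Proof. exact: big_cat. Qed.

Lemma nceval_scale c p : ev (ncscale c p) = c *: ev p.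
Proof.
by rewrite /nceval big_map scaler_sumr; apply: eq_bigr => m _; rewrite scalerA.
Qed.

Lemma nceval_mul p q : ev (ncmul p q) = ev p * ev q.
Proof.
rewrite /nceval big_allpairs_dep mulr_suml; apply: eq_bigr => a _.
rewrite mulr_sumr; apply: eq_bigr => c _ /=.
by rewrite big_cat -scalerAl -scalerAr scalerA.
Qed.

Lemma nceval_sum (I : Type) (r : seq I) (P : pred I) (p : I -> ncpoly) :
  ev (\big[cat/[::]]_(i <- r | P i) p i) = \sum_(i <- r | P i) ev (p i).
Proof. exact: (big_morph ev nceval_cat nceval_nil). Qed.

Lemma nceval_prod (I : Type) (r : seq I) (p : I -> ncpoly) :
  ev (\big[ncmul/ncone]_(i <- r) p i) = \prod_(i <- r) ev (p i).
Proof. exact: (big_morph ev nceval_mul nceval_one). Qed.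

End Eval.

Definition has_content (m : T -> nat) (p : ncpoly) :=
  forall w, w \in p -> forall v, count_mem v w.2 = m v.

Lemma eq_content m m' p : m =1 m' -> has_content m p -> has_content m' p.
Proof. by move=> mm' pm w pw v; rewrite -mm' pm. Qed.

Lemma content_var v : has_content (fun x => (v == x) : nat) (ncvar v).
Proof. by move=> w; rewrite mem_seq1 => /eqP -> x; rewrite /= addn0. Qed.

Lemma content_one : has_content (fun=> 0%N) ncone.
Proof. by move=> w; rewrite mem_seq1 => /eqP ->. Qed.

Lemma content_scale m c p : has_content m p -> has_content m (ncscale c p).
Proof. by move=> pm _ /mapP[w pw ->] v; apply: (pm w pw). Qed.

Lemma content_mul m m' p q : has_content m p -> has_content m' q ->
  has_content (fun v => m v + m' v)%N (ncmul p q).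
Proof.
by move=> pm qm _ /allpairsP[[a c] /= [pa qc ->]] v; rewrite count_cat pm ?qm.
Qed.

Lemma content_sum m (I : Type) (r : seq I) (P : pred I) (p : I -> ncpoly) :
  (forall i, P i -> has_content m (p i)) ->
  has_content m (\big[cat/[::]]_(i <- r | P i) p i).
Proof.
move=> pm; elim/big_ind: _ => // a c am cm w; rewrite mem_cat.
by case/orP => [/am|/cm].
Qed.

Lemma content_prod (I : Type) (r : seq I) (m : I -> T -> nat) (p : I -> ncpoly) :
  (forall i, has_content (m i) (p i)) ->
  has_content (fun v => \sum_(i <- r) m i v)%N (\big[ncmul/ncone]_(i <- r) p i).
Proof.
move=> pm; elim: r => [|i r IHr].
  by rewrite big_nil; apply: eq_content content_one => v; rewrite big_nil.
rewrite big_cons; apply: eq_content (content_mul (pm i) IHr) => v.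
by rewrite big_cons.
Qed.

End NCPolynomials.

Arguments eq_content {F T m m' p} _ _ w _ _.
Arguments content_var F {T} v w _ _.
Arguments content_mul {F T m m' p q} _ _ w _ _.
Arguments content_prod {F T I} r {m p} _ w _ _.

Definition ncmap (F : fieldType) (T T' : eqType) (f : T -> T') (p : ncpoly F T) :
  ncpoly F T' := [seq (m.1, map f m.2) | m <- p].

Lemma nceval_map (F : fieldType) (T T' : eqType) (f : T -> T') (p : ncpoly F T)
    (A : algType F) (rho : T' -> A) : nceval rho (ncmap f p) = nceval (rho \o f) p.
Proof.
by rewrite /nceval big_map; apply: eq_bigr => m _; rewrite big_map.
Qed.

Lemma content_map (F : fieldType) (T T' : eqType) (f : T -> T') (p : ncpoly F T) m m' :
    has_content m p -> (forall v, m' (f v) = m v) ->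
    (forall v', (forall v, f v != v') -> m' v' = 0%N) -> injective f ->
  has_content m' (ncmap f p).
Proof.
move=> pm mf m0 finj _ /mapP[w pw ->] v' /=; rewrite count_map.
have [[v fv]|no] := classic (exists v, f v = v').
  rewrite -fv mf -(pm w pw); apply: eq_count => x /=.
  by rewrite inj_eq.
rewrite m0 => [|v]; last by apply/eqP => fv; apply: no; exists v.
by apply/eqP; rewrite -leqn0 leqNgt -has_count; apply/hasP => -[x _ /eqP fx]; apply: no; exists x.
Qed.

Arguments content_map {F T T' f p m m'} _ _ _ _ w _ _.

Section GradedPolynomials.
Variables (F : fieldType) (gT : finGroupType).
Local Notation L := (nat * gT)%type.

(** The default letter is reached only for the empty list, which has no counterpart among the words
    of a [gpoly]. *)
Definition word_of (s : seq L) : gword gT := (head (0%N, 1%g) s, behead s).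

Lemma letters_word_of s : s <> [::] -> letters (word_of s) = s.
Proof. by case: s. Qed.

Lemma word_of_letters w : word_of (letters w) = w.
Proof. by case: w. Qed.

Definition gpoly_of (p : ncpoly F L) : gpoly F gT :=
  [fsfun w in [fset word_of m.2 | m in p]%fset => \sum_(m <- p | word_of m.2 == w) m.1].

Lemma gpoly_ofE p w : gpoly_of p w = \sum_(m <- p | word_of m.2 == w) m.1.
Proof.
rewrite fsfun_fun; case: ifP => // /negP nw.
rewrite big_seq_cond big1 // => m /andP[pm /eqP wm].
by case: nw; rewrite -wm; apply/imfsetP; exists m.
Qed.

End GradedPolynomials.

Lemma enum_index_enum (I : finType) : enum I = index_enum I.
Proof. by rewrite [index_enum I]unlock enumT. Qed.

Lemma size_map_enum_ord (T : Type) n (h : 'I_n -> T) :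
  size [seq h i | i <- enum 'I_n] = n.
Proof. by rewrite (size_map h) size_enum_ord. Qed.

Lemma nth_map_enum_ord (T : Type) n (h : 'I_n -> T) x0 i :
  nth x0 [seq h j | j <- enum 'I_n] (nat_of_ord i) = h i.
Proof. by rewrite (nth_map i) ?size_enum_ord // nth_ord_enum. Qed.

Lemma sum_pred1_seq (R : nmodType) (I : eqType) (r : seq I) x (h : I -> R) :
  uniq r -> \sum_(i <- r | i == x) h i = if x \in r then h x else 0.
Proof.
elim: r => [|y r IHr] /=; first by rewrite big_nil.
case/andP => nry /IHr {}IHr; rewrite big_cons inE IHr eq_sym.
by case: eqP => [->|] //=; rewrite (negPf nry) addr0.
Qed.

Section Multilinearization.
Variables (F : fieldType) (gT : finGroupType).
Hypothesis char0 : [pchar F] =i pred0.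
Local Notation L := (nat * gT)%type.

Lemma natr_eq0_char0 n : (n%:R == 0 :> F) = (n == 0%N).
Proof. by move/pcharf0P: char0. Qed.

(** Evaluate at [c = 0, ..., d - 1], which are distinct in characteristic zero, and invert the
    Vandermonde matrix. *)
Lemma power_sum_eq0 (B : lmodType F) d (v : nat -> B) :
  (forall c : F, \sum_(i < d) c ^+ i *: v i = 0) -> forall i, (i < d)%N -> v i = 0.
Proof.
move=> v0 i lt_id; pose i0 := Ordinal lt_id.
pose a : 'rV[F]_d := \row_k (k : nat)%:R; pose M := (Vandermonde d a)^T.
have unitM : M \in unitmx.
  rewrite unitmxE det_tr det_Vandermonde unitfE.
  apply/prodf_neq0 => k _; apply/prodf_neq0 => l kl.
  by rewrite !mxE -natrB 1?ltnW // natr_eq0_char0 subn_eq0 -ltnNge.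
have /matrixP VM := mulVmx unitM.
transitivity (\sum_(j < d) (invmx M *m M) i0 j *: v j).
  rewrite (bigD1 i0) //= VM mxE eqxx scale1r big1 ?addr0 // => j ji.
  by rewrite VM mxE eq_sym (negPf ji) scale0r.
under eq_bigr do rewrite mxE scaler_suml.
rewrite exchange_big big1 //= => k _.
transitivity (invmx M i0 k *: \sum_(j < d) (k : nat)%:R ^+ j *: v j).
  by rewrite scaler_sumr; apply: eq_bigr => j _; rewrite scalerA !mxE.
by rewrite v0 scaler0.
Qed.

Definition galg_eval (A : algType F) (f : gpoly F gT) (phi : L -> A) : A :=
  \sum_(w <- finsupp f) f w *: \prod_(v <- letters w) phi v.

Definition length_part (A : algType F) (f : gpoly F gT) n (phi : L -> A) : A :=
  \sum_(w <- finsupp f | size (letters w) == n) f w *: \prod_(v <- letters w) phi v.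

Lemma galg_eval_length (f : gpoly F gT) : exists d,
  forall (A : algType F) (phi : L -> A), galg_eval f phi = \sum_(n < d) length_part f n phi.
Proof.
pose d := (\max_(w <- finsupp f) size (letters w)).+1; exists d => A phi.
have sz w : w \in finsupp f -> (size (letters w) < d)%N.
  by move=> fw; rewrite ltnS (big_rem w) //= leq_maxl.
rewrite /galg_eval (eq_big_seq (fun w => \sum_(n < d | size (letters w) == n)
    f w *: \prod_(v <- letters w) phi v)) => [|w fw].
  rewrite /length_part; under [RHS]eq_bigr do rewrite big_mkcond.
  rewrite [RHS]exchange_big; apply: eq_bigr => w _ /=.
  by rewrite big_mkcond.
rewrite (big_pred1 (Ordinal (sz w fw))) // => n; by rewrite -val_eqE eq_sym.
Qed.

Lemma length_part_scale (A : algType F) (f : gpoly F gT) n (phi : L -> A) c :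
  length_part f n (fun v => c *: phi v) = c ^+ n *: length_part f n phi.
Proof.
rewrite /length_part scaler_sumr; apply: eq_bigr => w /eqP <-.
rewrite scaler_prod big_const_seq count_predT scalerA mulrC -scalerA.
congr (_ *: _).
by elim: (size _) => //= k ->; rewrite exprS.
Qed.

Definition graded_map (A : algType F) (hom : gT -> A -> Prop) (phi : L -> A) :=
  forall v, hom v.2 (phi v).

Section Polarization.
Variables (f : gpoly F gT) (n : nat) (w0 : 'I_n -> L).

Definition polar_letter (i : 'I_n) : L := (nat_of_ord i, (w0 i).2).

(** Full linearisation of the part of [f] supported on rearrangements of [w0]: each occurrence of a
    letter receives a fresh variable of the same degree. *)
Definition polarization : ncpoly F L :=
  [seq (f (word_of [seq w0 ((s : 'S_n) i) | i <- enum 'I_n]),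
        [seq polar_letter (s i) | i <- enum 'I_n]) | s <- enum 'S_n].

Lemma polar_letter_inj : injective polar_letter.
Proof. by move=> i j [] /val_inj. Qed.

Lemma polarization_content :
  has_content (fun v => count_mem v [seq polar_letter i | i <- enum 'I_n]) polarization.
Proof.
move=> _ /mapP[s _ ->] v /=; rewrite (map_comp polar_letter s).
apply/seq.permP/perm_map; apply: uniq_perm; rewrite ?enum_uniq //.
  by rewrite map_inj_uniq ?enum_uniq //; apply: perm_inj.
move=> i; rewrite mem_enum; apply/mapP; exists (s^-1 i)%g; rewrite ?mem_enum //.
by rewrite permKV.
Qed.

Lemma polarization_eval (A : algType F) (psi : L -> A) :
  nceval psi polarization = \sum_(s : 'S_n)
   f (word_of [seq w0 (s i) | i <- enum 'I_n]) *: \prod_i psi (polar_letter (s i)).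
Proof.
rewrite /nceval big_map big_enum; apply: eq_bigr => s _ /=.
by rewrite big_map enum_index_enum.
Qed.

(** The sum factors over the points [i]: a point of the image of [k] contributes -1, a point outside
    contributes -1 + 1. So only surjective, hence injective, maps survive. *)
Lemma inclusion_exclusion (k : {ffun 'I_n -> 'I_n}) :
  \sum_(U : {set 'I_n}) (-1) ^+ #|U| * ([forall j, k j \in U] : nat)%:R =
  (if injectiveb k then (-1) ^+ n else 0) :> F.
Proof.
transitivity (\sum_(U in {set 'I_n})
    \prod_i (if i \in U then -1 else ((i \notin codom k) : nat)%:R : F)).
  apply: eq_bigr => U _; rewrite (bigID (mem U)) /= (eq_bigr (fun=> -1)).
    rewrite prodr_const; congr (_ * _).
    have [/forallP kU|nkU] := boolP [forall j, k j \in U].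
      rewrite big1 // => i nUi; rewrite (negPf nUi); case: codomP => // -[j ij].
      by rewrite ij kU in nUi.
    apply/esym/eqP; have /existsP[j nUj] : [exists j, k j \notin U].
      by rewrite -negb_forall.
    by apply/prodf_eq0; exists (k j); rewrite // (negPf nUj) codom_f.
  by move=> i ->.
rewrite -(bigA_distr _ _ (fun=> -1) (fun i => ((i \notin codom k) : nat)%:R)) /=.
have [/injectiveP ik|/injectivePn[i1 [i2 ne kE]]] := boolP (injectiveb k).
  rewrite (eq_bigr (fun=> -1)) ?prodr_const ?card_ord // => i _.
  by rewrite (inj_card_onto ik) // addr0.
have /existsP[i ni] : [exists i, i \notin codom k].
  apply: contraT => /existsPn all; case/eqP: ne; move: kE.
  suff ik : injective k by move/ik.
  apply/injectiveP; rewrite /dinjectiveb -/(codom k); apply/card_uniqP.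
  rewrite size_codom; apply: eq_card => i.
  by rewrite [RHS]inE; apply: negbNE; exact: all.
by rewrite (bigD1 i) //= ni addNr mul0r.
Qed.

(* Polarisation identity: the sum of [+-f] over all partial sums of the new
   variables only retains the words in which each of them occurs once. *)
Lemma polarization_length_part (A : algType F) (psi : L -> A) :
  (0 < n)%N ->
  \sum_(U : {set 'I_n}) (-1) ^+ #|U| *:
    length_part f n (fun v => \sum_(i in U | w0 i == v) psi (polar_letter i)) =
  (-1) ^+ n *: nceval psi polarization.
Proof.
move=> n0; pose G (k : {ffun 'I_n -> 'I_n}) : A :=
  f (word_of [seq w0 (k i) | i <- enum 'I_n]) *: \prod_i psi (polar_letter (k i)).
have lpE (U : {set 'I_n}) :
    length_part f n (fun v => \sum_(i in U | w0 i == v) psi (polar_letter i)) =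
    \sum_(k : {ffun 'I_n -> 'I_n}) ([forall j, k j \in U] : nat)%:R *: G k.
  transitivity (\sum_(w <- finsupp f | size (letters w) == n) \sum_(k : {ffun 'I_n -> 'I_n})
     (if letters w == [seq w0 (k i) | i <- enum 'I_n] then f w else 0) *:
     (([forall j, k j \in U] : nat)%:R *: \prod_i psi (polar_letter (k i)))).
    apply: eq_bigr => w /eqP szw; pose v0 := w.1.
    rewrite (big_nth v0) szw big_mkord.
    under eq_bigr do rewrite big_mkcond /=.
    rewrite bigA_distr_bigA scaler_sumr; apply: eq_bigr => k _.
    have wkE : (letters w == [seq w0 (k i) | i <- enum 'I_n]) =
        [forall j : 'I_n, w0 (k j) == nth v0 (letters w) j].
      apply/eqP/forallP => [-> j|h].
        by rewrite nth_map_enum_ord.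
      apply: (@eq_from_nth _ v0) => [|j]; rewrite ?size_map_enum_ord //.
      rewrite szw => lt_j.
      by rewrite (nth_map_enum_ord _ _ (Ordinal lt_j)) (eqP (h (Ordinal lt_j))).
    rewrite wkE; have [/forallP h|nh] := boolP [forall j, w0 (k j) == nth v0 (letters w) j].
      congr (_ *: _); have [/forallP kU|nkU] := boolP [forall j, k j \in U].
        by rewrite scale1r; apply: eq_bigr => j _; rewrite kU h.
      have /existsP[j nUj] : [exists j, k j \notin U] by rewrite -negb_forall.
      by rewrite scale0r (@prod_eq0 _ _ _ _ _ j) ?mem_index_enum // (negPf nUj).
    rewrite scale0r; have /existsP[j nj] : [exists j, w0 (k j) != nth v0 (letters w) j].
      by rewrite -negb_forall.
    by rewrite (@prod_eq0 _ _ _ _ _ j) ?mem_index_enum ?scaler0 // (negPf nj) andbF.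
  rewrite exchange_big; apply: eq_bigr => k _; cbv beta.
  rewrite -scaler_suml /G scalerA scalerA mulrC; congr (_ *: _).
  set ws := [seq _ | i <- _].
  have szws : size ws = n by rewrite size_map_enum_ord.
  have lws : letters (word_of ws) = ws.
    by apply: letters_word_of => ws0; rewrite -szws ws0 in n0.
  have szE w : letters w == ws = (w == word_of ws).
    apply/eqP/eqP => [<-|->] //; by rewrite word_of_letters.
  under eq_bigr do rewrite szE.
  rewrite -big_mkcondr (eq_bigl (fun w => w == word_of ws)) => [|w]; last first.
    by have [->|_] := eqVneq w (word_of ws); rewrite ?andbF // lws szws !eqxx.
  rewrite sum_pred1_seq ?fset_uniq //; case: ifP => // /negbT nfw.
  by rewrite (fsfun_dflt nfw).
under eq_bigr do rewrite lpE scaler_sumr.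
rewrite exchange_big /=.
rewrite (eq_bigr (fun k : {ffun 'I_n -> 'I_n} => (if injectiveb k then (-1) ^+ n else 0) *: G k)); last first.
  move=> k _; rewrite -inclusion_exclusion scaler_suml; apply: eq_bigr => U _.
  by rewrite scalerA.
rewrite (bigID (fun k : {ffun 'I_n -> 'I_n} => injectiveb k)) /= addrC big1 ?add0r.
  rewrite (reindex (@pval _)) /=; last first.
    pose in_Sn := insubd (1%g : 'S_n).
    by exists in_Sn => /= k Uk; first apply: val_inj; apply: insubdK.
  rewrite polarization_eval scaler_sumr; apply: eq_big => /= [s|s _]; rewrite ?(valP s) //.
  congr (_ *: _); rewrite /G; congr (f (word_of _) *: _).
    by apply: eq_map => i; rewrite pvalE.
  by apply: eq_bigr => i _; rewrite pvalE.
by move=> k /negPf ->; rewrite scale0r.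
Qed.

End Polarization.

(** Giving the fresh variables the values of the original letters, the polarisation at [w0] becomes
    the sum of the terms of all rearrangements of [w0]. If all these vanished, summing over [w0]
    would give [n!] times the value of the part of length [n]. *)
Lemma polarization_nonzero (A : algType F) (hom : gT -> A -> Prop) f n (phi : L -> A) :
    (forall g, hom g 0) -> graded_map hom phi -> (0 < n)%N -> length_part f n phi <> 0 ->
  exists w0 : 'I_n -> L, exists2 psi, graded_map hom psi & nceval psi (polarization f w0) <> 0.
Proof.
move=> hom0 gphi n0 nz; apply: NNPP => no; apply: nz.
pose ls := flatten [seq letters w | w <- finsupp f].
pose al := seq_sub ls.
pose G (w : {ffun 'I_n -> al}) : A :=
  f (word_of [seq val (w i) | i <- enum 'I_n]) *: \prod_i phi (val (w i)).
have G0 (w : {ffun 'I_n -> al}) : \sum_(s : 'S_n) G [ffun i => w (s i)] = 0.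
  pose w0 i := val (w i).
  pose psi (v : L) : A := if insub v.1 is Some i then
    if (w0 i).2 == v.2 then phi (w0 i) else 0 else 0.
  have gpsi : graded_map hom psi.
    by move=> v; rewrite /psi; case: insub => // i; case: eqP => // <-; apply: gphi.
  transitivity (nceval psi (polarization f w0)); last first.
    by apply: NNPP => h; apply: no; exists w0, psi.
  rewrite polarization_eval; apply: eq_bigr => s _; congr (f (word_of _) *: _).
    by apply: eq_map => i; rewrite ffunE.
  by apply: eq_bigr => i _; rewrite /psi /= valK eqxx ffunE.
have sumG : \sum_(w : {ffun 'I_n -> al}) \sum_(s : 'S_n) G [ffun i => w (s i)] =
    (n`!)%:R *: \sum_w G w.
  rewrite exchange_big /= (eq_bigr (fun=> \sum_w G w)) => [|s _].
    by rewrite sumr_const scaler_nat card_Sn.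
  rewrite [RHS](reindex (fun w : {ffun 'I_n -> al} => [ffun i => w (s i)])) //.
  exists (fun w : {ffun 'I_n -> al} => [ffun i => w (s^-1 i)%g]) => w _.
    by apply/ffunP => i; rewrite !ffunE permKV.
  by apply/ffunP => i; rewrite !ffunE permK.
move: sumG; rewrite big1 // => /esym/eqP.
rewrite scaler_eq0 natr_eq0_char0 -leqn0 leqNgt fact_gt0 /= => /eqP <-.
pose mk (w : gword gT) (k : {ffun 'I_n -> al}) :=
  letters w == [seq val (k i) | i <- enum 'I_n].
transitivity (\sum_(w <- finsupp f | size (letters w) == n) \sum_k
  (if mk w k then f w *: \prod_i phi (val (k i)) else 0)).
  rewrite /length_part big_seq_cond [RHS]big_seq_cond; apply: eq_bigr => w.
  case/andP=> fw /eqP szw; pose v0 := w.1.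
  have lw (i : 'I_n) : nth v0 (letters w) i \in ls.
    by apply/flattenP; exists (letters w); rewrite ?map_f // mem_nth // szw.
  pose k := [ffun i => SeqSub (lw i)].
  have mk_k : mk w k.
    apply/eqP/(@eq_from_nth _ v0) => [|i]; rewrite ?size_map_enum_ord //.
    rewrite szw => lt_i.
    by rewrite (nth_map_enum_ord _ _ (Ordinal lt_i)) ffunE.
  rewrite (bigD1 k) //= mk_k [X in _ = _ + X]big1 ?addr0 => [|k' nk].
    congr (_ *: _); rewrite (eqP mk_k) big_map enum_index_enum.
    by apply: eq_bigr.
  case: ifP => // /eqP lk'; case/eqP: nk; apply/ffunP => i; apply: val_inj.
  have := eqP mk_k; rewrite lk' => /(congr1 (fun s => nth v0 s i)).
  by rewrite !nth_map_enum_ord.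
rewrite exchange_big; apply: eq_bigr => k _; cbv beta; rewrite /G.
set ws := [seq _ | i <- _].
have szws : size ws = n by rewrite size_map_enum_ord.
have lws : letters (word_of ws) = ws.
  by apply: letters_word_of => ws0; rewrite -szws ws0 in n0.
have szE w : letters w == ws = (w == word_of ws).
  apply/eqP/eqP => [<-|->] //; by rewrite word_of_letters.
rewrite (eq_bigr (fun w => if w == word_of ws then G k else 0)); last first.
  move=> w szw; rewrite /mk -/ws szE; case: eqP => // wE; by rewrite wE.
rewrite -big_mkcondr (eq_bigl (fun w => w == word_of ws)) => [|w]; last first.
  by have [->|_] := eqVneq w (word_of ws); rewrite ?andbF // lws szws !eqxx.
rewrite sum_pred1_seq ?fset_uniq //; case: ifP => // /negbT nfw.
by rewrite (fsfun_dflt nfw) scale0r.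
Qed.

Definition degree_part g (p : ncpoly F L) : ncpoly F L :=
  [seq m <- p | (\prod_(v <- m.2) v.2)%g == g].

Lemma nceval_degree_part (A : algType F) (phi : L -> A) p :
  nceval phi p = \sum_g nceval phi (degree_part g p).
Proof.
rewrite /nceval; under [RHS]eq_bigr do rewrite big_filter big_mkcond.
rewrite exchange_big; apply: eq_bigr => m _ /=.
rewrite (bigD1 (\prod_(v <- m.2) v.2)%g) //= eqxx [X in _ + X]big1 ?addr0 //.
by move=> g /negPf gm; rewrite eq_sym gm.
Qed.

Section GradedStructure.
Variables (A : algType F) (hom : gT -> A -> Prop).
Hypothesis homD : forall g x y, hom g x -> hom g y -> hom g (x + y).
Hypothesis homZ : forall g a x, hom g x -> hom g (a *: x).
Hypothesis hom0 : forall g, hom g 0.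
Hypothesis homI : hom 1%g 1.
Hypothesis homM : forall g h x y, hom g x -> hom h y -> hom (g * h)%g (x * y).

Lemma degree_part_hom (phi : L -> A) g p : graded_map hom phi ->
  hom g (nceval phi (degree_part g p)).
Proof.
move=> gphi; rewrite /nceval big_filter.
elim/big_ind: _ => //; first by move=> x y; apply: homD.
move=> m /eqP <-; apply: homZ; elim: m.2 => [|v s IHs]; first by rewrite !big_nil.
by rewrite !big_cons; apply: homM.
Qed.

End GradedStructure.

Definition nc_identity (A : algType F) (hom : gT -> A -> Prop) (p : ncpoly F L) :=
  forall phi, graded_map hom phi -> nceval phi p = 0.

Definition content_le1 (m : L -> nat) := forall v, (m v <= 1)%N.

(** The length, the word and the degree are chosen where the value on [A] is nonzero. Each of the
    three reductions preserves identities of any graded algebra, so the same polynomial serves for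
    all [B]. *)
Lemma multilinear_separation (A : algType F) (homA : gT -> A -> Prop) (f : gpoly F gT) phi :
    (forall g, homA g 0) -> graded_map homA phi -> galg_eval f phi <> 0 ->
  exists p g (m : L -> nat), [/\ has_content m p, content_le1 m,
    exists2 psi, graded_map homA psi & nceval psi (degree_part g p) <> 0 &
    forall (B : algType F) (homB : gT -> B -> Prop),
      (forall g x y, homB g x -> homB g y -> homB g (x + y)) ->
      (forall g a x, homB g x -> homB g (a *: x)) -> (forall g, homB g 0) ->
      homB 1%g 1 ->
      (forall g h x y, homB g x -> homB h y -> homB (g * h)%g (x * y)) ->
      (forall x : gT -> B, (forall g, homB g (x g)) -> \sum_g x g = 0 -> forall g, x g = 0) ->
      (forall phi, graded_map homB phi -> galg_eval f phi = 0) ->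
      nc_identity homB (degree_part g p)].
Proof.
move=> homA0 gphi nz.
have [d dE] := galg_eval_length f.
have [n lt_nd nzn] : exists2 n, (n < d)%N & length_part f n phi <> 0.
  apply: NNPP => no; apply: nz; rewrite dE big1 // => n _.
  by apply: NNPP => h; apply: no; exists n => //; apply: ltn_ord.
have n0 : (0 < n)%N.
  by case: (n) nzn => // -[]; rewrite /length_part big_pred0.
have [w0 [psi gpsi nzp]] := polarization_nonzero homA0 gphi n0 nzn.
have [g nzg] : exists g, nceval psi (degree_part g (polarization f w0)) <> 0.
  apply: NNPP => no; apply: nzp; rewrite nceval_degree_part big1 // => g _.
  by apply: NNPP => h; apply: no; exists g.
exists (polarization f w0), g, (fun v => count_mem v [seq polar_letter w0 i | i <- enum 'I_n]).
split; first exact: polarization_content.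
- move=> v; rewrite count_uniq_mem; first by case: (_ \in _).
  by rewrite map_inj_uniq ?enum_uniq //; apply: polar_letter_inj.
- by exists psi.
move=> B homB hD hZ h0 hI hM hdir idB chi gchi.
have lenB phi' : graded_map homB phi' -> length_part f n phi' = 0.
  move=> gphi'.
  (* Scaling all letters by [c] multiplies the part of length [n] by the [n]-th power of [c], which
     separates the lengths. *)
  apply: (@power_sum_eq0 _ d (fun n => length_part f n phi')) lt_nd => c.
  rewrite -[RHS](idB (fun v => c *: phi' v)) ?dE; last by move=> v; apply: hZ.
  by apply: eq_bigr => i _; rewrite length_part_scale.
move: g {nzg}; apply: (hdir (fun g => nceval chi (degree_part g (polarization f w0)))).
  by move=> g; apply: degree_part_hom.
rewrite -nceval_degree_part; apply/eqP.
have := polarization_length_part f w0 chi n0; rewrite big1 => [|U _].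
  by move/esym/eqP; rewrite scaler_eq0 signr_eq0.
rewrite lenB ?scaler0 // => v; elim/big_ind: _ => //; first by move=> x y; apply: hD.
by move=> i /andP[_ /eqP <-]; apply: (gchi (polar_letter w0 i)).
Qed.

End Multilinearization.

(** * The central polynomial *)

(* Variables of the central polynomial are coded by a kind, which selects one of
   the families [tX] to [tPC] below, and two indices. *)
Definition tag := (nat * nat * nat)%type.

Definition kind (v : tag) := v.1.1.

Definition ord_apply (T : Type) (x0 : T) n (h : 'I_n -> T) (a : nat) : T :=
  if insub a is Some i then h i else x0.

Lemma ord_applyE (T : Type) (x0 : T) n (h : 'I_n -> T) (i : 'I_n) :
  ord_apply x0 h (nat_of_ord i) = h i.
Proof. by rewrite /ord_apply valK. Qed.

Lemma sum_kind_le (I : finType) (h : I -> tag) c v :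
  injective h -> (forall i, kind (h i) = c) ->
  (\sum_i (h i == v : nat) <= (kind v == c : nat))%N.
Proof.
move=> hinj hc; case: (pickP (fun i => h i == v)) => [i /eqP <-|none].
  rewrite hc eqxx (bigD1 i) //= eqxx big1 // => j /negPf ji.
  by rewrite (inj_eq hinj) ji.
by rewrite big1 // => i _; rewrite none.
Qed.

Section CentralPolynomial.
Variables (F : fieldType) (gT : finGroupType) (n : nat) (deg : 'I_n -> gT).
Local Notation L := (nat * gT)%type.
Variables (k0 : nat) (q : 'I_k0 -> ncpoly F L).

Definition tX (i : 'I_n) : tag := (0%N, nat_of_ord i, 0%N).
Definition tY (i : 'I_n) : tag := (1%N, nat_of_ord i, 0%N).
Definition tXX (k i : 'I_n) : tag := (2%N, nat_of_ord k, nat_of_ord i).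
Definition tYY (k i : 'I_n) : tag := (3%N, nat_of_ord k, nat_of_ord i).
Definition tZZ (k i : 'I_n) : tag := (4%N, nat_of_ord k, nat_of_ord i).
Definition tP (t : 'I_k0) (v : L) : tag := (5%N, nat_of_ord t, choice.pickle v).
Definition tPA (t : 'I_k0) : tag := (6%N, nat_of_ord t, 0%N).
Definition tPC (t : 'I_k0) : tag := (7%N, nat_of_ord t, 0%N).

Local Notation poly := (ncpoly F tag).
Local Notation "p ** q" := (ncmul p q) (at level 40, left associativity).
Local Notation "$ v" := (ncvar F v) (at level 5).

Definition alt_poly k (arg : 'I_n -> poly) : poly :=
  \big[cat/[::]]_(s | deg_pres deg s) ncscale ((-1) ^+ s)
    (\big[@ncmul F _/ncone F _]_l ($(tYY k l) ** arg (s l) ** $(tZZ k l))).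

Definition razmyslov_poly k (u : poly) : poly :=
  \big[cat/[::]]_j alt_poly k
    (fun l => if l == j then u ** $(tXX k l) else $(tXX k l)).

(** The two letters around each [q t] are meant to carry a nonzero value of [q t] to the idempotent
    [E]. *)
Definition insertion_poly : poly :=
  \big[@ncmul F _/ncone F _]_t ($(tPA t) ** ncmap (tP t) (q t) ** $(tPC t)).

Definition central_poly : poly :=
  \big[cat/[::]]_(s | deg_pres deg s) ncscale ((-1) ^+ s)
    (\big[cat/[::]]_i ($(tX i) **
      (\big[@ncmul F _/ncone F _]_k
         razmyslov_poly k (if k == i then ncone F _ else $(tX k) ** $(tY (s k)))
       ** insertion_poly) ** $(tY (s i)))).

Lemma nceval_alt_poly (A : algType F) (rho : tag -> A) k arg :
  nceval rho (alt_poly k arg) =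
  alt deg (fun l => nceval rho (arg l)) (fun l => rho (tYY k l)) (fun l => rho (tZZ k l)).
Proof.
rewrite nceval_sum; apply: eq_bigr => s _; rewrite nceval_scale nceval_prod.
by congr (_ *: _); apply: eq_bigr => l _; rewrite !nceval_mul !nceval_var.
Qed.

Lemma nceval_insertion_poly (A : algType F) (rho : tag -> A) :
  nceval rho insertion_poly =
  \prod_t (rho (tPA t) * nceval (fun v => rho (tP t v)) (q t) * rho (tPC t)).
Proof.
rewrite nceval_prod; apply: eq_bigr => t _.
by rewrite !nceval_mul !nceval_var nceval_map.
Qed.

Lemma nceval_central_poly (A : algType F) (rho : tag -> A) :
  nceval rho central_poly =
  central_value deg (fun i => rho (tX i)) (fun i => rho (tY i))
    (fun k i => rho (tXX k i)) (fun k i => rho (tYY k i)) (fun k i => rho (tZZ k i))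
    (nceval rho insertion_poly).
Proof.
rewrite nceval_sum; apply: eq_bigr => s _; rewrite nceval_scale nceval_sum.
congr (_ *: _); apply: eq_bigr => i _.
rewrite !nceval_mul !nceval_var nceval_prod; congr (_ * (_ * _) * _).
apply: eq_bigr => k _; rewrite nceval_sum; apply: eq_bigr => j _.
rewrite nceval_alt_poly /alt; apply: eq_bigr => s' _; congr (_ *: _).
apply: eq_bigr => l _; congr (_ * _ * _).
case: eqP => _; rewrite ?nceval_mul ?nceval_var //; congr (_ * _).
by case: eqP => _; rewrite ?nceval_one ?nceval_mul ?nceval_var.
Qed.

Lemma alt_poly_content k arg (a : 'I_n -> tag -> nat) :
  (forall l, has_content (a l) (arg l)) ->
  has_content (fun v => \sum_l ((tYY k l == v) + a l v + (tZZ k l == v)))%N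
    (alt_poly k arg).
Proof.
move=> ha; apply: content_sum => s _; apply: content_scale.
pose c l v := ((tYY k l == v) + a (s l) v + (tZZ k l == v))%N.
apply: (eq_content _ (content_prod (m := c) (index_enum 'I_n) _)) => [v|l].
  rewrite /c !big_split /=; congr (_ + _ + _)%N.
  by rewrite [RHS](reindex_inj (@perm_inj _ s)).
exact: (content_mul (content_mul (content_var F (tYY k l)) (ha (s l)))
  (content_var F (tZZ k l))).
Qed.

Arguments alt_poly_content k {arg a} _ w _ _.

Definition block_content k v :=
  (\sum_l ((tYY k l == v) + (tXX k l == v) + (tZZ k l == v)))%N.

Lemma razmyslov_poly_content k u a : has_content a u ->
  has_content (fun v => a v + block_content k v)%N (razmyslov_poly k u).
Proof.
move=> hu; apply: content_sum => j _.
pose c l v := ((if l == j then a v else 0) + (tXX k l == v))%N.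
have h l : has_content (c l) (if l == j then u ** $(tXX k l) else $(tXX k l)).
  rewrite /c.
  case: ifP => _; first exact: content_mul hu (content_var F _).
  exact: content_var.
apply: (eq_content _ (alt_poly_content k h)) => v; rewrite /c /block_content !big_split /=.
have -> : (\sum_(i < n) (if i == j then a v else 0) = a v)%N.
  by rewrite -big_mkcond big_pred1_eq.
by rewrite -!addnA addnCA.
Qed.

Arguments razmyslov_poly_content k {u a} _ w _ _.

Variable mq : 'I_k0 -> L -> nat.
Hypothesis mqP : forall t, has_content (mq t) (q t).
Arguments mqP : clear implicits.
Hypothesis mq1 : forall t, content_le1 (mq t).

Definition insertion_content t (v : tag) : nat :=
  if v.1 == (5%N, nat_of_ord t) then oapp (mq t) 0%N (choice.pickle_inv v.2) else 0%N.

Lemma insertion_poly_content :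
  has_content (fun v => \sum_t ((tPA t == v) + insertion_content t v + (tPC t == v)))%N
    insertion_poly.
Proof.
apply: (content_prod (m := fun t v => ((tPA t == v) + insertion_content t v + (tPC t == v))%N) (index_enum _) _) => t.
suff hq : has_content (insertion_content t) (ncmap (tP t) (q t)).
  exact: (content_mul (content_mul (content_var F (tPA t)) hq) (content_var F (tPC t))).
apply: (content_map (mqP t)) => [v|v' nv'|v w].
- by rewrite /insertion_content eqxx choice.pickleK_inv.
- rewrite /insertion_content; case: eqP => // v1.
  have := @choice.pickle_invK L v'.2; case: (choice.pickle_inv v'.2) => //= w wv.
  case/eqP: (nv' w); rewrite /tP wv; by case: v' v1 {nv' wv} => [v1 v2] /= ->.
- by case; apply: (pcan_inj choice.pickleK).
Qed.

Definition central_content v :=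
  (\sum_i (tX i == v) + \sum_i (tY i == v) + \sum_k block_content k v +
   \sum_t ((tPA t == v) + insertion_content t v + (tPC t == v)))%N.

(** In the term of [s] and [i], [x i] and [y (s i)] stand outside and the other pairs inside the
    blocks, so each letter occurs once. The block of index [i] is applied to 1 and still brings its
    own letters. *)
Lemma central_poly_content : has_content central_content central_poly.
Proof.
apply: content_sum => s _; apply: content_scale; apply: content_sum => i _.
pose u k v := (if k == i then 0 else (tX k == v) + (tY (s k) == v))%N.
have hu k : has_content (u k) (if k == i then ncone F _ else $(tX k) ** $(tY (s k))).
  rewrite /u; case: eqP => _; first exact: content_one.
  exact: content_mul (content_var F _) (content_var F _).
have h := content_mul (content_mul (content_var F (tX i))
  (content_mul (content_prod (index_enum _) (fun k => razmyslov_poly_content k (hu k)))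
     insertion_poly_content)) (content_var F (tY (s i))).
apply: eq_content h => v; rewrite /central_content.
have -> : (\sum_i (tY i == v) = \sum_k (tY (s k) == v))%N.
  by rewrite (reindex_inj (@perm_inj _ s)).
rewrite -[in RHS]big_split /= [in RHS](bigD1 i) //= big_split /=.
have -> : (\sum_i0 u i0 v = \sum_(k | k != i) ((tX k == v) + (tY (s k) == v)))%N.
  rewrite (bigD1 i) //= /u eqxx add0n; apply: eq_bigr => k /negPf ki; by rewrite ki.
by rewrite -!addnA; congr addn; rewrite [RHS]addnC -!addnA.
Qed.

Lemma central_content_le1 v : (central_content v <= 1)%N.
Proof.
have eX : (\sum_i (tX i == v) <= (kind v == 0))%N.
  by apply: sum_kind_le => // i j [] /val_inj.
have eY : (\sum_i (tY i == v) <= (kind v == 1))%N.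
  by apply: sum_kind_le => // i j [] /val_inj.
have e2 (h : 'I_n -> 'I_n -> tag) c :
    (forall k l, h k l = (c, nat_of_ord k, nat_of_ord l)) ->
    (\sum_k \sum_l (h k l == v) <= (kind v == c))%N.
  move=> hE; rewrite pair_bigA /=; apply: (sum_kind_le (h := fun p => h p.1 p.2)).
    by move=> [k l] [k' l'] /=; rewrite !hE => -[] /val_inj -> /val_inj ->.
  by move=> p; rewrite hE.
have eB : (\sum_k block_content k v <= (kind v == 3) + (kind v == 2) + (kind v == 4))%N.
  rewrite /block_content; under eq_bigr do rewrite !big_split /=.
  rewrite !big_split /=.
  by rewrite !leq_add // e2.
have eA : (\sum_t (tPA t == v) <= (kind v == 6))%N.
  by apply: sum_kind_le => // i j [] /val_inj.
have eC : (\sum_t (tPC t == v) <= (kind v == 7))%N.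
  by apply: sum_kind_le => // i j [] /val_inj.
have eI : (\sum_t insertion_content t v <= (kind v == 5))%N.
  case: (pickP (fun t : 'I_k0 => v.1 == (5%N, nat_of_ord t))) => [t /eqP vt|none].
    rewrite (bigD1 t) //= big1 ?addn0 => [|t' /negPf tt']; last first.
      by rewrite /insertion_content vt xpair_eqE eqxx /= eq_sym val_eqE tt'.
    rewrite /insertion_content /kind vt !eqxx; case: (choice.pickle_inv _) => //= w.
    exact: mq1.
  by rewrite big1 // => t _; rewrite /insertion_content none.
rewrite /central_content !big_split /=.
apply: leq_trans (leq_add (leq_add (leq_add eX eY) eB) (leq_add (leq_add eA eI) eC)) _.
by move: (kind v); do 8!case=> //.
Qed.

End CentralPolynomial.

(** * Values of the central polynomial *)

Section CentralPolynomialValues.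
Variables (F : fieldType) (A : algType F) (gT : finGroupType) (hom : gT -> A -> Prop).
Local Notation L := (nat * gT)%type.
Hypothesis char0 : [pchar F] =i pred0.
Hypothesis homD : forall g x y, hom g x -> hom g y -> hom g (x + y).
Hypothesis homZ : forall g a x, hom g x -> hom g (a *: x).
Hypothesis hom0 : forall g, hom g 0.
Hypothesis homI : hom 1%g 1.
Hypothesis homM : forall g h x y, hom g x -> hom h y -> hom (g * h)%g (x * y).
Variables (n : nat) (deg : 'I_n -> gT).
Variables (b : 'I_n -> A) (co : 'I_n -> A -> F).
Variables (bd : 'I_n -> A) (cod : 'I_n -> A -> F).
Hypothesis n_gt0 : (0 < n)%N.
Hypothesis bP : graded_coords hom b deg co.
Hypothesis bdP : graded_coords hom bd (fun i => (deg i)^-1%g) cod.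
Hypotheses (hb : forall i, hom (deg i) (b i))
           (hbd : forall i, hom (deg i)^-1%g (bd i)).
Variable N0 : F.
Hypothesis nz_N0 : N0 != 0.
Hypothesis tbd : forall i j, left_trace b co (b i * bd j) = N0 * (i == j)%:R.
Variable kap : A -> F.
Hypothesis casimir : forall a, hom 1%g a -> \sum_i b i * a * bd i = (kap a)%:A.
Variables (E : A) (dy : 'I_n -> gT) (y0 z0 : 'I_n -> A).
Hypotheses (EE : E * E = E) (nz_kE : kap E != 0).
Hypothesis hy0 : forall l, hom (dy l) (y0 l).
Hypothesis hz0 : forall l, hom (dy l * deg l)^-1%g (z0 l).
Hypothesis y0z0 : forall j l, deg j = deg l ->
  y0 l * b j * z0 l = if j == l then E else 0.
Variables (k0 : nat) (q : 'I_k0 -> ncpoly F L) (gq : 'I_k0 -> gT).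
Variable psi : 'I_k0 -> L -> A.
Hypothesis gpsi : forall t, graded_map hom (psi t).
Hypothesis hq : forall t phi, graded_map hom phi -> hom (gq t) (nceval phi (q t)).
Variable mq : 'I_k0 -> L -> nat.
Hypothesis mqP : forall t, has_content (mq t) (q t).
Arguments mqP : clear implicits.
Hypothesis mq1 : forall t, content_le1 (mq t).

Lemma prod_idempotent m : \prod_(i < m) E * E = E.
Proof. by elim: m => [|m IHm]; rewrite ?big_ord0 ?mul1r // big_ord_recl -mulrA IHm EE. Qed.

Lemma prod_idempotent_gt0 m : (0 < m)%N -> \prod_(i < m) E = E.
Proof. by case: m => // m _; rewrite big_ord_recr /= prod_idempotent. Qed.

Lemma coord_mx_self (c : 'I_n -> A) d ce : graded_coords hom c d ce ->
  \det (coord_mx ce c) = 1.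
Proof.
case=> _ cE _ _; rewrite -(det1 F n); congr (\det _); apply/matrixP => i j.
by rewrite !mxE cE eq_sym.
Qed.

Lemma alt_hom y z : (forall l, hom (dy l) (y l)) ->
  (forall l, hom (dy l * deg l)^-1%g (z l)) -> hom 1%g (alt deg b y z).
Proof.
move=> hy hz; rewrite /alt; elim/big_ind: _ => //; first by move=> u v; apply: homD.
move=> s /forallP ps; apply: homZ; elim/big_ind: _ => // [u v|l _].
  by rewrite -{3}[1%g]mulg1; apply: homM.
rewrite -(mulgV (dy l * deg l)%g) -{1}(eqP (ps l)).
by apply: homM => //; apply: homM.
Qed.

(** The letters [y0 l] and [z0 l] recognise [b l] among the basis elements of its degree, so any
    other degree preserving permutation has a vanishing slot. What remains is a power of [E]. *)
Lemma alt_basis : alt deg b y0 z0 = E.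
Proof.
rewrite /alt (bigD1 1%g) /=; last by apply/forallP => l; rewrite perm1.
rewrite odd_perm1 scale1r [X in _ + X]big1 ?addr0 => [|s /andP[/forallP ps s1]].
  rewrite (eq_bigr (fun=> E)) ?prod_idempotent_gt0 // => l _.
  by rewrite perm1 y0z0 // eqxx.
have /existsP[l sl] : [exists l, s l != l].
  apply: contraNT s1 => /existsPn no; apply/eqP; apply/permP => l; rewrite perm1.
  by apply/eqP; have := no l; rewrite negbK.
rewrite (@prod_eq0 _ _ _ _ _ l) ?scaler0 ?mem_index_enum //.
by rewrite y0z0 ?(negPf sl) //; apply/eqP/ps.
Qed.

Variables (da : 'I_k0 -> gT).

(** The closing letters, of kinds 4 and 7, have the inverse of the degree accumulated before them,
    so alternating slots and insertions have degree 1, as the Casimir sum requires. *)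
Definition tag_degree (v : tag) : gT :=
  match kind v with
  | 0 => ord_apply 1%g deg v.1.2
  | 1 => ord_apply 1%g (fun i => (deg i)^-1%g) v.1.2
  | 2 => ord_apply 1%g deg v.2
  | 3 => ord_apply 1%g dy v.2
  | 4 => ord_apply 1%g (fun l => (dy l * deg l)^-1%g) v.2
  | 5 => oapp snd 1%g (choice.pickle_inv v.2 : option L)
  | 6 => ord_apply 1%g da v.1.2
  | 7 => ord_apply 1%g (fun t => (da t * gq t)^-1%g) v.1.2
  | _ => 1%g
  end.

Definition tag_letter (v : tag) : L := (choice.pickle v, tag_degree v).

Lemma tag_letter_inj : injective tag_letter.
Proof. by move=> u v [] /(pcan_inj choice.pickleK). Qed.

Definition central_gpoly : ncpoly F L := ncmap tag_letter (central_poly deg q).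

Lemma central_gpoly_content : exists m, [/\ has_content m central_gpoly,
  content_le1 m & exists v, m v = 1%N].
Proof.
pose m (w : L) := if choice.pickle_inv w.1 is Some v then
  if tag_letter v == w then central_content n mq v else 0%N else 0%N.
have mE v : m (tag_letter v) = central_content n mq v.
  by rewrite /m choice.pickleK_inv eqxx.
have cP : has_content (central_content n mq) (central_poly deg q).
  exact: central_poly_content.
exists m; split.
- apply: (content_map cP) => // [w nw|].
    by rewrite /m; case: choice.pickle_inv => // v; rewrite (negPf (nw v)).
  exact: tag_letter_inj.
- move=> w; rewrite /m; case: choice.pickle_inv => // v; case: ifP => // _.
  exact: central_content_le1.
(* A letter of content 1 excludes empty monomials, which is needed for the passage to words. *)
exists (tag_letter (tX (Ordinal n_gt0))); rewrite mE.
apply/eqP; rewrite eqn_leq central_content_le1 // /central_content.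
by rewrite (bigD1 (Ordinal n_gt0)) //= eqxx -!addnA.
Qed.

Lemma tag_hom (B : algType F) (homB : gT -> B -> Prop) phi v :
  graded_map homB phi -> homB (tag_degree v) (phi (tag_letter v)).
Proof. by move=> gphi; apply: (gphi (tag_letter v)). Qed.

Lemma insertion_graded (B : algType F) (homB : gT -> B -> Prop) phi (t : 'I_k0) :
  graded_map homB phi -> graded_map homB (fun v => phi (tag_letter (tP t v))).
Proof.
move=> gphi v; have := tag_hom (tP t v) gphi.
by rewrite /tag_degree /= choice.pickleK_inv.
Qed.

Lemma central_gpoly_scalar phi : graded_map hom phi ->
  exists c, nceval phi central_gpoly = c%:A.
Proof.
move=> gphi; rewrite nceval_map nceval_central_poly.
pose rho v := phi (tag_letter v).
have hrho v := tag_hom v gphi.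
rewrite (central_valueE homI homM bP bdP hb hbd tbd casimir).
- by eexists.
- by move=> i; have := hrho (tX i); rewrite /tag_degree /= ord_applyE.
- by move=> i; have := hrho (tY i); rewrite /tag_degree /= ord_applyE.
- by move=> k i; have := hrho (tXX k i); rewrite /tag_degree /= ord_applyE.
rewrite -[1%g]mulg1; apply: homM.
  elim/big_ind: _ => // [u v|k _].
    by rewrite -{3}[1%g]mulg1; apply: homM.
  apply: alt_hom => l.
    by have := hrho (tYY k l); rewrite /tag_degree /= ord_applyE.
  by have := hrho (tZZ k l); rewrite /tag_degree /= ord_applyE.
rewrite nceval_insertion_poly; elim/big_ind: _ => // [u v|t _].
  by rewrite -{3}[1%g]mulg1; apply: homM.
rewrite -(mulgV (da t * gq t)%g); apply: homM; last first.
  by have := hrho (tPC t); rewrite /tag_degree /= ord_applyE.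
apply: homM; first by have := hrho (tPA t); rewrite /tag_degree /= ord_applyE.
by apply: hq; apply: insertion_graded.
Qed.

(** At the dual bases the determinants are 1 and all blocks and insertions take the value [E]. This
    leaves [t 1], equal to [n], times a power of [N0] times [kap E]. *)
Lemma central_gpoly_nonzero (pa pc : 'I_k0 -> A) :
    (forall t, [/\ hom (da t) (pa t), hom (da t * gq t)^-1%g (pc t) &
       pa t * nceval (psi t) (q t) * pc t = E]) ->
  exists2 phi, graded_map hom phi & nceval phi central_gpoly <> 0.
Proof.
move=> pP; pose rho (v : tag) : A :=
  match kind v with
  | 0 => ord_apply 0 b v.1.2
  | 1 => ord_apply 0 bd v.1.2
  | 2 => ord_apply 0 b v.2
  | 3 => ord_apply 0 y0 v.2
  | 4 => ord_apply 0 z0 v.2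
  | 5 => oapp (fun w => ord_apply 0 (fun t => psi t w) v.1.2) 0
           (choice.pickle_inv v.2 : option L)
  | 6 => ord_apply 0 pa v.1.2
  | 7 => ord_apply 0 pc v.1.2
  | _ => 0
  end.
have hord m (d : 'I_m -> gT) (h : 'I_m -> A) a : (forall i, hom (d i) (h i)) ->
    hom (ord_apply 1%g d a) (ord_apply 0 h a).
  by move=> dh; rewrite /ord_apply; case: insub.
have hrho v : hom (tag_degree v) (rho v).
  case: v => [[kd a] c]; rewrite /tag_degree /rho /kind /=.
  case: kd => [|[|[|[|[|[|[|[|kd]]]]]]]] //=; try by apply: hord => // t; have [] := pP t.
  case: (choice.pickle_inv c) => [w|] //=; rewrite /ord_apply.
  by case: insub => // t; apply: gpsi.
pose phi (w : L) : A := if (choice.pickle_inv w.1 : option tag) is Some v then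
  if tag_degree v == w.2 then rho v else 0 else 0.
have phiE v : phi (tag_letter v) = rho v.
  by rewrite /phi choice.pickleK_inv eqxx.
exists phi.
  move=> w; rewrite /phi; case: choice.pickle_inv => // v.
  by case: eqP => // <-; apply: hrho.
rewrite nceval_map nceval_central_poly nceval_insertion_poly /=.
have -> : (fun i => phi (tag_letter (tX i))) = b.
  by apply: functional_extensionality => i; rewrite phiE /rho /= ord_applyE.
have -> : (fun i => phi (tag_letter (tY i))) = bd.
  by apply: functional_extensionality => i; rewrite phiE /rho /= ord_applyE.
have -> : (fun k i => phi (tag_letter (tXX k i))) = (fun k : 'I_n => b).
  apply: functional_extensionality => k; apply: functional_extensionality => i.
  by rewrite phiE /rho /= ord_applyE.
have -> : (fun k i => phi (tag_letter (tYY k i))) = (fun k : 'I_n => y0).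
  apply: functional_extensionality => k; apply: functional_extensionality => i.
  by rewrite phiE /rho /= ord_applyE.
have -> : (fun k i => phi (tag_letter (tZZ k i))) = (fun k : 'I_n => z0).
  apply: functional_extensionality => k; apply: functional_extensionality => i.
  by rewrite phiE /rho /= ord_applyE.
rewrite (eq_bigr (fun=> E)) => [|t _]; last first.
  have [_ _ <-] := pP t; rewrite !phiE /rho /= !ord_applyE.
  congr (_ * nceval _ _ * _); apply: functional_extensionality => w.
  by rewrite phiE /rho /= choice.pickleK_inv /= ord_applyE.
have pE : (\prod_(k < n) alt deg b y0 z0) * \prod_(t < k0) E = E.
  rewrite (eq_bigr (fun=> E)) => [|k _]; last exact: alt_basis.
  rewrite (prod_idempotent_gt0 n_gt0); case: (k0) => [|m]; first by rewrite big_ord0 mulr1.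
  by rewrite prod_idempotent_gt0.
have hE : hom 1%g E.
  by rewrite -alt_basis; apply: alt_hom.
rewrite (central_valueE homI homM bP bdP hb hbd tbd casimir) ?pE //.
rewrite !(coord_mx_self bP) (coord_mx_self bdP) big1 ?mul1r //; apply/eqP.
rewrite scaler_eq0 negb_or oner_eq0 andbT !mulf_neq0 ?expf_neq0 //.
rewrite /left_trace (eq_bigr (fun=> 1)) ?sumr_const ?card_ord => [|i _].
  by rewrite natr_eq0_char0 // -lt0n.
by case: (bP) => _ cb _ _; rewrite mul1r cb eqxx.
Qed.

Lemma central_gpoly_identity (B : algType F) (homB : gT -> B -> Prop) t :
  nc_identity homB (q t) -> nc_identity homB central_gpoly.
Proof.
move=> idq phi gphi; rewrite nceval_map nceval_central_poly.
have -> : nceval (phi \o tag_letter) (insertion_poly q) = 0.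
  rewrite nceval_insertion_poly; apply: (@prod_eq0 _ _ _ _ _ t); rewrite ?mem_index_enum //=.
  by rewrite idq ?mulr0 ?mul0r //; apply: insertion_graded.
rewrite /central_value big1 // => s _; rewrite big1 ?scaler0 // => i _.
by rewrite mulr0 mulr0 mul0r.
Qed.

End CentralPolynomialValues.

Theorem graded_central_polynomial (F : fieldType) (A : algType F)
    (gT : finGroupType) (hom : gT -> A -> Prop) (n : nat) (deg : 'I_n -> gT)
    (b : 'I_n -> A) (co : 'I_n -> A -> F) (bd : 'I_n -> A) (cod : 'I_n -> A -> F)
    (N0 : F) (kap : A -> F) (E : A) (dy : 'I_n -> gT) (y0 z0 : 'I_n -> A)
    (k0 : nat) (q : 'I_k0 -> ncpoly F (nat * gT)%type) (gq : 'I_k0 -> gT)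
    (mq : 'I_k0 -> nat * gT -> nat) :
  [pchar F] =i pred0 ->
  (forall g x y, hom g x -> hom g y -> hom g (x + y)) ->
  (forall g a x, hom g x -> hom g (a *: x)) ->
  (forall g, hom g 0) -> hom 1%g 1 ->
  (forall g h x y, hom g x -> hom h y -> hom (g * h)%g (x * y)) ->
  (0 < n)%N ->
  graded_coords hom b deg co -> graded_coords hom bd (fun i => (deg i)^-1%g) cod ->
  (forall i, hom (deg i) (b i)) -> (forall i, hom (deg i)^-1%g (bd i)) ->
  N0 != 0 -> (forall i j, left_trace b co (b i * bd j) = N0 * (i == j)%:R) ->
  (forall a, hom 1%g a -> \sum_i b i * a * bd i = (kap a)%:A) ->
  E * E = E -> kap E != 0 ->
  (forall l, hom (dy l) (y0 l)) -> (forall l, hom (dy l * deg l)^-1%g (z0 l)) ->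
  (forall j l, deg j = deg l -> y0 l * b j * z0 l = if j == l then E else 0) ->
  (forall g v, hom g v -> v <> 0 ->
    exists h a c, [/\ hom h a, hom (h * g)^-1%g c & a * v * c = E]) ->
  (forall t, exists2 psi, graded_map hom psi & nceval psi (q t) <> 0) ->
  (forall t phi, graded_map hom phi -> hom (gq t) (nceval phi (q t))) ->
  (forall t, has_content (mq t) (q t)) -> (forall t, content_le1 (mq t)) ->
  exists p : ncpoly F (nat * gT)%type,
  [/\ exists m, [/\ has_content m p, content_le1 m & exists v, m v = 1%N],
      forall phi, graded_map hom phi -> exists c, nceval phi p = c%:A,
      exists2 phi, graded_map hom phi & nceval phi p <> 0 &
      forall (B : algType F) (homB : gT -> B -> Prop) t,
        nc_identity homB (q t) -> nc_identity homB p].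
Proof.
move=> char0 homD homZ hom0 homI homM n0 bP bdP hb hbd nzN tbd cas EE kE hy hz yz sw
  nzq hq mqP mq1.
have expsi t : exists psi, graded_map hom psi /\ nceval psi (q t) <> 0.
  by have [psi ? ?] := nzq t; exists psi.
have [psi psiP] := fin_all_exists expsi.
have ex t : exists d : gT * (A * A), [/\ hom d.1 d.2.1, hom (d.1 * gq t)^-1%g d.2.2 &
    d.2.1 * nceval (psi t) (q t) * d.2.2 = E].
  have [gp nz] := psiP t.
  have [h [a [c [? ? ?]]]] := sw _ _ (hq t _ gp) nz.
  by exists (h, (a, c)).
have [d dP] := fin_all_exists ex.
exists (central_gpoly deg dy q gq (fun t => (d t).1)); split.
- exact: central_gpoly_content.
- exact: (central_gpoly_scalar homD homZ hom0 homI homM bP bdP hb hbd tbd cas _ hq).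
- have gpsi t : graded_map hom (psi t) by have [] := psiP t.
  exact: (central_gpoly_nonzero char0 homD homZ hom0 homI homM n0 bP bdP hb hbd nzN
    tbd cas EE kE hy hz yz gpsi dP).
exact: central_gpoly_identity.
Qed.

(** * The trace form of a groupoid basis *)

Definition unital_algebra (F : fieldType) (V : vectType F) (mul : V -> V -> V)
    (one : V) : Prop :=
  [/\ is_algebra mul, left_id one mul, right_id one mul & one != 0].

Section UnitalAlgebra.
Variables (F : fieldType) (V : vectType F) (mul : V -> V -> V) (one : V).
Hypothesis h : unital_algebra mul one.

(** The alias retains [h], so that the algebra structure built from the product and the unit can be
    attached to a type depending on them. *)
Definition ualg : Type := let _ := h in V.

HB.instance Definition _ := GRing.Lmodule.copy ualg V.

Let algV : is_algebra mul. Proof. by case: h. Qed.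

Lemma ualg_mulA : associative (mul : ualg -> ualg -> ualg).
Proof. exact: amulA. Qed.

Lemma ualg_mul1 : left_id (one : ualg) (mul : ualg -> ualg -> ualg).
Proof. by case: h. Qed.

Lemma ualg_mul1r : right_id (one : ualg) (mul : ualg -> ualg -> ualg).
Proof. by case: h. Qed.

Lemma ualg_mulDl : left_distributive (mul : ualg -> ualg -> ualg) +%R.
Proof. by move=> x y z; apply: amulDl. Qed.

Lemma ualg_mulDr : right_distributive (mul : ualg -> ualg -> ualg) +%R.
Proof. by move=> x y z; apply: amulDr. Qed.

Lemma ualg_one_neq0 : (one : ualg) != 0.
Proof. by case: h. Qed.

HB.instance Definition _ := GRing.Zmodule_isNzRing.Build ualg
  ualg_mulA ualg_mul1 ualg_mul1r ualg_mulDl ualg_mulDr ualg_one_neq0.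

Lemma ualg_scaleAl (a : F) (x y : ualg) : a *: (x * y) = (a *: x) * y.
Proof. by rewrite [RHS](amulZl algV). Qed.

HB.instance Definition _ := GRing.Lmodule_isLalgebra.Build F ualg ualg_scaleAl.

Lemma ualg_scaleAr (a : F) (x y : ualg) : a *: (x * y) = x * (a *: y).
Proof. by rewrite [RHS](amulZr algV). Qed.

HB.instance Definition _ := GRing.Lalgebra_isAlgebra.Build F ualg ualg_scaleAr.

Definition ualg_hom (gT : finGroupType) (gr : gT -> {vspace V}) g (x : ualg) : Prop :=
  (x : V) \in gr g.

Lemma ualg_hom_closed (gT : finGroupType) (gr : gT -> {vspace V}) :
    is_grading mul gr -> one \in gr 1%g ->
  [/\ forall g x y, ualg_hom gr g x -> ualg_hom gr g y -> ualg_hom gr g (x + y),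
    forall g a x, ualg_hom gr g x -> ualg_hom gr g (a *: x),
    forall g, ualg_hom gr g 0, ualg_hom gr 1%g 1 &
    forall g h x y, ualg_hom gr g x -> ualg_hom gr h y -> ualg_hom gr (g * h)%g (x * y)].
Proof.
move=> grV one1; split=> //; first by move=> g x y; apply: memvD.
- by move=> g a x; apply: memvZ.
- by move=> g; apply: mem0v.
by move=> g k x y; apply: amul_gr.
Qed.

Lemma ualg_hom_direct (gT : finGroupType) (gr : gT -> {vspace V}) (x : gT -> ualg) :
    is_grading mul gr -> (forall g, ualg_hom gr g (x g)) -> \sum_g x g = 0 ->
  forall g, x g = 0.
Proof.
case=> /directv_sum_independent dir _ _ hx x0 g.
by apply: (dir x) => // k _; apply: hx.
Qed.

Lemma eval_wordE (gT : finGroupType) (phi : nat * gT -> ualg) w :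
  eval_word mul phi w = \prod_(v <- letters w) phi v.
Proof.
rewrite /eval_word /letters big_cons; case: w => v s /=.
by elim: s (phi v) => [|u s IHs] x; rewrite ?big_nil ?mulr1 // big_cons mulrA -IHs.
Qed.

Lemma gevalE (gT : finGroupType) (phi : nat * gT -> ualg) f :
  geval mul phi f = galg_eval f phi.
Proof. by apply: eq_bigr => w _; rewrite eval_wordE. Qed.

End UnitalAlgebra.

(** * Coordinates, dual basis and Casimir sum of a groupoid basis *)

Section GroupoidBasis.
Variables (F : fieldType) (gT : finGroupType) (V : vectType F).
Variables (mul : V -> V -> V) (gr : gT -> {vspace V}).
Hypotheses (char0 : [pchar F] =i pred0).
Hypotheses (algV : is_algebra mul) (grV : is_grading mul gr).
Variables (r : nat) (gs : nat -> gT) (H : {set gT}) (al : gT -> gT -> F).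
Variable B : 'I_r -> gT -> 'I_r -> V.
Hypothesis gbB : groupoid_basis mul gr gs H al B.
Local Notation "x ** y" := (mul x y) (at level 40, left associativity).

Definition triples : {set 'I_r * gT * 'I_r} := [set p | p.1.2 \in H].
Local Notation n := #|triples|.
Local Notation gam := (@enum_val _ (mem triples)).

Definition gbasis (k : 'I_n) : V := B (gam k).1.1 (gam k).1.2 (gam k).2.

Definition gcoord (k : 'I_n) (x : V) : F := coord [tuple gbasis k | k < n] k x.

Lemma gamH k : (gam k).1.2 \in H.
Proof. by have := enum_valP k; rewrite inE. Qed.

Lemma sum_triples (R : nmodType) (f : 'I_r * gT * 'I_r -> R) :
  \sum_k f (gam k) = \sum_i \sum_(h in H) \sum_j f (i, h, j).
Proof.
rewrite -big_enum_val.
rewrite (eq_bigl (fun p : 'I_r * gT * 'I_r => p.1.2 \in H)) => [|p]; last by rewrite inE.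
rewrite pair_big_dep /= pair_big /=.
apply: eq_big => [[[i h] j]|[[i h] j]] //=; by rewrite andbT.
Qed.

Lemma gbasis_span v : v \in <<[tuple gbasis k | k < n]>>%VS.
Proof.
case: gbB => _ _ span _; have [c ->] := span v.
rewrite -(sum_triples (fun p => c p.1.1 p.1.2 p.2 *: B p.1.1 p.1.2 p.2)).
apply: memv_suml => k _; apply: memvZ; apply: memv_span.
by apply/tnthP; exists k; rewrite tnth_mktuple.
Qed.

Lemma gbasis_free : free [tuple gbasis k | k < n].
Proof.
case: gbB => _ _ _ fr; apply/freeP => c c0 k.
pose c' i h j := if [pick k | gam k == (i, h, j)] is Some k then c k else 0.
have c'E l : c' (gam l).1.1 (gam l).1.2 (gam l).2 = c l.
  rewrite /c' -!surjective_pairing; case: pickP => [l' /eqP /enum_val_inj -> //|].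
  by move/(_ l); rewrite eqxx.
rewrite -c'E; apply: fr (gamH k).
rewrite -(sum_triples (fun p => c' p.1.1 p.1.2 p.2 *: B p.1.1 p.1.2 p.2)) -[RHS]c0.
by apply: eq_bigr => l _; rewrite c'E nth_mktuple.
Qed.

Lemma gcoord_sum x : x = \sum_k gcoord k x *: gbasis k.
Proof.
rewrite {1}(coord_span (gbasis_span x)); apply: eq_bigr => k _.
by rewrite nth_mktuple.
Qed.

Lemma gcoord_gbasis k l : gcoord k (gbasis l) = (k == l)%:R.
Proof.
rewrite /gcoord -(nth_mktuple (fun k => gbasis k) 0 l) coord_free ?gbasis_free //.
by rewrite eq_sym.
Qed.

Definition gdeg (k : 'I_n) : gT := ((gs (gam k).1.1)^-1 * (gam k).1.2 * gs (gam k).2)%g.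

Lemma gbasis_gr k : gbasis k \in gr (gdeg k).
Proof. by case: gbB => hB _ _ _; apply: hB; apply: gamH. Qed.

Lemma gcoord_is_linear k : linear (gcoord k : V -> F^o).
Proof. by move=> a x y; rewrite /gcoord linearP. Qed.
HB.instance Definition _ k :=
  GRing.isLinear.Build F V F^o _ (gcoord k) (gcoord_is_linear k).

Lemma gcoordZ k a x : gcoord k (a *: x) = a * gcoord k x.
Proof. exact: linearZ. Qed.

Lemma gcoordP k a x y : gcoord k (a *: x + y) = a * gcoord k x + gcoord k y.
Proof. exact: gcoord_is_linear. Qed.

Lemma gcoord0 k : gcoord k 0 = 0.
Proof. exact: linear0. Qed.

Lemma gcoord_lin_sum k (I : Type) (s : seq I) (Q : pred I) (f : I -> V) :
  gcoord k (\sum_(i <- s | Q i) f i) = \sum_(i <- s | Q i) gcoord k (f i).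
Proof. exact: linear_sum. Qed.

Lemma gcoord_deg g x k : x \in gr g -> gcoord k x != 0 -> gdeg k = g.
Proof.
move=> gx nz; apply/eqP; apply: contraNT nz => kg.
have -> : x = \sum_l (gcoord l x * (gdeg l == g)%:R) *: gbasis l.
  have := congr1 (gcomp gr g) (gcoord_sum x); rewrite (gcompE grV _ gx) eqxx => {1}->.
  rewrite linear_sum; apply: eq_bigr => l _.
  rewrite linearZ /= (gcompE grV _ (gbasis_gr l)) eq_sym.
  by case: eqP => _; rewrite ?mulr1 ?mulr0 ?scaler0 ?scale0r.
rewrite linear_sum big1 // => l _; rewrite linearZ /= gcoord_gbasis.
have [<-|_] := eqVneq k l; first by rewrite (negPf kg) mulr0 scale0r.
by rewrite scaler0.
Qed.

Hypothesis r_gt0 : (0 < r)%N.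
Hypotheses (H1 : 1%g \in H)
  (HM : forall h k, h \in H -> k \in H -> (h * k)%g \in H)
  (HV : forall h, h \in H -> h^-1%g \in H).
Hypothesis al0 : forall h k, h \in H -> k \in H -> al h k != 0.
Hypothesis al1 : forall h, h \in H -> al 1%g h = 1 /\ al h 1%g = 1.

Definition gone : V := \sum_i B i 1%g i.

Lemma mulB i h j k h' l : h \in H -> h' \in H ->
  B i h j ** B k h' l = if j == k then al h h' *: B i (h * h')%g l else 0.
Proof. by case: gbB => _ mB _ _; apply: mB. Qed.

Definition index0 : 'I_r := Ordinal r_gt0.

Lemma triple0 : (index0, 1%g, index0) \in triples.
Proof. by rewrite inE. Qed.

Definition grank (p : 'I_r * gT * 'I_r) : 'I_n := enum_rank_in triple0 p.

Lemma grankK p : p \in triples -> gam (grank p) = p.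
Proof. by move=> pT; rewrite /grank enum_rankK_in. Qed.

Lemma gcoord_B k i h j : h \in H -> gcoord k (B i h j) = (gam k == (i, h, j))%:R.
Proof.
move=> Hh; have pT : (i, h, j) \in triples by rewrite inE.
have -> : B i h j = gbasis (grank (i, h, j)) by rewrite /gbasis grankK.
rewrite gcoord_gbasis -{2}(grankK pT).
by rewrite (inj_eq enum_val_inj).
Qed.

Lemma B_neq0 i h j : h \in H -> B i h j != 0.
Proof.
move=> Hh; apply/eqP => B0; have pT : (i, h, j) \in triples by rewrite inE.
have := gcoord_B (grank (i, h, j)) i j Hh; rewrite B0 linear0 grankK // eqxx => /esym/eqP.
by rewrite oner_eq0.
Qed.

Lemma gone_mul x : gone ** x = x.
Proof.
rewrite [x]gcoord_sum (amul_sumr algV); apply: eq_bigr => k _.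
rewrite (amulZr algV); congr (_ *: _).
rewrite (amul_suml algV) (bigD1 (gam k).1.1) //= big1 => [|i /negPf ik].
  by rewrite addr0 mulB ?gamH // eqxx mul1g; have [-> _] := al1 (gamH k); rewrite scale1r.
by rewrite mulB ?gamH // ik.
Qed.

Lemma mul_gone x : x ** gone = x.
Proof.
rewrite [x]gcoord_sum (amul_suml algV); apply: eq_bigr => k _.
rewrite (amulZl algV); congr (_ *: _).
rewrite (amul_sumr algV) (bigD1 (gam k).2) //= big1 => [|i /negPf ik].
  by rewrite addr0 mulB ?gamH // eqxx mulg1; have [_ ->] := al1 (gamH k); rewrite scale1r.
by rewrite mulB ?gamH // eq_sym ik.
Qed.

Lemma gone_gr : gone \in gr 1%g.
Proof.
apply: memv_suml => i _; case: gbB => hB _ _ _.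
by have := hB i _ i H1; rewrite mulg1 mulVg.
Qed.

Lemma groupoid_unital : unital_algebra mul gone.
Proof.
split=> //; [exact: gone_mul|exact: mul_gone|].
apply/eqP => one0; have := B_neq0 index0 index0 H1.
by rewrite -[B _ _ _]gone_mul one0 (amul0x algV) eqxx.
Qed.

Local Notation A := (ualg groupoid_unital).
Local Notation ghom := (ualg_hom (h := groupoid_unital) gr).

(** The scalar is chosen so that a basis element [B i h j] times its dual is the matrix unit
    [B i 1 i]. *)
Definition gdual (k : 'I_n) : V :=
  let: (i, h, j) := gam k in (al h h^-1%g)^-1 *: B j h^-1%g i.

Definition gflip (k : 'I_n) : 'I_n :=
  let: (i, h, j) := gam k in grank (j, h^-1%g, i).

Lemma gam_flip k : gam (gflip k) = ((gam k).2, (gam k).1.2^-1%g, (gam k).1.1).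
Proof.
rewrite /gflip; have := gamH k; case: (gam k) => [[i h] j] /= Hh.
by rewrite grankK // inE HV.
Qed.

Lemma gflipK : involutive gflip.
Proof.
move=> k; apply: enum_val_inj; rewrite !gam_flip /= invgK.
by case: (gam k) => [[]].
Qed.

Definition gweight (k : 'I_n) : F := al (gam k).1.2 (gam k).1.2^-1%g.

Lemma gweight_neq0 k : gweight k != 0.
Proof. by rewrite al0 ?HV ?gamH. Qed.

Lemma gdualE k : gdual k = (gweight k)^-1 *: gbasis (gflip k).
Proof.
by rewrite /gdual /gweight /gbasis gam_flip; case: (gam k) => [[i h] j].
Qed.

Lemma gdeg_flip k : gdeg (gflip k) = (gdeg k)^-1%g.
Proof. by rewrite /gdeg gam_flip /= !invMg invgK mulgA. Qed.

Lemma gdual_gr k : gdual k \in gr (gdeg k)^-1%g.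
Proof. by rewrite gdualE memvZ // -gdeg_flip gbasis_gr. Qed.

Definition gcoord_dual (k : 'I_n) (x : V) : F := gweight k * gcoord (gflip k) x.

Lemma graded_coords_gbasis : graded_coords ghom (gbasis : 'I_n -> A) gdeg gcoord.
Proof.
split.
- by move=> k a x y; rewrite linearP.
- exact: gcoord_gbasis.
- exact: gcoord_sum.
by move=> g x k; apply: gcoord_deg.
Qed.

Lemma graded_coords_gdual :
  graded_coords ghom (gdual : 'I_n -> A) (fun k => (gdeg k)^-1%g) gcoord_dual.
Proof.
split.
- by move=> k a x y; rewrite /gcoord_dual linearP /= mulrDr mulrCA.
- move=> k l; rewrite gdualE /gcoord_dual gcoordZ gcoord_gbasis.
  rewrite (inj_eq (inv_inj gflipK)); case: eqP => [->|_].
    by rewrite mulr1 mulfV ?gweight_neq0.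
  by rewrite !mulr0.
- move=> x; rewrite {1}[x]gcoord_sum (reindex_inj (inv_inj gflipK)).
  apply: eq_bigr => k _; rewrite /gcoord_dual gdualE scalerA mulrAC.
  by rewrite mulfV ?gweight_neq0 // mul1r.
move=> g x k gx; rewrite /gcoord_dual mulf_eq0 negb_or => /andP[_ nz].
by rewrite -gdeg_flip (gcoord_deg gx nz).
Qed.

Lemma gbasis_mul_gdual k l : gbasis k ** gdual l =
  if (gam k).2 == (gam l).2 then
    ((gweight l)^-1 * al (gam k).1.2 (gam l).1.2^-1%g) *:
       B (gam k).1.1 ((gam k).1.2 * (gam l).1.2^-1)%g (gam l).1.1
  else 0.
Proof.
rewrite gdualE (amulZr algV) /gbasis gam_flip /= mulB ?HV ?gamH //.
by case: eqP => _; rewrite ?scaler0 // scalerA.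
Qed.

(** Left multiplication by [B i h j] sends basis elements to multiples of basis elements or to 0. A
    diagonal entry requires [i = j] and [h = 1], and then the [|H| r] elements with row index [i]
    are fixed. *)
Lemma left_trace_B i h j : h \in H ->
  left_trace (gbasis : 'I_n -> A) gcoord (B i h j : A) =
  ((i == j) && (h == 1%g))%:R * (#|H| * r)%:R.
Proof.
move=> Hh; transitivity (\sum_s \sum_(l in H) \sum_(m < r)
    (((i == j) && (h == 1%g)) && (i == s))%:R : F).
  rewrite -(sum_triples (fun p => (((i == j) && (h == 1%g)) && (i == p.1.1))%:R)).
  apply: eq_bigr => k _; rewrite [_ * _]mulB ?gamH //.
  case: eqP => [jk|jk]; last first.
    rewrite linear0; case: eqP => // ij /=; case: eqP => //= _; case: eqP => // ik.
    by case: jk; rewrite -ij.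
  rewrite gcoordZ gcoord_B ?HM ?gamH // -jk.
  case: eqP => [e|ne].
    have [ki kh] : (gam k).1.1 = i /\ (gam k).1.2 = (h * (gam k).1.2)%g.
      by split; [rewrite e|rewrite {1}e].
    have h1 : h = 1%g by apply: (mulIg (gam k).1.2); rewrite mul1g -kh.
    rewrite jk ki h1 !eqxx /=; have [-> _] := al1 (gamH k).
    by rewrite mulr1.
  rewrite mulr0; case: eqP => //= ij; case: eqP => //= h1; case: ne.
  rewrite h1 mul1g ij jk; by case: (gam k) => [[]].
rewrite (bigD1 i) //= [X in _ + X]big1 ?addr0 => [|s si]; last first.
  by rewrite big1 // => l _; rewrite big1 // => m _; rewrite [i == s]eq_sym (negPf si) andbF.
rewrite eqxx andbT (eq_bigr (fun=> ((i == j) && (h == 1%g))%:R * r%:R)).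
  by rewrite sumr_const -[LHS]mulr_natr natrM -mulrA; congr (_ * _); apply: mulrC.
by move=> l _; rewrite sumr_const card_ord mulr_natr.
Qed.

Lemma left_trace_gdual k l :
  left_trace (gbasis : 'I_n -> A) gcoord ((gbasis k : A) * (gdual l : A)) =
  (#|H| * r)%:R * (k == l)%:R.
Proof.
rewrite [_ * _]gbasis_mul_gdual.
have tr := trace_lin graded_coords_gbasis.
have tr0 : left_trace (gbasis : 'I_n -> A) gcoord (0 : A) = 0.
  by have := tr (-1) 0 0; rewrite scaler0 addr0 mulN1r addNr.
case: eqP => [kl2|kl2]; last first.
  by rewrite tr0; case: eqP => [kl|]; rewrite ?mulr0 //; case: kl2; rewrite kl.
have HH : ((gam k).1.2 * (gam l).1.2^-1)%g \in H by rewrite HM ?HV ?gamH.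
have := tr ((gweight l)^-1 * al (gam k).1.2 (gam l).1.2^-1%g)
  (B (gam k).1.1 ((gam k).1.2 * (gam l).1.2^-1)%g (gam l).1.1) 0.
rewrite addr0 tr0 addr0 => ->; rewrite left_trace_B //.
rewrite -eq_mulgV1; case: (eqVneq k l) => [->|kl].
  by rewrite !eqxx /= mul1r mulr1 mulVf ?mul1r ?gweight_neq0.
have -> : ((gam k).1.1 == (gam l).1.1) && ((gam k).1.2 == (gam l).1.2) = false.
  apply/negP => /andP[/eqP e1 /eqP e2]; case/eqP: kl; apply: enum_val_inj.
  by move: e1 e2 kl2; case: (gam k) => [[? ?] ?]; case: (gam l) => [[? ?] ?] /= -> -> ->.
by rewrite mul0r !mulr0.
Qed.

(** On degree 1 this is [|H|] times a matrix trace: there, equal row and column indices force a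
    trivial group part. *)
Definition gkap (a : V) : F :=
  \sum_k gcoord k a * (((gam k).1.1 == (gam k).2)%:R * #|H|%:R).

(** For a nonzero term the column of [gbasis l] and the row and column of [gbasis k] must agree.
    Then degree 1 forces the group part of [gbasis k] to be trivial, and the term is [B s 1 s], once
    for each element of [H]. *)
Lemma casimir_gbasis k : gdeg k = 1%g ->
  \sum_l gbasis l ** gbasis k ** gdual l =
  (((gam k).1.1 == (gam k).2)%:R * #|H|%:R) *: gone.
Proof.
move=> dk; transitivity (\sum_s \sum_(h in H) \sum_(m < r)
   (if (m == (gam k).1.1) && ((gam k).1.1 == (gam k).2) then B s 1%g s else 0)).
  rewrite -(sum_triples (fun p => if (p.2 == (gam k).1.1) && ((gam k).1.1 == (gam k).2)
      then B p.1.1 1%g p.1.1 else 0)).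
  apply: eq_bigr => l _; rewrite -(amulA algV) gbasis_mul_gdual.
  case: (eqVneq (gam l).2 (gam k).1.1) => [lk|lk] /=; last first.
    case: eqP => _; last by rewrite (amulx0 algV).
    by rewrite (amulZr algV) mulB ?HM ?HV ?gamH // (negPf lk) scaler0.
  rewrite lk [X in if X then _ else 0]eq_sym; case: eqP => [k12|_]; last by rewrite (amulx0 algV).
  have k1 : (gam k).1.2 = 1%g.
    move: dk; rewrite /gdeg k12 => /(congr1 (fun x => gs (gam k).2 * x * (gs (gam k).2)^-1)%g).
    by rewrite !mulgA mulgV mul1g mulgK mulg1 mulgV.
  rewrite (amulZr algV) mulB ?HM ?HV ?gamH // lk eqxx k1 mul1g mulgV scalerA.
  have [-> _] := al1 (HV (gamH l)); rewrite mulr1 mulVf ?gweight_neq0 //.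
  by rewrite scale1r.
rewrite /gone scaler_sumr; apply: eq_bigr => s _.
rewrite (eq_bigr (fun=> ((gam k).1.1 == (gam k).2)%:R *: B s 1%g s)).
  by rewrite sumr_const -scaler_nat scalerA mulrC.
move=> h _; rewrite (bigD1 (gam k).1.1) //= eqxx [X in _ + X]big1 ?addr0.
  by case: eqP => _; rewrite ?scale1r ?scale0r.
by move=> m /negPf ->.
Qed.

Lemma casimir_scalar (a : A) : ghom 1%g a ->
  \sum_l (gbasis l : A) * a * (gdual l : A) = (gkap a)%:A.
Proof.
move=> ha; transitivity (\sum_k gcoord k a *: \sum_l gbasis l ** gbasis k ** gdual l).
  under [RHS]eq_bigr do rewrite scaler_sumr.
  rewrite exchange_big; apply: eq_bigr => l _ /=.
  rewrite {1}[a]gcoord_sum mulr_sumr mulr_suml; apply: eq_bigr => k _.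
  by rewrite -scalerAr -scalerAl.
rewrite /gkap scaler_suml; apply: eq_bigr => k _.
have [->|nz] := eqVneq (gcoord k a) 0; first by rewrite mul0r !scale0r.
by rewrite casimir_gbasis ?scalerA // (gcoord_deg ha nz).
Qed.

Definition gidem : V := B index0 1%g index0.
Definition gleft (l : 'I_n) : V := B index0 1%g (gam l).1.1.
Definition gright (l : 'I_n) : V := gdual l ** B (gam l).1.1 1%g index0.
Definition gleft_deg (l : 'I_n) : gT := ((gs index0)^-1 * gs (gam l).1.1)%g.

Lemma gidem_idem : gidem ** gidem = gidem.
Proof.
by rewrite mulB // eqxx mulg1; have [-> _] := al1 H1; rewrite scale1r.
Qed.

Lemma gkap_gidem : gkap gidem != 0.
Proof.
rewrite /gkap (bigD1 (grank (index0, 1%g, index0))) //= big1 => [|k kn].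
  rewrite gcoord_B // grankK ?triple0 // !eqxx addr0 !mul1r natr_eq0_char0 //.
  by rewrite cards_eq0; apply/set0Pn; exists 1%g.
rewrite gcoord_B //; case: eqP => [ke|_]; last by rewrite mul0r.
by case/eqP: kn; apply: enum_val_inj; rewrite ke grankK ?triple0.
Qed.

Lemma gleft_gr l : gleft l \in gr (gleft_deg l).
Proof.
by case: gbB => hB _ _ _; have := hB index0 1%g (gam l).1.1 H1; rewrite mulg1.
Qed.

Lemma gright_gr l : gright l \in gr (gleft_deg l * gdeg l)^-1%g.
Proof.
rewrite invMg; apply: amul_gr (gdual_gr l) _ => //.
rewrite /gleft_deg invMg invgK; case: gbB => hB _ _ _.
by have := hB (gam l).1.1 1%g index0 H1; rewrite mulg1.
Qed.

(** Row, column and degree determine the group part, so distinct basis elements of the same degree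
    differ in row or column and are killed by one of the two factors. *)
Lemma gleft_gright j l : gdeg j = gdeg l ->
  gleft l ** gbasis j ** gright l = if j == l then gidem else 0.
Proof.
move=> djl; rewrite -(amulA algV) /gright (amulA algV (gbasis j)) gbasis_mul_gdual.
case: eqP => [jl2|jl2]; last first.
  rewrite (amul0x algV) (amulx0 algV); case: eqP => // jl; by case: jl2; rewrite jl.
have HH : ((gam j).1.2 * (gam l).1.2^-1)%g \in H by rewrite HM ?HV ?gamH.
rewrite (amulZl algV) mulB // eqxx (amulZr algV) (amulZr algV) mulB ?HM ?HV ?gamH //.
case: (eqVneq j l) => [->|jl].
  rewrite eqxx mulgV !mulg1; have [-> _] := al1 H1.
  by rewrite !scale1r mulVf ?gweight_neq0 // scale1r.
case: eqP => [jl1|_]; last by rewrite !scaler0.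
case/eqP: jl; apply: enum_val_inj; move: djl jl1 jl2; rewrite /gdeg.
case: (gam j) => [[i h] m]; case: (gam l) => [[i' h'] m'] /= d e1 e2.
by move: d; rewrite e1 e2 => /mulIg /mulgI ->.
Qed.

(** Use the factors that detect a basis element with nonzero coordinate in [v]; homogeneity of [v]
    ensures that the others have the same degree and vanish. *)
Lemma gsandwich g (v : V) : v \in gr g -> v <> 0 -> exists h (a c : V),
  [/\ a \in gr h, c \in gr (h * g)^-1%g & a ** v ** c = gidem].
Proof.
move=> gv nz; have [k nzk] : exists k, gcoord k v != 0.
  apply: NNPP => no; apply: nz; rewrite [v]gcoord_sum big1 // => k _.
  have [->|nzk] := eqVneq (gcoord k v) 0; first by rewrite scale0r.
  by case: no; exists k.
have dk := gcoord_deg gv nzk.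
exists (gleft_deg k), (gleft k), ((gcoord k v)^-1 *: gright k); split.
- exact: gleft_gr.
- by rewrite memvZ // -dk gright_gr.
rewrite {1}[v]gcoord_sum (amul_sumr algV) (amul_suml algV) (bigD1 k) //= big1.
  rewrite addr0 !(amulZr algV) (amulZl algV) gleft_gright // eqxx.
  by rewrite scalerA mulVf // scale1r.
move=> j jk; have [->|nzj] := eqVneq (gcoord j v) 0.
  by rewrite scale0r (amulx0 algV) (amul0x algV).
rewrite !(amulZr algV) (amulZl algV) gleft_gright; last first.
  by rewrite dk (gcoord_deg gv nzj).
by rewrite (negPf jk) !scaler0.
Qed.

End GroupoidBasis.

(** * From lists of monomials to graded polynomials *)

Section GPolyOf.
Variables (F : fieldType) (gT : finGroupType).
Local Notation L := (nat * gT)%type.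

Lemma finsupp_gpoly_of (p : ncpoly F L) w : w \in finsupp (gpoly_of p) ->
  exists2 m, m \in p & w = word_of m.2.
Proof.
rewrite mem_finsupp gpoly_ofE => nz.
have [/hasP[m pm /eqP wm]|/hasPn no] := boolP (has (fun m => word_of m.2 == w) p).
  by exists m.
by case/eqP: nz; rewrite big_seq_cond big1 // => m /andP[/no /negPf ->].
Qed.

(** Empty monomials are excluded because [word_of] would turn them into a word with one letter. *)
Lemma galg_eval_gpoly_of (A : algType F) (p : ncpoly F L) (phi : L -> A) :
  (forall m, m \in p -> m.2 <> [::]) -> galg_eval (gpoly_of p) phi = nceval phi p.
Proof.
move=> p0; pose ws := undup [seq word_of m.2 | m <- p].
pose G w := \prod_(v <- letters w) phi v.
transitivity (\sum_(w <- ws) gpoly_of p w *: G w).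
  rewrite (bigID (mem (finsupp (gpoly_of p)))) /= [X in _ = _ + X]big1 ?addr0.
    rewrite -big_filter; apply: perm_big; apply: uniq_perm.
    - exact: fset_uniq.
    - by rewrite filter_uniq ?undup_uniq.
    move=> w; rewrite mem_filter /= mem_undup; case: (boolP (w \in finsupp _)) => //= fw.
    have [m pm ->] := finsupp_gpoly_of fw; symmetry; apply/mapP; by exists m.
  by move=> w nw; rewrite (fsfun_dflt nw) scale0r.
transitivity (\sum_(w <- ws) \sum_(m <- p | word_of m.2 == w) m.1 *: G w).
  by apply: eq_bigr => w _; rewrite gpoly_ofE scaler_suml.
under eq_bigr do rewrite big_mkcond.
rewrite exchange_big /nceval big_seq [RHS]big_seq; apply: eq_bigr => m pm /=.
transitivity (\sum_(w <- ws | w == word_of m.2) m.1 *: G w).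
  by rewrite [RHS]big_mkcond; apply: eq_bigr => w _; rewrite eq_sym.
have mws : word_of m.2 \in ws by rewrite mem_undup; apply/mapP; exists m.
by rewrite sum_pred1_seq ?undup_uniq // mws /G letters_word_of //; apply: p0.
Qed.

Lemma multilinear_gpoly_of (p : ncpoly F L) m : has_content m p -> content_le1 m ->
  (forall a, a \in p -> a.2 <> [::]) -> multilinear (gpoly_of p).
Proof.
case: p => [|a p] pm m1 p0.
  exists [::]; split=> // w fw; by have [] := finsupp_gpoly_of fw.
have cm v : count_mem v a.2 = m v by apply: (pm a); rewrite inE eqxx.
exists a.2; split.
  apply/(@count_mem_uniq _ a.2) => v; rewrite cm.
  have := m1 v; have : (0 < m v)%N = (v \in a.2) by rewrite -cm -has_count has_pred1.
  by case: (m v) => [|[|k]] //= <-.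
move=> w fw; have [c pc ->] := finsupp_gpoly_of fw.
rewrite letters_word_of; last exact: p0.
by apply/allP => v _ /=; rewrite cm (pm c pc).
Qed.

End GPolyOf.

(** * Finitely many isomorphism types *)

Section SameType.
Variables (F : fieldType) (gT : finGroupType) (r : nat) (gs : nat -> gT).
Variables (H : {set gT}) (al : gT -> gT -> F).
Variables (V1 V2 : vectType F) (mul1 : V1 -> V1 -> V1) (mul2 : V2 -> V2 -> V2).
Variables (gr1 : gT -> {vspace V1}) (gr2 : gT -> {vspace V2}).
Hypotheses (alg1 : is_algebra mul1) (alg2 : is_algebra mul2).
Hypotheses (grV1 : is_grading mul1 gr1) (grV2 : is_grading mul2 gr2).
Hypothesis HM : forall h k, h \in H -> k \in H -> (h * k)%g \in H.
Variables (B1 : 'I_r -> gT -> 'I_r -> V1) (B2 : 'I_r -> gT -> 'I_r -> V2).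
Hypotheses (gb1 : groupoid_basis mul1 gr1 gs H al B1)
           (gb2 : groupoid_basis mul2 gr2 gs H al B2).

Definition basis_map (x : V2) : V1 := \sum_k gcoord (H := H) B2 k x *: gbasis B1 k.

Lemma basis_map_is_linear : linear basis_map.
Proof.
move=> a x y; rewrite /basis_map scaler_sumr -big_split; apply: eq_bigr => k _ /=.
by rewrite gcoordP scalerDl scalerA.
Qed.
HB.instance Definition _ := GRing.isLinear.Build F V2 V1 _ basis_map basis_map_is_linear.

Lemma basis_map_gbasis k : basis_map (gbasis B2 k) = gbasis (H := H) B1 k.
Proof.
rewrite /basis_map (bigD1 k) //= (gcoord_gbasis gb2) eqxx scale1r big1 ?addr0 //.
by move=> l /negPf lk; rewrite (gcoord_gbasis gb2) lk scale0r.
Qed.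

Lemma basis_map_B i h j : h \in H -> basis_map (B2 i h j) = B1 i h j.
Proof.
move=> Hh; have pT : (i, h, j) \in triples r H by rewrite inE.
have := basis_map_gbasis (enum_rank_in pT (i, h, j)).
by rewrite /gbasis enum_rankK_in.
Qed.

Lemma basis_mapM x y : basis_map (mul2 x y) = mul1 (basis_map x) (basis_map y).
Proof.
rewrite [x](gcoord_sum gb2) [y](gcoord_sum gb2) (amul_suml alg2) !linear_sum.
rewrite (amul_suml alg1); apply: eq_bigr => k _ /=.
rewrite (amul_sumr alg2) linear_sum (amul_sumr alg1); apply: eq_bigr => l _ /=.
rewrite (amulZl alg2) (amulZr alg2) !linearZ /= (amulZl alg1) (amulZr alg1).
congr (_ *: (_ *: _)); rewrite !basis_map_gbasis.
case: gb1 => _ m1 _ _; case: gb2 => _ m2 _ _.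
rewrite m1 ?gamH // m2 ?gamH //; case: eqP => _; last by rewrite linear0.
by rewrite linearZ /= basis_map_B // HM ?gamH.
Qed.

Lemma basis_map_gr g x : x \in gr2 g -> basis_map x \in gr1 g.
Proof.
move=> gx; apply: memv_suml => k _.
have [->|nz] := eqVneq (gcoord B2 k x) 0; first by rewrite scale0r mem0v.
by rewrite -(gcoord_deg grV2 gb2 gx nz) memvZ // (gbasis_gr gb1).
Qed.

Lemma basis_map_inj0 x : basis_map x = 0 -> x = 0.
Proof.
move=> bx; rewrite [x](gcoord_sum gb2) big1 // => k _.
suff -> : gcoord B2 k x = 0 by rewrite scale0r.
rewrite -[RHS](gcoord0 (H := H) B1 k) -bx gcoord_lin_sum (bigD1 k) //= big1.
  by rewrite gcoordZ (gcoord_gbasis gb1) eqxx mulr1 addr0.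
by move=> l /negPf lk; rewrite gcoordZ (gcoord_gbasis gb1) eq_sym lk mulr0.
Qed.

Lemma basis_map_geval phi (f : gpoly F gT) :
  basis_map (geval mul2 phi f) = geval mul1 (basis_map \o phi) f.
Proof.
rewrite /geval linear_sum; apply: eq_bigr => -[v s] _ /=; rewrite linearZ /=.
congr (_ *: _); rewrite /eval_word /=.
by elim: s (phi v) => //= u s IHs x; rewrite IHs basis_mapM.
Qed.

(** Identities are pulled back along [basis_map], an injective graded homomorphism from the second
    algebra to the first. *)
Lemma same_type_identity f :
  graded_identity mul1 gr1 fullv f -> graded_identity mul2 gr2 fullv f.
Proof.
move=> id1 phi gphi; apply: basis_map_inj0; rewrite basis_map_geval; apply: id1.
move=> v; have := gphi v; rewrite !memv_cap !memvf /=; exact: basis_map_gr.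
Qed.

End SameType.

Lemma roots_of_unity_seq (F : closedFieldType) n : (0 < n)%N ->
  exists rs : seq F, forall a, a ^+ n = 1 -> a \in rs.
Proof.
move=> n0; have [rs rsE] := closed_field_poly_normal ('X^n - 1 : {poly F}).
exists rs => a an; have : root ('X^n - 1 : {poly F}) a by rewrite rootE !hornerE an subrr.
rewrite rsE rootZ ?root_prod_XsubC //.
by rewrite lead_coef_eq0 -size_poly_eq0 size_XnsubC.
Qed.

(* Up to isomorphism there are finitely many graded simple algebras of bounded
   dimension, so one polynomial can be made to vanish on all the bad ones. *)
Theorem graded_simple_separation (F : closedFieldType) (gT : finGroupType)
    (V : vectType F) (mul : V -> V -> V) (gr : gT -> {vspace V}) (n0 : nat) :
  [pchar F] =i pred0 -> is_algebra mul -> is_grading mul gr ->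
  graded_simple mul gr fullv ->
  exists m : gpoly F gT, e_central mul gr fullv m /\
    forall (W : vectType F) (mulW : W -> W -> W) (grW : gT -> {vspace W}),
      is_algebra mulW -> is_grading mulW grW -> graded_simple mulW grW fullv ->
      (\dim {:W} <= n0)%N ->
      ~ (forall f : gpoly F gT,
           graded_identity mulW grW fullv f -> graded_identity mul gr fullv f) ->
      graded_identity mulW grW fullv m.
Proof.
move=> char0 algV grV simV.
have nz_root (n : nat) (a : F) : a ^+ n.+1 = 1 -> a != 0.
  by move=> an; apply/eqP => a0; move/eqP: an; rewrite a0 expr0n eq_sym oner_eq0.
have unital (W : vectType F) (mulW : W -> W -> W) (grW : gT -> {vspace W}) :
    is_algebra mulW -> is_grading mulW grW -> graded_simple mulW grW fullv ->
    exists one, unital_algebra mulW one /\ one \in grW 1%g.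
  move=> aW gW sW.
  have [r [gs [H [al [B [gb /andP[r0 _] [H1 _ _] _ al1]]]]]] :=
    graded_simple_structure aW gW sW.
  exists (gone B); split; last exact: (gone_gr gb H1).
  exact: (groupoid_unital aW gb r0 H1 al1).
have [r [gs [H [al [B [gb /andP[r0 _] [H1 HM HV] alr al1]]]]]] :=
  graded_simple_structure algV grV simV.
have al0 h k : h \in H -> k \in H -> al h k != 0.
  move=> Hh Hk; have := alr h k Hh Hk; rewrite -(prednK (fact_gt0 #|gT|)).
  exact: nz_root.
pose hV := groupoid_unital algV gb r0 H1 al1.
have [homD homZ hom0 homI homM] := ualg_hom_closed hV grV (gone_gr gb H1).
have [rs rsP] := roots_of_unity_seq F (fact_gt0 #|gT|).
(* A finite type coding size, row degrees, support and cocycle, the last by positions in the list of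
   roots of unity. *)
pose Ty := ('I_n0.+1 * {ffun 'I_n0 -> gT} * {set gT} * {ffun gT * gT -> 'I_(size rs)})%type.
pose gsT (T : Ty) := ord_apply 1%g T.1.1.2.
pose alT (T : Ty) h k := rs`_(T.2 (h, k)).
pose has_type (T : Ty) (W : vectType F) mulW grW := exists B : 'I_(T.1.1.1) -> gT -> 'I_(T.1.1.1) -> W,
  groupoid_basis mulW grW (gsT T) T.1.2 (alT T) B /\
  forall h k, h \in T.1.2 -> k \in T.1.2 -> (h * k)%g \in T.1.2.
have type_exists (W : vectType F) (mulW : W -> W -> W) (grW : gT -> {vspace W}) :
    is_algebra mulW -> is_grading mulW grW -> graded_simple mulW grW fullv ->
    (\dim {:W} <= n0)%N -> exists T, has_type T W mulW grW.
  move=> aW gW sW dW.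
  have [r' [gs' [H' [al' [B' [gb' /andP[_ r'd] [H1' HM' _] alr' _]]]]]] :=
    graded_simple_structure aW gW sW.
  have r'n : (r' <= n0)%N := leq_trans r'd dW.
  have ex (p : gT * gT) : exists i : 'I_(size rs),
      p.1 \in H' -> p.2 \in H' -> rs`_i = al' p.1 p.2.
    have [/andP[Hh Hk]|nH] := boolP ((p.1 \in H') && (p.2 \in H')).
      have ars := rsP _ (alr' _ _ Hh Hk).
      have ir : (index (al' p.1 p.2) rs < size rs)%N by rewrite index_mem.
      by exists (Ordinal ir) => _ _ /=; rewrite nth_index.
    have ars := rsP 1 (expr1n _ _).
    have ir : (index (1%R : F) rs < size rs)%N by rewrite index_mem.
    by exists (Ordinal ir) => Hh Hk; rewrite Hh Hk in nH.
  have [a aP] := fin_all_exists ex.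
  have r'n1 : (r' < n0.+1)%N by [].
  exists (Ordinal r'n1, [ffun i : 'I_n0 => gs' i], H', [ffun p => a p]), B'.
  split=> //; case: gb' => b1 b2 b3 b4; split=> //.
    move=> i h j Hh; have := b1 i h j Hh.
    have gsE (k : 'I_r') : gsT (Ordinal r'n1, [ffun i : 'I_n0 => gs' i], H', [ffun p => a p]) k = gs' k.
      rewrite /gsT /=; have kn : (k < n0)%N := leq_trans (ltn_ord k) r'n.
      by rewrite (ord_applyE _ _ (Ordinal kn)) ffunE.
    by rewrite !gsE.
  move=> i h j k h' l Hh Hh'; rewrite b2 // /alT /= ffunE.
  by rewrite (aP (h, h')).
pose bad (T : Ty) := exists (W : vectType F) mulW grW, [/\ is_algebra mulW,
  is_grading mulW grW, has_type T W mulW grW & exists2 f : gpoly F gT,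
  graded_identity mulW grW fullv f & ~ graded_identity mul gr fullv f].
have exb T : exists b : bool, b <-> bad T.
  by case: (classic (bad T)) => h; [exists true|exists false]; split.
have [bb bbP] := fin_all_exists exb.
pose TT := [set T | bb T].
have exd (t : 'I_#|TT|) : exists d : ncpoly F (nat * gT)%type * gT * (nat * gT -> nat),
  [/\ has_content d.2 d.1.1, content_le1 d.2,
    (exists2 psi, graded_map (ualg_hom (h := hV) gr) psi & nceval psi d.1.1 <> 0),
    forall phi, graded_map (ualg_hom (h := hV) gr) phi ->
      ualg_hom (h := hV) gr d.1.2 (nceval phi d.1.1) &
    forall (W : vectType F) mulW grW one (hW : unital_algebra mulW one),
      is_algebra mulW -> is_grading mulW grW -> one \in grW 1%g ->
      has_type (enum_val t) W mulW grW ->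
      nc_identity (ualg_hom (h := hW) grW) d.1.1].
  (* One representative [W0] of a bad type supplies the identity [f]; [same_type_identity] transfers
     it to all algebras of that type. *)
  have := enum_valP t; rewrite inE => /bbP[W0 [mulW0 [grW0 [aW0 gW0 [B0 [gb0 HM0]] [f idf nidf]]]]].
  have [phi [gphi nzphi]] : exists phi, graded_subst gr fullv phi /\ geval mul phi f <> 0.
    apply: NNPP => no; apply: nidf => phi gphi; apply: NNPP => nz.
    by apply: no; exists phi.
  have gphi' : graded_map (ualg_hom (h := hV) gr) phi.
    by move=> v; have := gphi v; rewrite memv_cap memvf.
  have nzphi' : galg_eval (A := ualg hV) f phi <> 0 by rewrite -gevalE.
  have [p [g [m [pm m1 [psi gpsi nzpsi] sep]]]] :=
    multilinear_separation char0 hom0 gphi' nzphi'.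
  exists (degree_part g p, g, m); split=> //=.
  - by move=> w; rewrite mem_filter => /andP[_ pw]; apply: pm.
  - by exists psi.
  - by move=> chi gchi; apply: degree_part_hom.
  move=> W mulW grW one hW aW gW oneW [B1 [gb1 _]].
  have [hD hZ h0 hI hM] := ualg_hom_closed hW gW oneW.
  apply: sep => // [x|chi gchi]; first exact: ualg_hom_direct.
  rewrite -gevalE; apply: (same_type_identity aW0 aW gW HM0 gb0 gb1 idf).
  by move=> v; rewrite memv_cap memvf; apply: (gchi v).
have [d dP] := fin_all_exists exd.
have N0 : (#|H| * r)%:R != 0 :> F.
  rewrite natr_eq0_char0 // muln_eq0 negb_or -!lt0n r0 andbT.
  by apply/card_gt0P; exists 1%g.
have n_gt0 : (0 < #|triples r H|)%N.
  by apply/card_gt0P; exists (index0 r0, 1%g, index0 r0); apply: triple0.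
have nzq t : exists2 psi, graded_map (ualg_hom (h := hV) gr) psi &
    nceval psi (d t).1.1 <> 0 by have [] := dP t.
have hq t phi : graded_map (ualg_hom (h := hV) gr) phi ->
    ualg_hom (h := hV) gr (d t).1.2 (nceval phi (d t).1.1).
  by have [_ _ _ + _] := dP t; apply.
have cq t : has_content (d t).2 (d t).1.1 by have [] := dP t.
have cq1 t : content_le1 (d t).2 by have [] := dP t.
have [p [[mp [pm mp1 [v0 mv0]]] pscal [chi gchi nzchi] pid]] :=
  @graded_central_polynomial F (ualg hV) gT (ualg_hom gr) _ (gdeg gs (H := H))
   (gbasis B) (gcoord B) (gdual al B) (gcoord_dual al B r0 H1) (#|H| * r)%:R
   (gkap H B) (gidem B r0) (gleft_deg gs r0 (H := H)) (gleft B r0) (gright mul al B r0)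
   _ (fun t => (d t).1.1) (fun t => (d t).1.2) (fun t => (d t).2)
   char0 homD homZ hom0 homI homM n_gt0
   (graded_coords_gbasis algV grV gb r0 H1 al1)
   (graded_coords_gdual algV grV gb r0 H1 HV al0 al1)
   (gbasis_gr gb) (gdual_gr gb r0 H1 HV) N0
   (left_trace_gdual algV grV gb r0 H1 HM HV al0 al1)
   (fun a ha => casimir_scalar grV HM HV al0 ha)
   (gidem_idem gb r0 H1 al1) (gkap_gidem char0 gb r0 H1)
   (gleft_gr gb r0 H1) (gright_gr algV grV gb r0 H1 HV)
   (gleft_gright algV gb r0 H1 HM HV al0 al1)
   (gsandwich algV grV gb r0 H1 HM HV al0 al1) nzq hq cq cq1.
have p0 a : a \in p -> a.2 <> [::].
  by move=> /pm/(_ v0); rewrite mv0 => + a0; rewrite a0.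
have evalV phi : geval mul phi (gpoly_of p) = nceval (A := ualg hV) phi p.
  by rewrite (gevalE (h := hV)) galg_eval_gpoly_of.
exists (gpoly_of p); split.
  split; first exact: multilinear_gpoly_of pm mp1 p0.
    move=> idp; apply: nzchi; rewrite -evalV; apply: idp => v.
    by rewrite memv_cap memvf; apply: gchi.
  move=> phi gphi; have [|c pc] := pscal phi.
    by move=> v; have := gphi v; rewrite memv_cap memvf.
  rewrite evalV pc; split.
    by rewrite memv_cap memvf; apply: (homZ 1%g c 1 homI).
  move=> a _; change ((c%:A : ualg hV) * (a : ualg hV) = (a : ualg hV) * c%:A).
  by rewrite -scalerAl -scalerAr mul1r mulr1.
move=> W mulW grW aW gW sW dW nW.
have [one [hW oneW]] := unital W mulW grW aW gW sW.
have [T TW] := type_exists W mulW grW aW gW sW dW.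
have bT : T \in TT.
  rewrite inE; apply/bbP; exists W, mulW, grW; split=> //.
  apply: NNPP => no; apply: nW => f idf; apply: NNPP => nidf.
  by apply: no; exists f.
have := dP (enum_rank_in bT T); rewrite enum_rankK_in // => -[_ _ _ _ idW].
have idT := idW W mulW grW one hW aW gW oneW TW.
move=> phi gphi; rewrite (gevalE (h := hW)) galg_eval_gpoly_of //.
apply: (pid _ _ _ idT) => v.
by have := gphi v; rewrite memv_cap memvf.
Qed.

(** * Graded simple components *)

Section Subalgebra.
Variables (F : fieldType) (gT : finGroupType) (V : vectType F).
Variables (mul : V -> V -> V) (gr : gT -> {vspace V}) (S : {vspace V}).
Hypotheses (algV : is_algebra mul) (grV : is_grading mul gr).
Hypothesis simS : graded_simple mul gr S.

(** The structure theory concerns a whole space, whereas a component is a subspace of [V]; hence the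
    transport to [subvs_of S]. *)
Definition sub_mul (x y : subvs_of S) : subvs_of S := vsproj S (mul (vsval x) (vsval y)).

Definition sub_gr (g : gT) : {vspace subvs_of S} := (linfun (@vsval _ _ S) @^-1: gr g)%VS.

Lemma mul_closed x y : x \in S -> y \in S -> mul x y \in S.
Proof.
by case: simS => [[_ /subvP subS] _ _] Sx Sy; apply: subS; apply: mem_prodv.
Qed.

Lemma vsval_mul x y : vsval (sub_mul x y) = mul (vsval x) (vsval y).
Proof. by rewrite vsprojK // mul_closed // subvsP. Qed.

Lemma mem_sub_gr g x : (x \in sub_gr g) = (vsval x \in gr g).
Proof. by rewrite -memv_preim lfunE. Qed.

Lemma sub_is_algebra : is_algebra sub_mul.
Proof.
have vP a (x y : subvs_of S) : vsval (a *: x + y) = a *: vsval x + vsval y.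
  exact: linearP.
split.
- move=> a x y z; apply: subvs_inj.
  by rewrite vsval_mul !vP !vsval_mul (amulDl algV) (amulZl algV).
- move=> a x y z; apply: subvs_inj.
  by rewrite vsval_mul !vP !vsval_mul (amulDr algV) (amulZr algV).
by move=> x y z; apply: subvs_inj; rewrite !vsval_mul (amulA algV).
Qed.

Lemma sub_is_grading : is_grading sub_mul sub_gr.
Proof.
have sub_alg := sub_is_algebra.
split.
- apply/directv_sum_independent => us hus us0 g _; apply: subvs_inj.
  have [/directv_sum_independent dir _ _] := grV.
  apply: (dir (fun g => vsval (us g))) => // [k _|]; first by rewrite -mem_sub_gr hus.
  by have := congr1 vsval us0; rewrite linear_sum.
- apply/eqP; rewrite eqEsubv subvf; apply/subvP => x _.
  have [[/subvP Sgr _] _ _] := simS.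
  have /memv_sumP[u uS xu] := Sgr _ (subvsP x).
  have -> : x = \sum_g vsproj S (u g).
    by rewrite -[LHS]vsvalK xu linear_sum.
  apply: memv_sumr => g _; have := uS g isT; rewrite memv_cap => /andP[Su gu].
  by rewrite mem_sub_gr vsprojK.
move=> g h; apply: prodv_subP => x y; rewrite !mem_sub_gr vsval_mul => gx gy.
exact: amul_gr.
Qed.

Lemma sub_graded_simple : graded_simple sub_mul sub_gr fullv.
Proof.
have sub_alg := sub_is_algebra; have [_ sumS _] := sub_is_grading.
have [[Sgr subS] nzS simI] := simS.
split.
- split; last exact: subvf.
  rewrite /graded_subspace -{1}sumS; apply/subv_sumP => g _.
  by apply: subv_trans (sumv_sup g _ (subvv _)); rewrite ?capfv.
- apply: contra nzS => /eqP S0; rewrite -subv0; apply: prodv_subP => x y Sx Sy.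
  have := mem_prodv sub_alg (memvf (vsproj S x)) (memvf (vsproj S y)).
  rewrite S0 memv0 => /eqP/(congr1 vsval); rewrite vsval_mul !vsprojK // => ->.
  exact: mem0v.
move=> I [grI [_ SI IS]]; pose J := (linfun (@vsval _ _ S) @: I)%VS.
have memJ x : x \in I -> vsval x \in J by move=> Ix; rewrite -[vsval x]lfunE memv_img.
have JP y : y \in J -> exists2 x, x \in I & y = vsval x.
  by case/memv_imgP => x Ix ->; exists x; rewrite ?lfunE.
have JS : (J <= S)%VS by apply/subvP => y /JP[x _ ->]; apply: subvsP.
case: (simI J).
- split.
    apply/subvP => y /JP[x /(subvP grI)/memv_sumP[u uI ->] ->].
    rewrite linear_sum; apply: memv_sumr => g _; have := uI g isT.
    by rewrite !memv_cap mem_sub_gr => /andP[/memJ -> ->].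
  split=> //; apply: prodv_subP => y z.
    move=> Sy /JP[x Ix ->]; rewrite -(vsprojK Sy) -vsval_mul; apply: memJ.
    by apply: (subvP SI); apply: mem_prodv => //; apply: memvf.
  move=> /JP[x Ix ->] Sz; rewrite -(vsprojK Sz) -vsval_mul; apply: memJ.
  by apply: (subvP IS); apply: mem_prodv => //; apply: memvf.
- move=> J0; left; apply/eqP; rewrite -subv0; apply/subvP => x /memJ.
  by rewrite J0 !memv0 -(inj_eq subvs_inj) linear0.
move=> JE; right; apply/eqP; rewrite eqEsubv subvf; apply/subvP => x _.
have /JP[x' Ix' /subvs_inj -> //] : vsval x \in J by rewrite JE subvsP.
Qed.

Lemma vsval_geval phi (f : gpoly F gT) :
  vsval (geval sub_mul phi f) = geval mul (fun v => vsval (phi v)) f.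
Proof.
rewrite /geval linear_sum; apply: eq_bigr => -[v s] _; rewrite linearZ /=.
congr (_ *: _); rewrite /eval_word /=.
by elim: s (phi v) => //= u s IHs x; rewrite IHs vsval_mul.
Qed.

Lemma sub_graded_subst phi : graded_subst sub_gr fullv phi <->
  graded_subst gr S (fun v => vsval (phi v)).
Proof.
split=> gphi v; have := gphi v; rewrite !memv_cap mem_sub_gr ?memvf ?subvsP //.
Qed.

Lemma graded_substK phi : graded_subst gr S phi ->
  phi = (fun v => vsval (vsproj S (phi v))).
Proof.
move=> gphi; apply: functional_extensionality => v; rewrite vsprojK //.
by have := gphi v; rewrite memv_cap => /andP[].
Qed.

Lemma sub_graded_identity f :
  graded_identity sub_mul sub_gr fullv f <-> graded_identity mul gr S f.
Proof.
split=> idf phi gphi; last first.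
  by apply: subvs_inj; rewrite vsval_geval linear0; apply: idf; apply/sub_graded_subst.
rewrite (graded_substK gphi) -vsval_geval idf ?linear0 //.
by apply/sub_graded_subst; rewrite -graded_substK.
Qed.

Lemma sub_e_central f : e_central sub_mul sub_gr fullv f -> e_central mul gr S f.
Proof.
case=> mf nf cf; split=> // [/sub_graded_identity //|phi gphi].
have [|c1 c2] := cf (fun v => vsproj S (phi v)).
  by apply/sub_graded_subst; rewrite -graded_substK.
rewrite (graded_substK gphi) -vsval_geval memv_cap subvsP /=; split.
  by move: c1; rewrite memv_cap mem_sub_gr => /andP[].
by move=> a Sa; rewrite -(vsprojK Sa) -!vsval_mul c2 ?memvf.
Qed.

End Subalgebra.

Theorem theorem4p5 (F : closedFieldType) (gT : finGroupType)
  (V : vectType F) (mul : V -> V -> V) (gr : gT -> {vspace V})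
  (Ass : {vspace V}) (q : nat) (Acomp : 'I_q -> {vspace V}) :
  [pchar F] =i pred0 ->
  is_algebra mul -> is_grading mul gr ->
  max_graded_ss_supplement mul gr Ass ->
  directv (\sum_(i < q) Acomp i)%VS ->
  (\sum_(i < q) Acomp i)%VS = Ass ->
  (forall i, graded_ideal mul gr Ass (Acomp i) /\ graded_simple mul gr (Acomp i)) ->
  forall i : 'I_q, exists m : gpoly F gT,
    e_central mul gr (Acomp i) m /\
    forall (W : vectType F) (mulW : W -> W -> W) (grW : gT -> {vspace W}),
      is_algebra mulW -> is_grading mulW grW ->
      graded_simple mulW grW fullv ->
      (forall g, \dim (grW g) = \dim (Acomp i :&: gr g)%VS) ->
      ~ (forall f : gpoly F gT,
           graded_identity mulW grW fullv f -> graded_identity mul gr (Acomp i) f) ->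
      graded_identity mulW grW fullv m.
Proof.
move=> char0 algV grV _ _ _ simA i; have [_ simS] := simA i.
have [m [cm idm]] := graded_simple_separation (\sum_g \dim (Acomp i :&: gr g)%VS)
  char0 (sub_is_algebra algV simS) (sub_is_grading algV grV simS)
  (sub_graded_simple algV grV simS).
exists m; split; first exact: sub_e_central cm.
move=> W mulW grW aW gW sW dW nW; apply: (idm W mulW grW) => //.
  (* Condition (b) enters here: summed over the degrees it gives the dimension bound. *)
  case: (gW) => /directvP /= dirW sumW _; rewrite -sumW dirW.
  by apply: leq_sum => g _; rewrite dW.
by move=> idW; apply: nW => f /idW /sub_graded_identity; apply.
Qed.
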